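(* Let $\mu>0$. There exist positive numbers $\varepsilon_k$ and $c_k$ (indexed by integers $k\ge2$) such that, setting $$\Phi_k(u)=\int_{(0,1)}\Big(\min\Big\{(u')^2,\frac1{\varepsilon_k}\Big\}+c_k\,\varepsilon_k^{2k-1}(u^{(k)})^2\Big)\,dt,\qquad u\in H^k(0,1),$$ the $\Gamma$-limit of $\Phi_k$ as $k\to+\infty$, with respect to the convergence in measure and with respect to the $L^1$-convergence, is given by $$\Gamma\text{-}\lim_{k\to+\infty}\Phi_k(u)=\int_{(0,1)}(u')^2\,dt+\mu\,\#S(u)$$ on $SBV_2(0,1)$.
   Context: $SBV_2(0,1)$ is the space of functions $u\in BV(0,1)$ whose distributional derivative is a measure of the form $Du=u'\mathcal L^1+\sum_{t\in S(u)}(u(t+)-u(t-))\delta_t$ with $u'\in L^2(0,1)$; here $u'$ is the approximate gradient of $u$, $S(u)$ the set of jump points of $u$, and $u(t\pm)$ the right-hand and left-hand limits at $t$; $\#S(u)\in\mathbb N\cup\{+\infty\}$ is the number of jump points. Functionals are understood to take the value $+\infty$ outside their stated domain ($H^k(0,1)$ for $\Phi_k$, $SBV_2(0,1)$ for the limit). *)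

(* Defs.v *)
(* MathComp-Analysis. *)
From HB Require Import structures.
From mathcomp Require Import all_boot all_order all_algebra.
From mathcomp Require Import all_classical all_reals all_analysis.

Set Implicit Arguments.
Unset Strict Implicit.
Unset Printing Implicit Defensive.

Import Order.TTheory GRing.Theory Num.Theory.
Import numFieldNormedType.Exports.

Local Open Scope classical_set_scope.
Local Open Scope ring_scope.

(* Functions on (0,1) are total functions [R -> R] whose values outside ]0, 1[
   play no role.  They stand for their classes modulo a.e. equality: between
   (Borel) measurable functions, every notion below is invariant under
   modification on a null subset of ]0, 1[. *)

Section defs.
Context {R : realType}.
Implicit Types (u v f g phi : R -> R) (t l a z : R) (k : nat).

Local Notation leb := (@lebesgue_measure R).

Definition I01 : set R := `]0, 1[%classic.

Definition L0 f : Prop := measurable_fun I01 f.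

Definition L1 f : Prop := leb.-integrable I01 (EFin \o f).

Definition L2 f : Prop :=
  measurable_fun I01 f /\ (\int[leb]_(t in I01) (f t ^+ 2)%:E < +oo)%E.

Definition cvg_in_measure (v : nat -> R -> R) u : Prop :=
  forall d : R, 0 < d ->
    (fun k => leb (I01 `&` [set t | d <= `|v k t - u t|])) @ \oo --> 0%E.

Definition cvg_in_L1 (v : nat -> R -> R) u : Prop :=
  (fun k => \int[leb]_(t in I01) (`|v k t - u t|)%:E)%E @ \oo --> 0%E.

(* C_c^infty(0,1) *)
Definition test_function phi : Prop :=
  (forall (n : nat) t, derivable (derive1n n phi) t 1) /\
  (exists a b : R, [/\ 0 < a, b < 1 &
     forall t, ~ `[a, b]%classic t -> phi t = 0]).

Definition is_weak_derivative (j : nat) u g : Prop :=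
  [/\ locally_integrable I01 u, locally_integrable I01 g &
    forall phi, test_function phi ->
      \int[leb]_(t in I01) (u t * derive1n j phi t) =
      (- 1) ^+ j * \int[leb]_(t in I01) (g t * phi t)].

(* u^(j); a representative is chosen, or 0 if there is no weak derivative. *)
Definition weak_derivative (j : nat) u : R -> R :=
  xget (cst 0) [set g | is_weak_derivative j u g].

Definition sobolevH k u : Prop :=
  forall j : nat, (j <= k)%N -> exists2 g, is_weak_derivative j u g & L2 g.

(* Du = nu on (0,1).  The integral of phi against the signed measure nu is
   computed from its Jordan decomposition, which does not depend on the Hahn
   decomposition P, N. *)
Definition is_distributional_derivative u
    (nu : {charge set (measurableTypeR R) -> \bar R}) : Prop :=
  forall (P N : set (measurableTypeR R)) (nuPN : hahn_decomposition nu P N) phi,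
    test_function phi ->
    \int[leb]_(t in I01) (u t * derive1 phi t) =
    - (\int[jordan_pos nuPN]_(t in I01) phi t -
       \int[jordan_neg nuPN]_(t in I01) phi t).

Definition BV u : Prop :=
  L1 u /\ exists nu, is_distributional_derivative u nu.

(* l is the limit of u in the sense of density at t. *)
Definition is_approx_limit u t l : Prop :=
  forall d : R, 0 < d ->
    (fun r : R =>
       let A : set R := `]t - r, t + r[ `&` [set s | d <= `|u s - l|] in
       (leb A * ((2 * r)^-1)%:E)%E) @ 0^'+ --> 0%E.

Definition approx_differentiable_at u t a : Prop :=
  exists2 z, is_approx_limit u t z &
    is_approx_limit (fun s => (u s - z) / (s - t)) t a.

(* The approximate gradient u', defined for a.e. t when u is in BV(0,1); a
   measurable representative is chosen (0 if there is none). *)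
Definition approx_gradient u : R -> R :=
  xget (cst 0) [set g | measurable_fun I01 g /\
    {ae leb, forall t, I01 t -> approx_differentiable_at u t (g t)}].

(* One-sided limits are those of some representative of the a.e. class of u;
   the value does not depend on the representative. *)
Definition is_right_limit u t l : Prop :=
  exists2 v, {ae leb, forall s, I01 s -> v s = u s} & v s @[s --> t^'+] --> l.

Definition is_left_limit u t l : Prop :=
  exists2 v, {ae leb, forall s, I01 s -> v s = u s} & v s @[s --> t^'-] --> l.

Definition right_limit u t : R := xget 0 [set l | is_right_limit u t l].

Definition left_limit u t : R := xget 0 [set l | is_left_limit u t l].

Definition jump_set u : set R :=
  [set t | I01 t /\ exists l l' : R,
     [/\ is_left_limit u t l, is_right_limit u t l' & l != l']].

Definition jump u t : R := right_limit u t - left_limit u t.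

(* Sum over A of a summable family of either sign. *)
Definition signed_sum (A : set R) f : \bar R :=
  (\esum_(t in A) (EFin \o f)^\+ t - \esum_(t in A) (EFin \o f)^\- t)%E.

Definition SBV2 u : Prop :=
  [/\ BV u, L2 (approx_gradient u), summable (jump_set u) (EFin \o jump u) &
    exists2 nu, is_distributional_derivative u nu &
      forall B : set (measurableTypeR R), measurable B -> B `<=` I01 ->
        nu B = (\int[leb]_(t in B) (approx_gradient u t)%:E +
                signed_sum (jump_set u `&` B) (jump u))%E].

Definition Phi (eps c : nat -> R) k u : \bar R :=
  if `[< sobolevH k u >] then
    (\int[leb]_(t in I01)
       (Num.min (weak_derivative 1 u t ^+ 2) (1 / eps k) +
        c k * eps k ^+ (2 * k - 1) * weak_derivative k u t ^+ 2)%:E)%E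
  else +oo%E.

Definition MumfordShah (mu : R) u : \bar R :=
  if `[< SBV2 u >] then
    (\int[leb]_(t in I01) (approx_gradient u t ^+ 2)%:E +
     mu%:E * counting (jump_set u))%E
  else +oo%E.

(* G is the Gamma-limit on the space X of F_k as k tends to infinity.  The
   sequential definition is used; both convergences above are metrizable. *)
Definition is_Gamma_limit (X : set (R -> R))
    (conv : (nat -> R -> R) -> (R -> R) -> Prop)
    (F : nat -> (R -> R) -> \bar R) (G : (R -> R) -> \bar R) : Prop :=
  forall u, X u ->
    (forall v : nat -> R -> R, (forall k, X (v k)) -> conv v u ->
       (G u <= limn_einf (fun k => F k (v k)))%E) /\
    (exists v : nat -> R -> R, [/\ forall k, X (v k), conv v u &
       (limn_esup (fun k => F k (v k)) <= G u)%E]).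

End defs.

(* Main.v *)
(* Lower bound. Where [|u'| > eps ^- 1/2] the truncated density is [1 / eps], so a sequence of
   bounded energy is bad only on a set of measure [O(eps)]. Off this set the gradients are weakly
   compact; to cross a jump, the bad set near it must have measure at least about [mu * eps].
   Indeed, [c] is chosen so that on a bad set of measure [b * eps] with [b < mu] the [k]-th
   derivative moves the function by at most [(b / mu) ^ k], up to a polynomial in [k]: at good
   points on both sides all lower derivatives are negligible, because [eps] is small depending on
   [k], and the remainder of interpolation at Chebyshev nodes gains a factor of order [4 ^- k] over
   Taylor's formula. Weak limits of the truncated gradients are taken along an ultrafilter and
   identified by Radon-Nikodym.

   Upper bound. A finite-energy [u] is a.e. [C + prim g + stepsum s z]. The absolutely continuous
   part is replaced by its Bernstein polynomial of degree [k - 1], which has no [k]-th derivative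
   and whose Dirichlet energy does not exceed that of the function (Jensen), and each jump by a
   rescaling to width [mu * eps] of the normalized primitive of [(x (1 - x)) ^ k], whose [k]-th
   derivative has, up to a polynomial in [k], the smallest norm. *)
Require Import Defs.
From HB Require Import structures.
From mathcomp Require Import all_boot all_order all_algebra.
From mathcomp Require Import all_classical all_reals all_analysis.
From mathcomp Require Import measurable_realfun.
From mathcomp Require Import ring lra zify.
Set Implicit Arguments.
Unset Strict Implicit.
Unset Printing Implicit Defensive.
Import Order.TTheory GRing.Theory Num.Theory.
Import numFieldNormedType.Exports.
Local Open Scope classical_set_scope.
Local Open Scope ring_scope.

(** * Interpolation at Chebyshev nodes *)

(** The two bounds leave only powers of k to spare. A transition of width [mu * eps] already pays
    [mu] through the truncated density, so its derivative of order k must cost nothing in the limit,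
    while a transition narrower by a fixed factor must be impossible at a cost below [mu]. Both can
    hold because a factor [b / mu < 1] in the width enters to the power k and beats every power of
    k: [ck] may be off by such powers, hence the exponent 12 in it, but not by an exponential.
    Interpolating the kernel of the remainder avoids an exponential loss: the factor [4 ^- k] gained
    there is matched by the growth [4 ^ k * k!] of the top derivative of the profile.

    The exponent [2 k - 1] of [eps] makes the price invariant under dilation to unit scale. What is
    left for [eps] to control are end terms whose constants depend on k in an unspecified way.

    The limit of the energies along the ultrafilter is a finitely additive set function that may
    concentrate. The points all of whose neighbourhoods keep at least [mu] are finitely many, and
    off them [u - prim g] is locally constant. *)

Section chains.
Context {R : realType}.
Implicit Types (q g : nat -> R -> R) (p : {poly R}) (x y s t r : R) (m n N : nat).

(** A function with its derivatives, given as a sequence: dilation, sums and shifts of the order act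
    termwise, and nothing is asked of the top member beyond being a derivative. *)
Definition chain q m := forall j, (j < m)%N -> forall t : R, is_derive t (1 : R) (q j) (q j.+1 t).

Lemma chainW q m n : (n <= m)%N -> chain q m -> chain q n.
Proof. by move=> nm qm j jn; apply: qm; exact: leq_trans nm. Qed.

Lemma chain_shift q m : chain q m.+1 -> chain (fun j => q j.+1) m.
Proof. by move=> qm j jm; apply: qm. Qed.

Lemma chain_poly p m : chain (fun j t => (p^`(j)).[t]) m.
Proof. by move=> j _ t; rewrite derivnS; exact: is_derive_poly. Qed.

Lemma chainB q g m : chain q m -> chain g m -> chain (fun j t => q j t - g j t) m.
Proof. by move=> qm gm j jm t; have := qm j jm t; have := gm j jm t => ? ?; apply: is_deriveB. Qed.

Lemma is_derive_continuous (f f' : R -> R) :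
  (forall t : R, is_derive t (1 : R) f (f' t)) -> continuous f.
Proof.
move=> df t; apply/differentiable_continuous; rewrite -derivable1_diffP.
by have [] := df t.
Qed.

Lemma chain_continuous q m j : chain q m -> (j < m)%N -> continuous (q j).
Proof. by move=> qm /qm; exact: is_derive_continuous. Qed.

Lemma mvt (f f' : R -> R) (a b : R) : (forall t : R, is_derive t (1 : R) f (f' t)) ->
  a < b -> exists2 c, a < c < b & f b - f a = f' c * (b - a).
Proof.
move=> df ab; have [|c + ->] := @MVT R f f' a b ab (fun x _ => df x).
  by apply: continuous_subspaceT; exact: is_derive_continuous df.
by rewrite in_itv /= => ?; exists c.
Qed.

Lemma mvt_bound (f f' : R -> R) (a b M : R) :
  (forall t : R, is_derive t (1 : R) f (f' t)) -> a <= b ->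
  (forall t, a <= t <= b -> `|f' t| <= M) -> `|f b - f a| <= M * (b - a).
Proof.
move=> df; rewrite le_eqVlt => /predU1P[-> _|ab h]; first by rewrite !subrr normr0 mulr0.
have [c /andP[ac cb] ->] := mvt df ab.
by rewrite normrM (gtr0_norm (x := b - a)) ?subr_gt0// ler_pM2r ?subr_gt0// h// !ltW.
Qed.

(** The zeros of [q 1] found between consecutive zeros of [q 0] interlace them, so they are again
    strictly increasing and the induction goes on. *)
Lemma rolle_chain N q (z : nat -> R) : chain q N ->
  (forall i, (i < N)%N -> z i < z i.+1) ->
  (forall i, (i <= N)%N -> q 0%N (z i) = 0) ->
  exists2 c, z 0%N <= c <= z N & q N c = 0.
Proof.
elim: N q z => [|N IH] q z cq zi z0; first by exists (z 0%N); rewrite ?lexx ?z0.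
have h i : exists c, (i < N.+1)%N -> z i < c < z i.+1 /\ q 1%N c = 0.
  case: ltnP => [iN|_]; last by exists 0.
  have [c czz] := mvt (cq 0%N isT) (zi i iN).
  rewrite !z0 ?subrr//; last exact: ltnW.
  move=> /esym/eqP; rewrite mulf_eq0 subr_eq0 [in X in _ || X]gt_eqF ?zi// orbF => /eqP c0.
  by exists c.
have [y yP] := choice h.
have [c /andP[c1 c2] qc] := IH (fun j => q j.+1) y (chain_shift cq)
   (fun i iN => lt_trans (andP (yP i (leqW iN)).1).2 (andP (yP i.+1 iN).1).1) (fun i iN => (yP i iN).2).
exists c => //; apply/andP; split.
  by apply: le_trans c1; apply/ltW; have [/andP[]] := yP 0%N isT.
by apply: le_trans c2 _; apply/ltW; have [/andP[]] := yP N (ltnSn N).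
Qed.

Lemma rolle_seq q (a b : R) (l : seq R) : uniq l -> (0 < size l)%N ->
  chain q (size l).-1 -> {in l, forall x, a <= x <= b /\ q 0%N x = 0} ->
  exists2 c, a <= c <= b & q (size l).-1 c = 0.
Proof.
move=> ul l0 cq hl; pose s := sort <=%O l.
have ss : size s = size l by rewrite size_sort.
have srt : sorted <%O s by rewrite lt_sorted_uniq_le sort_uniq ul sort_le_sorted.
have ins i : (i < size l)%N -> nth 0 s i \in l by move=> il; rewrite -(mem_sort <=%O) mem_nth ?ss.
have [|i il|c /andP[c1 c2] qc] := @rolle_chain _ _ (nth 0 s) cq.
- by move=> i il; apply: (sortedP 0 srt); rewrite ss; lia.
- by have [] := hl _ (ins i _); [lia|].
- exists c => //; apply/andP; split.
    by apply: le_trans c1; have [] := hl _ (ins 0%N l0) => /andP[].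
  by apply: le_trans c2 _; have [] := hl _ (ins (size l).-1 _) => [|/andP[]]; [lia|].
Qed.

Definition lagrange N (x : 'I_N -> R) (i : 'I_N) : {poly R} :=
  \prod_(j < N | j != i) ((x i - x j)^-1 *: ('X - (x j)%:P)).

Lemma size_lagrange N (x : 'I_N -> R) i : (size (lagrange x i) <= N)%N.
Proof.
rewrite /lagrange; apply: leq_trans (size_poly_prod_leq _ _) _.
have hs (j : 'I_N) : (size ((x i - x j)^-1 *: ('X - (x j)%:P))%R <= 2)%N.
  by apply: leq_trans (size_scale_leq _ _) _; rewrite size_XsubC.
have : (\sum_(j < N | j != i) size ((x i - x j)^-1 *: ('X - (x j)%:P))%R <= \sum_(j < N | j != i) 2)%N.
  by apply: leq_sum => j _.
have cN : #|[pred j : 'I_N | j != i]| = N.-1.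
  by rewrite (eq_card (B := predC1 i))// cardC1 card_ord.
have N0 : (0 < N)%N by case: N i {x hs cN} => [[]|].
rewrite sum_nat_const !cN => h. move: h; set S := (\sum_(i0 < N | _) _)%N; move=> h; lia.
Qed.

Lemma lagrangeE N (x : 'I_N -> R) : injective x -> forall i j, (lagrange x i).[x j] = (i == j)%:R.
Proof.
move=> xi i j; rewrite /lagrange horner_prod; case: eqVneq => [<-|ij].
  rewrite big1// => k ki; rewrite hornerZ hornerXsubC mulVf// subr_eq0.
  by apply: contra_neq ki => /xi.
by rewrite (bigD1 j) ?[j == i]eq_sym//= hornerZ hornerXsubC subrr mulr0 mul0r.
Qed.

Definition interp N (x : 'I_N -> R) (f : R -> R) : {poly R} := \sum_(i < N) f (x i) *: lagrange x i.

Lemma size_interp N (x : 'I_N -> R) f : (size (interp x f) <= N)%N.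
Proof.
apply: leq_trans (size_sum _ _ _) _; apply/bigmax_leqP => i _.
by apply: leq_trans (size_scale_leq _ _) (size_lagrange x i).
Qed.

Lemma interpE N (x : 'I_N -> R) f : injective x -> forall j, (interp x f).[x j] = f (x j).
Proof.
move=> xi j; rewrite /interp horner_sum (bigD1 j)//= big1 ?addr0 => [|i ij].
  by rewrite hornerZ lagrangeE// eqxx mulr1.
by rewrite hornerZ lagrangeE// (negbTE ij) mulr0.
Qed.

(** A multiple [lam] of the nodal polynomial is added to the interpolant so that the error also
    vanishes at s. With [N + 1] zeros, Rolle's theorem gives a zero of order N, where [lam] is read
    off. *)
Lemma interp_error N (x : 'I_N -> R) q (a b M s : R) : injective x ->
  chain q N -> (forall i, a <= x i <= b) -> a <= s <= b ->
  (forall t, a <= t <= b -> `|q N t| <= M) ->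
  `|q 0%N s - (interp x (q 0%N)).[s]| <= `|\prod_(i < N) (s - x i)| * (M / N`!%:R).
Proof.
move=> xi cq xab sab hM; pose I := interp x (q 0%N).
pose W : {poly R} := \prod_(i < N) ('X - (x i)%:P).
have WE t : W.[t] = \prod_(i < N) (t - x i).
  by rewrite horner_prod; apply: eq_bigr => i _; rewrite hornerXsubC.
have [[i six]|nsx] := pselect (exists i, s = x i).
  rewrite six interpE// subrr normr0 mulr_ge0//.
  by rewrite divr_ge0// (le_trans _ (hM s sab)).
have Ws0 : W.[s] != 0.
  by rewrite WE; apply/prodf_neq0 => i _; rewrite subr_eq0; apply/eqP => sx; apply: nsx; exists i.
pose lam := (q 0%N s - I.[s]) / W.[s].
pose Q : {poly R} := I + lam *: W.
pose l := s :: [seq x i | i <- enum 'I_N].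
have sl : (size l).-1 = N by rewrite /= size_map size_enum_ord.
have [||||c cab] := @rolle_seq (fun j t => q j t - (Q^`(j)).[t]) a b l.
- rewrite /= map_inj_uniq// enum_uniq andbT; apply/mapP => -[i _ six].
  by apply: nsx; exists i.
- by [].
- by rewrite sl; apply: chainB => //; exact: chain_poly.
- move=> y; rewrite inE => /predU1P[->|/mapP[i _ ->]]; split => //.
    by rewrite derivn0 hornerD hornerZ /lam mulfVK//; ring.
  by rewrite derivn0 hornerD hornerZ interpE// WE (bigD1 i)//= subrr mul0r mulr0 addr0 subrr.
rewrite sl => /eqP; rewrite subr_eq0 => /eqP qc.
have WN : W^`(N) = (N`!%:R)%:P.
  have mW : W \is monic by apply: monic_prod_XsubC.
  have sW : size W = N.+1 by rewrite size_prod_XsubC -[index_enum _]enumT size_enum_ord.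
  have : (size (W^`(N)) <= 1)%N.
    apply/leq_sizeP => j j1; rewrite coef_derivn nth_default ?mul0rn// sW; lia.
  move=> /size1_polyC ->; congr (_%:P).
  rewrite coef_derivn addn0 ffactnn; move: mW; rewrite monicE lead_coefE sW /= => /eqP ->.
  by [].
have IN : I^`(N) = 0 by apply: derivn_poly0; exact: size_interp.
move: qc; rewrite derivnD derivnZ IN WN add0r hornerZ hornerC => qc.
have fN : 0 < N`!%:R :> R by rewrite ltr0n fact_gt0.
have -> : q 0%N s - I.[s] = W.[s] * (q N c / N`!%:R).
  by rewrite qc mulfK ?gt_eqF// /lam mulrC mulfVK.
rewrite -WE normrM ler_wpM2l// normrM normfV (gtr0_norm fN) ler_pM2r ?invr_gt0// hM//.
Qed.

End chains.

(** * Truncated powers and Chebyshev nodes *)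

Section chebyshev_nodes.
Context {R : realType}.
Implicit Types (q g : nat -> R -> R) (p : {poly R}) (x y s t r : R) (m n N : nat).

(** Form without quotient and with [h = 0] allowed, suited to functions glued from pieces and to
    changes of variable. *)
Lemma is_deriveP (f : R -> R) (x l : R) : is_derive x (1 : R) f l <->
  forall e, 0 < e -> exists2 d, 0 < d & forall h, `|h| < d -> `|f (x + h) - f x - l * h| <= e * `|h|.
Proof.
split=> [[df dl] e e0|H].
  move: df; rewrite /derivable => /cvg_ex[l' hl'].
  have ll' : l' = l by rewrite -dl; apply/esym; exact: cvg_lim hl'.
  rewrite ll' in hl'; move/cvgrPdist_le : hl' => /(_ e e0).
  rewrite near_withinE => /nbhs_ballP[d /= d0 hd]; exists d => // h hd1.
  have [->|h0] := eqVneq h 0; first by rewrite addr0 subrr mulr0 subr0 normr0 mulr0.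
  have := hd h; rewrite -ball_normE /= sub0r normrN => /(_ hd1 h0).
  rewrite /GRing.scale /= mulr1 [h + x]addrC => hh.
  have -> : f (x + h) - f x - l * h = - ((l - h^-1 * (f (x + h) - f x)) * h) by field.
  by rewrite normrN normrM ler_pM2r ?normr_gt0.
have cvgl : (fun h => h^-1 *: ((f \o shift x) (h *: (1 : R)) - f x)) @ 0^' --> (l : R).
  apply/cvgrPdist_le => e e0; have [d d0 hd] := H e e0.
  rewrite near_withinE; apply/nbhs_ballP; exists d => //= h.
  rewrite -ball_normE /= sub0r normrN => hd1 h0.
  have := hd h hd1; rewrite /GRing.scale /= mulr1 [h + x]addrC => hh.
  have -> : l - h^-1 * (f (x + h) - f x) = - (f (x + h) - f x - l * h) / h by field.
  by rewrite normrM normrN normfV ler_pdivrMr ?normr_gt0.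
apply: DeriveDef; [by apply/cvg_ex; exists l | exact: cvg_lim cvgl].
Qed.

(** The kernel that represents evaluation at [x] in Taylor's formula. Exponent 0 gives the indicator
    of the open half-line beyond [x]. *)
Definition truncpow (x : R) j (s : R) : R := if s <= x then 0 else (s - x) ^+ j / j`!%:R.

Lemma is_derive_truncpow x j s : (0 < j)%N ->
  is_derive s (1 : R) (truncpow x j.+1) (truncpow x j s).
Proof.
move=> j0; have facE : j.+1`!%:R = j.+1%:R * j`!%:R :> R by rewrite factS natrM.
have f0 : j`!%:R != 0 :> R by rewrite pnatr_eq0 -lt0n fact_gt0.
have f1 : 1 <= j`!%:R :> R by rewrite ler1n fact_gt0.
have j1 : j.+1%:R != 0 :> R by rewrite pnatr_eq0.
apply/is_deriveP => e e0; rewrite /truncpow; case: (ltgtP s x) => sx.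
- exists (x - s); first by rewrite subr_gt0.
  move=> h hx; have -> : s + h <= x by move: hx; rewrite ltr_norml => /andP[_]; lra.
  by rewrite !subrr mul0r subr0 normr0 mulr_ge0// ltW.
- have hp : is_derive s (1 : R) (fun t => (t - x) ^+ j.+1 / j.+1`!%:R) ((s - x) ^+ j / j`!%:R).
    have := is_derive_poly ((j.+1`!%:R)^-1 *: ('X - x%:P) ^+ j.+1) s.
    rewrite derivZ deriv_exp derivXsubC mul1r hornerZ hornerMn horner_exp hornerXsubC /=.
    have -> : j.+1`!%:R^-1 * ((s - x) ^+ j *+ j.+1) = (s - x) ^+ j / j`!%:R.
      by rewrite facE -mulr_natr; field; rewrite addrC natr1 j1 f0.
    congr (is_derive _ _ _ _); apply/funext => t.
    by rewrite hornerZ horner_exp hornerXsubC mulrC.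
  have [d d0 hd] := (is_deriveP _ _ _).1 hp e e0.
  exists (Num.min d (s - x)); first by rewrite lt_min d0 subr_gt0.
  move=> h; rewrite lt_min => /andP[h1 h2]; have -> : (s + h <= x) = false.
    by apply/negbTE; rewrite -ltNge; move: h2; rewrite ltr_norml => /andP[]; lra.
  exact: hd.
- exists (Num.min 1 e); first by rewrite lt_min ltr01.
  move=> h; rewrite lt_min => /andP[h1 h2]; rewrite sx mul0r !subr0.
  case: ifP => _; first by rewrite normr0 mulr_ge0// ltW.
  have -> : x + h - x = h by ring.
  rewrite normrM normrX exprS [leRHS]mulrC -mulrA ler_wpM2l//.
  have fj : 1 <= j.+1`!%:R :> R by rewrite ler1n fact_gt0.
  rewrite normfV normr_nat. apply: (le_trans _ (ltW h2)).
  rewrite ler_pdivrMr ?(lt_le_trans ltr01)//.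
  apply: (@le_trans _ _ (`|h| * 1)); last by rewrite ler_wpM2l.
  by rewrite mulr1 -[leRHS]expr1 ler_wiXn2l// ltW.
Qed.

(** The chain ends at exponent 1, the last continuous member; one order is lost here. *)
Lemma chain_truncpow x m : (0 < m)%N -> chain (fun j => truncpow x (m - j)) m.-1.
Proof.
move=> m0 j jm t; have -> : (m - j = (m - j.+1).+1)%N by lia.
by apply: is_derive_truncpow; lia.
Qed.

Fixpoint chebyshev n : {poly R} :=
  match n with
  | 0%N => 1
  | n1.+1 => match n1 with
    | 0%N => 'X
    | n2.+1 => 2%:P * 'X * chebyshev n1 - chebyshev n2
    end
  end.

Lemma chebyshevSS n : chebyshev n.+2 = 2%:P * 'X * chebyshev n.+1 - chebyshev n.
Proof. by []. Qed.

Lemma size_chebyshev n : size (chebyshev n) = n.+1 /\ lead_coef (chebyshev n) = 2 ^+ n.-1.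
Proof.
suff [] : (size (chebyshev n) = n.+1 /\ lead_coef (chebyshev n) = 2 ^+ n.-1) /\
  (size (chebyshev n.+1) = n.+2 /\ lead_coef (chebyshev n.+1) = 2 ^+ n) by [].
elim: n => [|n [[s1 l1] [s2 l2]]].
  by rewrite /= size_poly1 lead_coef1 size_polyX lead_coefX.
split=> //; rewrite chebyshevSS.
have nz : chebyshev n.+1 != 0 by rewrite -size_poly_eq0 s2.
have -> : 2%:P * 'X * chebyshev n.+1 = 2 *: (chebyshev n.+1 * 'X) by rewrite -mul_polyC; ring.
have sM : size (2 *: (chebyshev n.+1 * 'X)) = n.+3 by rewrite size_scale ?pnatr_eq0// size_mulX// s2.
split; first by rewrite size_polyDl sM// size_polyN s1.
by rewrite lead_coefDl ?sM ?size_polyN ?s1// lead_coefZ lead_coefM lead_coefX mulr1 l2 /= exprS.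
Qed.

Lemma chebyshev_cos n (t : R) : (chebyshev n).[cos t] = cos (n%:R * t).
Proof.
suff [] : (chebyshev n).[cos t] = cos (n%:R * t) /\ (chebyshev n.+1).[cos t] = cos (n.+1%:R * t) by [].
elim: n => [|n [h1 h2]]; first by rewrite /= hornerC hornerX mul0r cos0 mul1r.
split=> //; rewrite chebyshevSS hornerD hornerN !hornerM hornerC hornerX h1 h2.
have -> : n.+2%:R * t = n.+1%:R * t + t by rewrite -[n.+2]addn1 natrD mulrDl mul1r.
have -> : n%:R * t = n.+1%:R * t - t by rewrite -[n.+1]addn1 natrD mulrDl mul1r addrK.
by rewrite cosB cosD; ring.
Qed.

(** The roots of [chebyshev N], carried from [[-1, 1]] to [[0, 1]] by an affine map. *)
Definition chebnode N (i : 'I_N) : R := (1 + cos ((2 * i + 1)%:R * pi / (2 * N)%:R)) / 2.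

Lemma cos_odd_pihalf i : cos ((2 * i + 1)%:R * (pi / 2)) = 0 :> R.
Proof.
elim: i => [|i IH]; first by rewrite mul1r cos_pihalf.
have -> : (2 * i.+1 + 1)%:R * (pi / 2) = (2 * i + 1)%:R * (pi / 2) + pi :> R.
  by rewrite !natrD !natrM -[i.+1]addn1 natrD; field.
by rewrite cosDpi IH oppr0.
Qed.

Lemma chebangle_itv N (i : 'I_N) : 0 <= (2 * i + 1)%:R * (pi : R) / (2 * N)%:R <= pi.
Proof.
have N0 : (0 < N)%N by case: i => i; apply: leq_ltn_trans.
rewrite divr_ge0 ?mulr_ge0 ?ler0n ?pi_ge0//= ler_pdivrMr ?ltr0n ?muln_gt0//.
by rewrite mulrC ler_wpM2l ?pi_ge0// ler_nat; have := ltn_ord i; lia.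
Qed.

Lemma chebnode_inj N : injective (@chebnode N).
Proof.
move=> i j; rewrite /chebnode => /(mulIf (x := 2^-1)) - /(_ _)/addrI; rewrite invr_eq0 pnatr_eq0 => /(_ isT).
move=> /cos_inj; rewrite !in_itv /= !chebangle_itv => /(_ isT isT).
have N0 : (0 < N)%N by case: i => i; apply: leq_ltn_trans.
have h : (2 * N)%:R^-1 != 0 :> R by rewrite invr_eq0 pnatr_eq0; lia.
move=> /(mulIf h)/(mulIf (lt0r_neq0 (pi_gt0 R)))/eqP; rewrite eqr_nat => /eqP e.
by apply/val_inj => /=; lia.
Qed.

Lemma chebnode_itv N (i : 'I_N) : 0 <= chebnode i <= 1.
Proof.
rewrite /chebnode; set c := cos _.
have := cos_geN1 (R := R) ((2 * i + 1)%:R * pi / (2 * N)%:R).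
have := cos_le1 (R := R) ((2 * i + 1)%:R * pi / (2 * N)%:R).
by rewrite -/c; lra.
Qed.

(** The product is the Chebyshev polynomial at [2 * s - 1] divided by [2 ^ (2 * N - 1)], and that
    polynomial is a cosine on [[-1, 1]]. *)
Lemma chebnode_prod N (s : R) : 0 <= s <= 1 ->
  `|\prod_(i < N) (s - chebnode i)| <= 2 * 4 ^- N.
Proof.
move=> s01; have [N0|N0] := posnP N.
  by rewrite N0 big_ord0 normr1 expr0 invr1 mulr1; lra.
pose c (i : 'I_N) : R := cos ((2 * i + 1)%:R * pi / (2 * N)%:R).
pose y := 2 * s - 1; have y1 : -1 <= y <= 1 by rewrite /y; lra.
have N1 : N%:R != 0 :> R by rewrite pnatr_eq0 -lt0n.
have ci : injective c.
  move=> i j cij; apply: chebnode_inj; rewrite /chebnode.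
  by move: cij; rewrite /c => ->.
have TE : chebyshev N = lead_coef (chebyshev N) *: \prod_(z <- [seq c i | i <- enum 'I_N]) ('X - z%:P).
  apply: all_roots_prod_XsubC.
  - by rewrite size_map size_enum_ord (size_chebyshev N).1.
  - apply/allP => _ /mapP[i _ ->]; rewrite rootE /c chebyshev_cos.
    have -> : N%:R * ((2 * i + 1)%:R * pi / (2 * N)%:R) = (2 * i + 1)%:R * (pi / 2) :> R.
      by rewrite (natrM _ 2 N); field.
    by rewrite cos_odd_pihalf.
  - by rewrite uniq_rootsE map_inj_uniq ?enum_uniq.
have : (chebyshev N).[y] = 2 ^+ N.-1 * \prod_(i < N) (y - c i).
  rewrite {1}TE hornerZ (size_chebyshev N).2; congr (_ * _).
  rewrite big_map horner_prod -big_enum /=.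
  by rewrite enumT; apply: eq_bigr => i _; rewrite hornerXsubC.
have -> : \prod_(i < N) (y - c i) = 2 ^+ N * \prod_(i < N) (s - chebnode i).
  have -> : 2 ^+ N = \prod_(i < N) 2 :> R by rewrite prodr_const card_ord.
  rewrite -big_split /=; apply: eq_bigr => i _.
  by rewrite /y /chebnode -/(c i); field.
rewrite -{1}(acosK (x := y)) ?in_itv//= chebyshev_cos => h.
have := cos_max (R := R) (N%:R * acos y); rewrite h mulrA -exprD.
have e4 : 2 ^+ (N.-1 + N) = 4 ^+ N / 2 :> R.
  have -> : (4 : R) = 2 ^+ 2 by rewrite expr2; ring.
  rewrite -exprM; have -> : (2 * N = (N.-1 + N).+1)%N by lia.
  by rewrite exprS; field.
rewrite e4 normrM gtr0_norm ?divr_gt0 ?exprn_gt0// => hh.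
have p4 : 0 < 4 ^+ N :> R by rewrite exprn_gt0.
rewrite ler_pdivlMr//; move: hh; rewrite mulrAC ler_pdivrMr// mul1r mulrC.
by rewrite mulrC [leLHS]mulrC.
Qed.

End chebyshev_nodes.

(** * Functions with a small derivative of high order *)

Section flat_ends.
Context {R : realType}.
Implicit Types (q g : nat -> R -> R) (p : {poly R}) (x y s t r : R) (m n N : nat).

(** Error of the interpolation of [truncpow x m.-1] at [m - 2] Chebyshev nodes: the bound for the
    nodal polynomial over the factorial of the order. *)
Definition kap m : R := 2 * 4 ^- (m - 2) / (m - 2)`!%:R.

Lemma kap_gt0 m : 0 < kap m.
Proof. by rewrite /kap divr_gt0 ?ltr0n ?fact_gt0// mulr_gt0// invr_gt0 exprn_gt0. Qed.

(* Iterated integration by parts: [psi] is an antiderivative of [A * q m] when [size A <= m]. *)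
Fixpoint psi q m (A : {poly R}) (t : R) : R :=
  if m is m1.+1 then A.[t] * q m1 t - psi q m1 A^`() t else 0.

Lemma is_derive_psi q m A t : chain q m ->
  is_derive t (1 : R) (psi q m A) (A.[t] * q m t - (-1) ^+ m * A^`(m).[t] * q 0%N t).
Proof.
elim: m A => [|m IH] A cq.
  rewrite expr0 mul1r derivn0 subrr; exact: is_derive_cst.
have H1 := IH A^`() (chainW (leqnSn m) cq).
have H2 : is_derive t (1 : R) (fun t => A.[t] * q m t) (A^`().[t] * q m t + A.[t] * q m.+1 t).
  have h := is_derive_poly A t; have h' := cq m (ltnSn m) t.
  have := @is_deriveM _ _ (horner A) (q m) t 1 _ _ h h'.
  by move/is_derive_eq; apply; rewrite /GRing.scale /= addrC [X in X + _ = _]mulrC.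
have := is_deriveB H2 H1; move/is_derive_eq; apply.
by rewrite -derivSn exprS; ring.
Qed.

Lemma psiD q m A B t : psi q m (A + B) t = psi q m A t + psi q m B t.
Proof. by elim: m A B => [|m IH] A B /=; rewrite ?addr0// derivD IH hornerD; ring. Qed.

Lemma psi_bound q m A t (w : R) : (forall j, (j < m)%N -> `|q j t| <= w) ->
  `|psi q m A t| <= (\sum_(i < m) `|A^`(i).[t]|) * w.
Proof.
elim: m A => [|m IH] A h; first by rewrite /= normr0 big_ord0 mul0r.
rewrite big_ord_recl derivn0 mulrDl.
have -> : \sum_(i < m) `|A^`(lift ord0 i).[t]| = \sum_(i < m) `|A^`()^`(i).[t]|.
  by apply: eq_bigr => i _; rewrite lift0 derivSn.
rewrite /=; apply: le_trans (ler_normB _ _) _; apply: lerD.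
  by rewrite normrM ler_wpM2l// h.
by apply: IH => j jm; apply: h; exact: ltnW.
Qed.

Definition taylorpow x m : {poly R} := (m`!%:R)^-1 *: ('X - x%:P) ^+ m.

Lemma deriv_taylorpow x m : (taylorpow x m.+1)^`() = taylorpow x m.
Proof.
rewrite /taylorpow derivZ deriv_exp derivXsubC mul1r /= -scalerMnr scalerMnl -[_ *+ _]mulr_natr factS natrM.
by congr (_ *: _); field; rewrite addrC natr1 !pnatr_eq0 -lt0n fact_gt0.
Qed.

Lemma horner_taylorpow x m t : (taylorpow x m).[t] = (t - x) ^+ m / m`!%:R.
Proof. by rewrite hornerZ horner_exp hornerXsubC mulrC. Qed.

Lemma size_taylorpow x m : (size (taylorpow x m) <= m.+1)%N.
Proof. by rewrite (leq_trans (size_scale_leq _ _))// size_exp_XsubC. Qed.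

(** At its centre every power of positive exponent vanishes, so only the last term of the iterated
    integration by parts survives. *)
Lemma psi_taylorpow q m x : psi q m.+1 (taylorpow x m) x = (-1) ^+ m * q 0%N x.
Proof.
elim: m => [|m IH].
  by rewrite /= horner_taylorpow !expr0 fact0 divr1 subr0.
rewrite -[LHS]/((taylorpow x m.+1).[x] * q m.+1 x - psi q m.+1 (taylorpow x m.+1)^`() x).
by rewrite deriv_taylorpow IH horner_taylorpow subrr expr0n /= !mul0r sub0r exprS mulN1r mulNr.
Qed.

Lemma psi_taylorpow_bound q m x t (w : R) : `|t - x| <= 1 -> (forall j, (j <= m)%N -> `|q j t| <= w) ->
  `|psi q m.+1 (taylorpow x m) t| <= m.+1%:R * w.
Proof.
move=> tx; elim: m => [|m IH] h.
  by rewrite /= horner_taylorpow !expr0 fact0 divr1 subr0 !mul1r h.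
rewrite -[psi _ _ _ _]/((taylorpow x m.+1).[t] * q m.+1 t - psi q m.+1 (taylorpow x m.+1)^`() t).
rewrite deriv_taylorpow; have -> : m.+2%:R * w = w + m.+1%:R * w by rewrite -[m.+2]addn1 natrD; ring.
apply: le_trans (ler_normB _ _) _; apply: lerD; last by apply: IH => j jm; apply: h; exact: leqW.
rewrite horner_taylorpow normrM -[leRHS]mul1r; apply: ler_pM => //; last exact: h.
rewrite normrM normrX normfV normr_nat.
have f1 : 1 <= m.+1`!%:R :> R by rewrite ler1n fact_gt0.
rewrite ler_pdivrMr ?(lt_le_trans ltr01)// mul1r. apply: (le_trans _ f1).
by rewrite exprn_ile1.
Qed.

Lemma truncpow_le1 x j t : 0 <= x -> t <= 1 -> 0 <= truncpow x j t <= 1.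
Proof.
move=> x0 t1; rewrite /truncpow; case: ifPn => [_|]; [by rewrite lexx ler01|rewrite -ltNge => xt].
have f1 : 1 <= j`!%:R :> R by rewrite ler1n fact_gt0.
have f0 : 0 < j`!%:R :> R by rewrite ltr0n fact_gt0.
have tx0 : 0 <= t - x by rewrite subr_ge0 ltW.
rewrite divr_ge0 ?exprn_ge0 ?(ltW f0)//= ler_pdivrMr// mul1r; apply: (le_trans _ f1).
by rewrite exprn_ile1//; lra.
Qed.

(* The kernel is the truncated power minus its interpolant at Chebyshev nodes, which gains
   the factor 4 ^- (m - 2) / (m - 2)`! over the trivial Taylor bound. *)
Lemma flat_ends_bound m : (2 <= m)%N -> exists2 C : R, 0 <= C &
  forall q x (w M : R), chain q m -> 0 <= x <= 1 ->
  (forall j, (j < m)%N -> `|q j 0| <= w /\ `|q j 1| <= w) ->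
  (forall t, 0 <= t <= 1 -> `|q m t| <= M) ->
  `|q 0%N x| <= C * w + kap m * M.
Proof.
case: m => [//|[//|N]] _; set m := N.+2.
pose L (t : R) : R := \sum_(i < m) \sum_(k < N) `|(lagrange (@chebnode R N) k)^`(i).[t]|.
have L0 t : 0 <= L t by apply: sumr_ge0 => i _; apply: sumr_ge0.
exists (L 0 + L 1 + m%:R); first by apply: addr_ge0; [exact: addr_ge0|exact: ler0n].
move=> q x w M cq x01 qw qM.
pose f := truncpow x m.-1; pose I := interp (@chebnode R N) f.
have w0 : 0 <= w by apply: (le_trans _ (qw 0%N isT).1).
have M0 : 0 <= M by apply: (le_trans _ (qM 0 _)); rewrite ?normr_ge0 ?lexx ?ler01.
have fI s : 0 <= s <= 1 -> `|f s - I.[s]| <= kap m.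
  (* With exponent [m - 1], the derivative of order [N = m - 2] of the kernel is [truncpow x 1], at
     most 1 on the unit interval. Hence [m - 2] nodes. *)
  move=> s01; have cf := @chain_truncpow R x m.-1 isT.
  have := @interp_error _ _ (@chebnode R N) _ 0 1 1 s (@chebnode_inj R N) cf (@chebnode_itv R N) s01.
  rewrite subn0 -/f -/I => /(_ _)/le_trans; apply.
    move=> t t01; have := truncpow_le1 (m.-1 - N) (x := x) (t := t).
    by move=> /(_ _ _)/andP[||h1 h2]; [lra..|rewrite ger0_norm].
  rewrite /kap /m subn2 /= mul1r ler_wpM2r ?invr_ge0 ?ler0n//.
  exact: chebnode_prod.
have sI : (size I <= m)%N by rewrite (leq_trans (size_interp _ _))// leqW.
have psiI t : (forall j, (j < m)%N -> `|q j t| <= w) -> `|psi q m (- I) t| <= L t * w.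
  move=> ht; apply: le_trans (psi_bound _ ht) _; apply: ler_wpM2r => //.
  apply: ler_sum => i _; rewrite derivnN hornerN normrN /I /interp linear_sum horner_sum.
  apply: le_trans (ler_norm_sum _ _ _) _; apply: ler_sum => k _.
  rewrite /= derivnZ hornerZ normrM -[leRHS]mul1r ler_wpM2r//.
  have /andP[c0 c1] := @chebnode_itv R N k; have /andP[x0 x1] := x01.
  by have /andP[h1 h2] := truncpow_le1 m.-1 x0 c1; rewrite ger0_norm.
have dpsi (A : {poly R}) : (size A <= m)%N -> forall t, is_derive t (1 : R) (psi q m A) (A.[t] * q m t).
  move=> sA t; have := is_derive_psi A t cq; move/is_derive_eq; apply.
  by rewrite derivn_poly0// horner0 mulr0 mul0r subr0.
have sNI : (size (- I) <= m)%N by rewrite size_polyN.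
(* The kernel [f - I] is the polynomial [- I] to the left of x and [- I + taylorpow x m.-1] to the
   right. [psi] is used on each side, and the mismatch at x is [q 0 x] up to sign. *)
have sP : (size (- I + taylorpow x m.-1)%R <= m)%N.
  by rewrite (leq_trans (size_polyD _ _))// geq_max sNI size_taylorpow.
have /andP[x0 x1] := x01.
have e1 : `|psi q m (- I) x - psi q m (- I) 0| <= kap m * M * (x - 0).
  apply: (mvt_bound (dpsi _ sNI)) => // t /andP[t0 tx]; rewrite normrM ler_pM//.
    rewrite hornerN -[X in `|X|]add0r; have <- : f t = 0 by rewrite /f /truncpow tx.
    by apply: fI; rewrite t0 (le_trans tx).
  by apply: qM; rewrite t0 (le_trans tx).
have e2 : `|psi q m (- I + taylorpow x m.-1) 1 - psi q m (- I + taylorpow x m.-1) x| <= kap m * M * (1 - x).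
  apply: (mvt_bound (dpsi _ sP)) => // t /andP[tx t1]; rewrite normrM ler_pM//.
    have -> : (- I + taylorpow x m.-1).[t] = f t - I.[t].
      rewrite hornerD hornerN horner_taylorpow addrC /f /truncpow; case: ifP => // tx'.
      have -> : t = x by apply/eqP; rewrite eq_le tx tx'.
      by rewrite subrr expr0n mul0r.
    by apply: fI; rewrite t1 (le_trans x0).
  by apply: qM; rewrite t1 (le_trans x0).
have e3 := psiI 0 (fun j jm => (qw j jm).1).
have e4 := psiI 1 (fun j jm => (qw j jm).2).
have e5 : `|psi q m (taylorpow x m.-1) 1| <= m%:R * w.
  apply: psi_taylorpow_bound; first by rewrite ger0_norm; lra.
  by move=> j jm; exact: (qw j jm).2.
have <- : `|psi q m (taylorpow x m.-1) x| = `|q 0%N x|.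
  by rewrite psi_taylorpow normrM normrX normrN1 expr1n mul1r.
move: e2; rewrite !psiD; move: e1 e3 e4 e5.
set a := psi q m (- I) x; set b := psi q m (- I) 0; set c := psi q m (- I) 1.
set d := psi _ _ (taylorpow _ _) 1; set e := psi _ _ (taylorpow _ _) x.
rewrite !ler_norml; move=> /andP[? ?] /andP[? ?] /andP[? ?] /andP[? ?] /andP[? ?].
by apply/andP; split; lra.
Qed.

End flat_ends.

(** * Flat points in cells with a large good part *)

Section cells.
Context {R : realType}.
Implicit Types (q g : nat -> R -> R) (p : {poly R}) (x y s t r : R) (m n N : nat).
Local Notation leb := (@lebesgue_measure R).

(** Greedy choice: a point within d of the infimum is kept and an interval of length [2 * d] above
    the infimum is discarded, so each point uses up measure [2 * d]. *)
Lemma separated_points (S : set R) a b N (d : R) : measurable S -> S `<=` `[a, b]%classic ->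
  0 < d -> ((2 * N%:R * d)%:E < leb S)%E ->
  exists z : nat -> R, (forall i, (i < N)%N -> S (z i)) /\
    (forall i, (i.+1 < N)%N -> z i + d <= z i.+1).
Proof.
move=> mS Sab d0; elim: N S mS Sab => [|N IH] S mS Sab h; first by exists (fun=> 0).
have S0 : S !=set0.
  apply/set0P/eqP => S0; move: h; rewrite S0 measure0 lte_fin ltNge.
  by rewrite mulr_ge0// ?mulr_ge0// ltW.
have hS : has_inf S by split=> //; exists a => t /Sab; rewrite /= in_itv /= => /andP[].
have [t St ti] := inf_adherent d0 hS.
pose S' := S `&` `[t + d, +oo[%classic.
have mS' : measurable S' by apply: measurableI.
have [||z [z1 z2]] := IH S' mS'.
- by move=> u [/Sab].
- have : (leb S <= leb S' + leb `[inf S, (inf S + 2 * d)%R]%classic)%E.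
    apply: le_trans (@measureU2 _ _ _ leb _ _ mS' _) => //.
    apply: le_measure; rewrite ?inE//; first by apply: measurableU.
    move=> u Su; have [tu|ut] := leP (t + d) u; first by left; split => //=; rewrite in_itv /= tu.
    right => /=; rewrite in_itv /= ge_inf//=; [lra|by case: hS].
  rewrite lebesgue_measure_itv /= lte_fin ltrDl mulr_gt0// -EFinD => h2.
  have := lt_le_trans h h2.
  rewrite (_ : (2 * N.+1%:R * d)%:E = (2 * N%:R * d)%:E + (inf S + 2 * d - inf S)%:E)%E; last first.
    by rewrite -EFinD -[N.+1]addn1 natrD; congr (_%:E); ring.
  by rewrite lteD2rE.
exists (fun i => if i is j.+1 then z j else t); split.
- by move=> [|i] // /z1 [].
- move=> [|i] iN; last exact: z2.
  by have [_] := z1 0%N iN; rewrite /= in_itv /= andbT.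
Qed.

Lemma poor_cells (B : set R) a r (k : R) n : measurable B -> 0 < r -> 0 <= k <= 1 ->
  (forall i, (i < n)%N -> (leb (`[(a + i%:R * r)%R, (a + i.+1%:R * r)%R[ `\` B) < (k * r)%:E)%E) ->
  ((n%:R * ((1 - k) * r))%:E <= leb (B `&` `[a, (a + n%:R * r)%R[))%E.
Proof.
move=> mB r0 k01; elim: n => [|n IH] h; first by rewrite mul0r measure_ge0.
have IH' := IH (fun i iN => h i (leqW iN)).
have hn := h n (ltnSn n).
have arn : a + n%:R * r <= a + n.+1%:R * r by rewrite lerD2l ler_pM2r// ler_nat.
have an : a <= a + n%:R * r by rewrite lerDl mulr_ge0// ltW.
pose c := `[(a + n%:R * r)%R, (a + n.+1%:R * r)%R[%classic : set R.
have cE : leb c = r%:E.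
  rewrite lebesgue_measure_itv /= lte_fin ltrD2l ltr_pM2r// ltr_nat ltnSn -EFinD.
  by congr (_%:E); rewrite -[n.+1]addn1 natrD; ring.
have mc : measurable c by exact: measurable_itv.
have -> : B `&` `[a, (a + n.+1%:R * r)%R[ = (B `&` `[a, (a + n%:R * r)%R[) `|` (B `&` c).
  by rewrite -setIUr /c -itv_bndbnd_setU ?bnd_simp//.
rewrite measureU//; [|exact: measurableI|exact: measurableI|]; last first.
  rewrite setIACA setIid; apply/seteqP; split => // u [_ []] /=.
  by rewrite !in_itv /= => /andP[_ h1] /andP[h2 _]; move: (lt_le_trans h1 h2); rewrite ltxx.
have hc : (r%:E = leb (c `\` B) + leb (B `&` c))%E.
  by rewrite -cE (measureDI leb mc mB) [c `&` B]setIC.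
have [x1 x1E] : exists x1, leb (c `\` B) = x1%:E.
  exists (fine (leb (c `\` B))); rewrite fineK// ge0_fin_numE//.
  by apply: lt_trans hn _; rewrite ltry.
have [x2 x2E] : exists x2, leb (B `&` c) = x2%:E.
  exists (fine (leb (B `&` c))); rewrite fineK// ge0_fin_numE//.
  apply: le_lt_trans (_ : (leb c < +oo)%E); last by rewrite cE ltry.
  by apply: le_measure; rewrite ?inE//; exact: measurableI.
move: hc hn; rewrite -/c x1E x2E -EFinD lte_fin => -[hc] hn.
have -> : n.+1%:R * ((1 - k) * r) = n%:R * ((1 - k) * r) + (1 - k) * r.
  by rewrite -[n.+1]addn1 natrD; ring.
rewrite EFinD; apply: leeD => //; rewrite [leRHS]x2E lee_fin; lra.
Qed.

(** A cell is rich when its good part has measure at least [k * r]. Between the nearest rich cells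
    on the two sides of x all cells are poor, and each uses up [(1 - k) * r] of the bad measure;
    this bounds their distance. The n cells on one side cannot all be poor, because of the bound on
    b. *)
Lemma rich_cells (B : set R) x r (k b : R) n : measurable B -> 0 < r -> 0 < k < 1 ->
  b < n%:R * ((1 - k) * r) ->
  (leb (B `&` `[(x - n%:R * r)%R, (x + n%:R * r)%R[) <= b%:E)%E ->
  exists a1 a2, [/\ x - n%:R * r <= a1, a1 + r <= x, x <= a2, a2 + r <= x + n%:R * r &
    a2 + r - a1 <= b / (1 - k) + 2 * r] /\
  ((k * r)%:E <= leb (`[a1, (a1 + r)%R[ `\` B))%E /\
  ((k * r)%:E <= leb (`[a2, (a2 + r)%R[ `\` B))%E.
Proof.
move=> mB r0 /andP[k0 k1] bn hB; pose x0 := x - n%:R * r.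
pose cell i := `[(x0 + i%:R * r)%R, (x0 + i.+1%:R * r)%R[%classic : set R.
pose rich i := ((k * r)%:E <= leb (cell i `\` B))%E.
have mono i j : (i <= j)%N -> i%:R * r <= j%:R * r by move=> ij; rewrite ler_pM2r// ler_nat.
have poor i j : (i <= j)%N -> (j <= 2 * n)%N -> (forall l, (i <= l < j)%N -> ~~ rich l) -> (j - i)%:R * ((1 - k) * r) <= b.
  move=> ij jn hl; rewrite -lee_fin; apply: le_trans hB.
  apply: le_trans (@poor_cells B (x0 + i%:R * r) r k (j - i) mB r0 _ _) _.
  - by rewrite !ltW.
  - move=> l lij; rewrite ltNge; have := hl (i + l)%N ltac:(lia); rewrite /rich /cell.
    by rewrite -addnS !natrD !mulrDl !addrA.
  - apply: le_measure; rewrite ?inE//; [exact: measurableI..|].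
    apply: setIS; apply: subset_itv; rewrite bnd_simp.
      by rewrite /x0 lerDl mulr_ge0// ltW.
    rewrite natrB// mulrBl /x0.
    have : j%:R * r <= (2 * n)%:R * r by exact: mono.
    by rewrite natrM; lra.
have [i2 [i2n r2 h2]] : exists i2, [/\ (n <= i2 < 2 * n)%N, rich i2 & forall l, (n <= l < i2)%N -> ~~ rich l].
  have [ex|nex] := pselect (exists i, (n <= i < 2 * n)%N && rich i).
    case: (ex_minnP ex) => i /andP[i1 i3] imin; exists i; split=> // l /andP[l1 l2].
    by apply/negP => rl; have := imin l; rewrite l1 rl (leq_trans l2) ?(ltnW (andP i1).2)//= => /(_ isT); lia.
  have := @poor n (2 * n)%N ltac:(lia) (leqnn _).
  have -> : (2 * n - n = n)%N by lia.
  move=> /(_ _)/le_lt_trans - /(_ _ _ bn); rewrite ltxx => h; exfalso; apply: notF; apply: h.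
  by move=> l ll; apply/negP => rl; apply: nex; exists l; rewrite ll.
have [i1 [i1n r1 h1]] : exists i1, [/\ (i1 < n)%N, rich i1 & forall l, (i1 < l < n)%N -> ~~ rich l].
  have [ex|nex] := pselect (exists i, (i < n)%N && rich i).
    have bd i : (i < n)%N && rich i -> (i <= n)%N by case/andP => /ltnW.
    case: (ex_maxnP ex bd) => i /andP[i1 i3] imax; exists i; split=> // l /andP[l1 l2].
    by apply/negP => rl; have := imax l; rewrite l2 rl => /(_ isT); lia.
  have := @poor 0%N n (leq0n _) ltac:(lia); rewrite subn0.
  move=> /(_ _)/le_lt_trans - /(_ _ _ bn); rewrite ltxx => h; exfalso; apply: notF; apply: h.
  by move=> l ll; apply/negP => rl; apply: nex; exists l; rewrite rl andbT; case/andP: ll.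
have hb := @poor i1.+1 i2 ltac:(lia) ltac:(lia) _.
have {}hb : (i2 - i1.+1)%:R * ((1 - k) * r) <= b.
  apply: hb => l ll; case: (ltnP l n) => ln; [apply: h1|apply: h2]; lia.
exists (x0 + i1%:R * r), (x0 + i2%:R * r).
have E i : x0 + i%:R * r + r = x0 + i.+1%:R * r by rewrite -[i.+1]addn1 natrD; ring.
rewrite !E; split; last by [].
have k1' : 0 < 1 - k by lra.
split.
- by rewrite lerDl mulr_ge0// ltW.
- by have := mono i1.+1 n i1n; rewrite /x0; lra.
- by have := mono n i2 ltac:(lia); rewrite /x0; lra.
- by have := mono i2.+1 (2 * n)%N ltac:(lia); rewrite natrM /x0; lra.
- have e : x0 + i2.+1%:R * r - (x0 + i1%:R * r) = (i2 - i1.+1)%:R * r + 2 * r.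
    by rewrite natrB; [rewrite -[i2.+1]addn1 -[i1.+1]addn1 !natrD; ring|lia].
  by rewrite e lerD2r ler_pdivlMr//; move: hb; rewrite mulrCA mulrC.
Qed.

(** The mean value theorem on the disjoint pairs [(2 * i, 2 * i + 1)] raises the order by one at the
    cost of a factor [2 / d] and of half of the points, hence [2 ^ m] of them at the start.
    Disjointness of the pairs keeps the new points at distance d. *)
Lemma flat_points q m a r (d w : R) (z : nat -> R) : chain q m -> 0 < d ->
  (forall i, (i < 2 ^ m)%N -> a <= z i <= a + r /\ `|q 0%N (z i)| <= w) ->
  (forall i, (i.+1 < 2 ^ m)%N -> z i + d <= z i.+1) ->
  forall j, (j <= m)%N -> exists z' : nat -> R,
   (forall i, (i < 2 ^ (m - j))%N -> a <= z' i <= a + r /\ `|q j (z' i)| <= (2 / d) ^+ j * w) /\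
   (forall i, (i.+1 < 2 ^ (m - j))%N -> z' i + d <= z' i.+1).
Proof.
move=> cq d0 z1 z2; elim=> [|j IH] jm; first by exists z; rewrite subn0 expr0; split=> // i; rewrite mul1r; exact: z1.
have [y [y1 y2]] := IH (ltnW jm).
have pE : (2 ^ (m - j) = 2 * 2 ^ (m - j.+1))%N by rewrite -expnS; congr (2 ^ _)%N; lia.
have h i : exists c, (i < 2 ^ (m - j.+1))%N ->
    y (2 * i)%N < c < y (2 * i).+1 /\ `|q j.+1 c| <= (2 / d) ^+ j.+1 * w.
  case: ltnP => [iN|_]; last by exists 0.
  have gap : y (2 * i)%N + d <= y (2 * i).+1 by apply: y2; rewrite pE; lia.
  have ylt : y (2 * i)%N < y (2 * i).+1 by lra.
  have [c cy ce] := mvt (cq j jm) ylt.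
  exists c => _; split=> //.
  have [_ b1] := y1 (2 * i)%N ltac:(rewrite pE; lia).
  have [_ b2] := y1 (2 * i).+1 ltac:(rewrite pE; lia).
  have dy : 0 < y (2 * i).+1 - y (2 * i)%N by rewrite subr_gt0.
  have : `|q j.+1 c| * (y (2 * i).+1 - y (2 * i)%N) <= 2 * ((2 / d) ^+ j * w).
    rewrite -[X in _ * X](gtr0_norm dy) -normrM -ce.
    by apply: le_trans (ler_normB _ _) _; lra.
  have -> : (2 / d) ^+ j.+1 * w = 2 * ((2 / d) ^+ j * w) / d by rewrite exprS; ring.
  rewrite ler_pdivlMr//; apply: le_trans; apply: ler_wpM2l => //; lra.
have [c cP] := choice h; exists c; split.
- move=> i iN; have [/andP[c1 c2] cb] := cP i iN; split=> //.
  have [/andP[b1 _] _] := y1 (2 * i)%N ltac:(rewrite pE; lia).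
  have [/andP[_ b2] _] := y1 (2 * i).+1 ltac:(rewrite pE; lia).
  by apply/andP; split; lra.
- move=> i iN; have [/andP[_ c1] _] := cP i (ltnW iN); have [/andP[c2 _] _] := cP i.+1 iN.
  have := y2 (2 * i).+1 ltac:(rewrite pE; lia).
  have -> : (2 * i).+2 = (2 * i.+1)%N by lia.
  lra.
Qed.

(** From one point of small derivative for each order, smallness spreads over the cell from the top
    order down: order m by its oscillation e, each lower order by integration over a length at most
    1. *)
Lemma flat_cell q m a r (d w e : R) (z : nat -> R) : chain q m -> 0 < d <= 1 -> 0 <= r <= 1 -> 0 <= w ->
  (forall i, (i < 2 ^ m)%N -> a <= z i <= a + r /\ `|q 0%N (z i)| <= w) ->
  (forall i, (i.+1 < 2 ^ m)%N -> z i + d <= z i.+1) ->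
  (forall s t, a <= s <= a + r -> a <= t <= a + r -> `|q m t - q m s| <= e) ->
  forall j, (j <= m)%N -> forall y, a <= y <= a + r -> `|q j y| <= m.+1%:R * ((2 / d) ^+ m * w) + e.
Proof.
move=> cq /andP[d0 d1] /andP[r0 r1] w0 z1 z2 he.
have base j : (j <= m)%N -> exists2 y, a <= y <= a + r & `|q j y| <= (2 / d) ^+ m * w.
  move=> jm; have [y [y1 _]] := flat_points cq d0 z1 z2 jm.
  have [h1 h2] := y1 0%N ltac:(by rewrite expn_gt0); exists (y 0%N) => //.
  apply: (le_trans h2); apply: ler_wpM2r => //; apply: ler_weXn2l => //.
  by rewrite ler_pdivlMr// mul1r; lra.
set D := (2 / d) ^+ m * w in base *; have D0 : 0 <= D.
  by rewrite /D mulr_ge0// exprn_ge0// divr_ge0// ltW.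
have e0 : 0 <= e.
  by apply: (le_trans _ (he a a _ _)); rewrite ?normr_ge0// lexx lerDl.
suff H i : (i <= m)%N -> forall y, a <= y <= a + r -> `|q (m - i)%N y| <= i.+1%:R * D + e.
  move=> j jm y yI; have := H (m - j)%N (leq_subr _ _) y yI; rewrite subKn// => /le_trans; apply.
  by rewrite lerD2r ler_wpM2r// ler_nat; lia.
elim: i => [|i IH] im y yI.
  rewrite subn0 mul1r; have [z0 zI zb] := base m (leqnn m).
  have := he _ _ zI yI => h; have := ler_normD (q m y - q m z0) (q m z0).
  by rewrite subrK; lra.
have [z0 zI zb] := base (m - i.+1)%N (leq_subr _ _).
have {}IH := IH (ltnW im).
have jE : (m - i = (m - i.+1).+1)%N by clear -im; lia.
have jm : (m - i.+1 < m)%N by clear -im; lia.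
have key u v : a <= u -> u <= v -> v <= a + r ->
    `|q (m - i.+1)%N v - q (m - i.+1)%N u| <= i.+1%:R * D + e.
  move=> au uv vr.
  apply: (le_trans (mvt_bound (cq _ jm) uv (M := i.+1%:R * D + e) _)).
    by move=> t /andP[t1 t2]; rewrite -jE; apply: IH; apply/andP; split; lra.
  rewrite -[leRHS]mulr1; apply: ler_wpM2l; last lra.
  by rewrite addr_ge0// mulr_ge0.
have -> : i.+2%:R * D = D + i.+1%:R * D by rewrite -[i.+2]addn1 natrD; ring.
have := ler_normD (q (m - i.+1)%N y - q (m - i.+1)%N z0) (q (m - i.+1)%N z0); rewrite subrK.
have : `|q (m - i.+1)%N y - q (m - i.+1)%N z0| <= i.+1%:R * D + e.
  have [yz|zy] := leP y z0.
    rewrite distrC; apply: key => //; [by case/andP: yI|by case/andP: zI].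
  apply: key; [by case/andP: zI|exact: ltW|by case/andP: yI].
lra.
Qed.

End cells.

(** * The gradient on a small bad set *)

Section bad_sets.
Context {R : realType}.
Implicit Types (q g : nat -> R -> R) (p : {poly R}) (x y s t r : R) (m n N : nat).
Local Notation leb := (@lebesgue_measure R).

Lemma is_derive_affine (f : R -> R) (a c l t : R) : is_derive (a + c * t) (1 : R) f l ->
  is_derive t (1 : R) (fun u => f (a + c * u)) (c * l).
Proof.
move=> /is_deriveP df; apply/is_deriveP => e e0.
have c1 : 0 < `|c| + 1 by rewrite ltr_wpDl.
have [d d0 hd] := df (e / (`|c| + 1)) (divr_gt0 e0 c1).
exists (d / (`|c| + 1)); first exact: divr_gt0.
move=> h; rewrite ltr_pdivlMr// => hh.
have ch : `|c * h| < d.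
  rewrite normrM mulrC; apply: le_lt_trans hh; rewrite ler_wpM2l// lerDl//.
have := hd _ ch; rewrite mulrDr addrA => /le_trans h2.
have -> : c * l * h = l * (c * h) by ring.
apply: h2; rewrite normrM mulrAC ler_pdivrMr// -!mulrA ler_pM2l// mulrC ler_wpM2l// lerDl//.
Qed.

Lemma chain_affine q m (a c : R) : chain q m -> chain (fun j t => c ^+ j * q j (a + c * t)) m.
Proof.
move=> cq j jm t; have := is_derive_affine (cq j jm (a + c * t)).
move=> h; have := is_deriveZ (c ^+ j) h; move/is_derive_eq.
by apply; rewrite /GRing.scale /= exprSr mulrA.
Qed.

(** Dilation to the unit interval. The length [y2 - y1] is kept exactly in the top-order term, where
    its power m decides the estimate; the end term only sees the crude bound T. *)
Lemma flat_ends_scaled m : (2 <= m)%N -> exists2 C : R, 0 <= C &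
  forall q x y1 y2 (w M T : R), chain q m -> y1 <= x <= y2 -> y1 < y2 -> y2 - y1 <= T -> 1 <= T ->
  (forall j, (j < m)%N -> `|q j y1| <= w /\ `|q j y2| <= w) ->
  (forall t, y1 <= t <= y2 -> `|q m t| <= M) ->
  `|q 0%N x| <= C * T ^+ m * w + kap m * (y2 - y1) ^+ m * M.
Proof.
move=> m2; have [C C0 HC] := @flat_ends_bound R m m2; exists C => //.
move=> q x y1 y2 w M T cq /andP[y1x xy2] y12 yT T1 qw qM.
set c := y2 - y1; have c0 : 0 < c by rewrite subr_gt0.
have w0 : 0 <= w by apply: (le_trans _ (qw 0%N (ltnW m2)).1).
have := HC _ ((x - y1) / c) (T ^+ m * w) (c ^+ m * M) (chain_affine y1 c cq).
rewrite expr0 mul1r (_ : y1 + c * ((x - y1) / c) = x); last by field; rewrite gt_eqF.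
move=> /(_ _ _ _)/le_trans; apply; last by rewrite !mulrA.
- by rewrite divr_ge0 ?subr_ge0 ?(ltW y12)//= ler_pdivrMr// mul1r lerD2r.
- move=> j jm; have cT : c ^+ j <= T ^+ m.
    apply: (@le_trans _ _ (T ^+ j)); last by apply: ler_weXn2l => //; exact: ltnW.
    by rewrite lerXn2r ?nnegrE// ltW// (lt_le_trans ltr01).
  rewrite mulr0 mulr1 addr0 (_ : y1 + c = y2); last by rewrite /c; ring.
  rewrite !normrM normrX gtr0_norm//.
  by split; apply: ler_pM => //; [exact: exprn_ge0 (ltW c0)|exact: (qw j jm).1|exact: exprn_ge0 (ltW c0)|exact: (qw j jm).2].
- move=> t /andP[t0 t1]; rewrite normrM normrX gtr0_norm// ler_pM2l ?exprn_gt0//; apply: qM.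
  rewrite lerDl mulr_ge0 ?(ltW c0)//=.
  have : c * t <= c * 1 by rewrite ler_pM2l.
  by rewrite mulr1 /c; lra.
Qed.

(** To be applied with [q 0 = u']. In units of eps the chain becomes [eps ^+ j.+1 * q j (eps * t)],
    whose top member has a Hoelder constant A free of eps. A rich cell on each side of x contains
    [2 ^ m] separated good points, so all orders are small there, and [flat_ends_scaled] applies in
    between on a length at most [b / (1 - d) + 2 * d]. The parameters [w], [rho], [sig] are fixed
    before eps, which has to absorb them. *)
Lemma small_on_bad_set m (A d mu : R) : (2 <= m)%N -> 0 < A -> 0 < d <= 2^-1 -> 0 < mu ->
  exists2 eps : R, 0 < eps <= d & forall q x (b : R), chain q m -> 0 <= b <= mu ->
  (leb ([set t | (eps^-1 < q 0%N t ^+ 2)%R] `&` `[(x - eps * (2 * mu + 2))%R, (x + eps * (2 * mu + 2))%R[)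
     <= (eps * b)%:E)%E ->
  (forall s t, x - eps * (2 * mu + 2) <= s -> s <= t -> t <= x + eps * (2 * mu + 2) ->
     `|q m t - q m s| <= A * eps ^- m.+1 * Num.sqrt ((t - s) / eps)) ->
  eps * `|q 0%N x| <= d + kap m * (b / (1 - d) + 2 * d) ^+ m *
     (d + A * Num.sqrt (b / (1 - d) + 2 * d)).
Proof.
move=> m2 A0 /andP[d0 dh] mu0; have [C C0 HC] := @flat_ends_scaled m m2.
pose T := 2 * mu + 2; have T1 : 1 <= T by rewrite /T; lra.
have T0 : 0 < T by apply: lt_le_trans T1.
have CT0 : 0 < 1 + C * T ^+ m.
  by rewrite ltr_wpDr// mulr_ge0// exprn_ge0// ltW.
(* Small enough for the end term [C * T ^+ m * w] to stay below d. *)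
pose w := d / (1 + C * T ^+ m); have w0 : 0 < w by exact: divr_gt0.
have wd : w <= d.
  by rewrite ler_pdivrMr// ler_pMr// lerDl mulr_ge0// exprn_ge0// ltW.
have CTw : C * T ^+ m * w <= d.
  by rewrite /w mulrA ler_pdivrMr// mulrC ler_pM2l// lerDr.
(* Width of a cell in units of eps, such that the top order oscillates by at most [w / 2] on it. *)
pose rho := Num.min d ((w / (2 * A)) ^+ 2).
have wA0 : 0 < w / (2 * A) by rewrite divr_gt0// mulr_gt0.
have rho0 : 0 < rho by rewrite lt_min d0 exprn_gt0.
have rhod : rho <= d by rewrite ge_min lexx.
have Arho : A * Num.sqrt rho <= w / 2.
  rewrite mulrC -ler_pdivlMr//; apply: (@le_trans _ _ (Num.sqrt ((w / (2 * A)) ^+ 2))).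
    by rewrite ler_wsqrtr// ge_min lexx orbT.
  rewrite sqrtr_sqr gtr0_norm//; rewrite le_eqVlt; apply/orP; left; apply/eqP; field; exact: lt0r_neq0.
pose N := (2 ^ m)%N; have N0 : 0 < N%:R :> R by rewrite ltr0n expn_gt0.
have N1 : 1 <= N%:R :> R by rewrite ler1n expn_gt0.
(* Spacing in units of eps: [2 * N * sig] is half of the measure [d * rho] of the good part of a
   rich cell, which therefore holds N separated points. *)
pose sig := d * rho / (4 * N%:R).
have sig0 : 0 < sig by rewrite divr_gt0 ?mulr_gt0.
have sig1 : sig <= 1.
  rewrite ler_pdivrMr ?mulr_gt0// mul1r; apply: (@le_trans _ _ 1); last lra.
  by apply: mulr_ile1; rewrite ?ltW//; lra.
pose K := m.+1%:R * (2 / sig) ^+ m; have K0 : 0 < K by rewrite mulr_gt0// exprn_gt0// divr_gt0.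
(* At a good point the rescaled gradient is at most [sqrt eps], and [flat_cell] multiplies it by K;
   the product must not exceed [w / 2]. *)
pose eps := Num.min d ((w / (2 * K)) ^+ 2).
have wK0 : 0 < w / (2 * K) by rewrite divr_gt0// mulr_gt0.
have e0 : 0 < eps by rewrite lt_min d0 exprn_gt0.
have ed : eps <= d by rewrite ge_min lexx.
have Ke : K * Num.sqrt eps <= w / 2.
  rewrite mulrC -ler_pdivlMr//; apply: (@le_trans _ _ (Num.sqrt ((w / (2 * K)) ^+ 2))).
    by rewrite ler_wsqrtr// ge_min lexx orbT.
  rewrite sqrtr_sqr gtr0_norm//; rewrite le_eqVlt; apply/orP; left; apply/eqP; field; exact: lt0r_neq0.
exists eps; first by rewrite e0 ed.
move=> q x b cq /andP[b0 bmu]; rewrite -/T; set B := [set t | _] => hB hH.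
have cont0 : continuous (q 0%N) by apply: chain_continuous cq _; exact: ltnW.
have mB : measurable B.
  have mf : measurable_fun setT (fun t => q 0%N t ^+ 2).
    by apply: measurable_funX; exact: continuous_measurable_fun.
  have := mf measurableT `]eps^-1, +oo[%classic (measurable_itv _); rewrite setTI.
  by congr (measurable _); apply/seteqP; split => t; rewrite /B /= in_itv /= andbT.
pose r := eps * rho; have r0 : 0 < r by exact: mulr_gt0.
(* The n cells on one side cover more than [2 * mu + 1] units without leaving the window. As
   [1 - d >= 1 / 2], they cannot all be poor when [b <= mu]. *)
pose n := (Num.truncn ((2 * mu + 1) / rho)).+1.
have nlt : (2 * mu + 1) / rho < n%:R by rewrite /n; apply: truncnS_gt.
have nle : n%:R <= (2 * mu + 1) / rho + 1.
  by rewrite /n -natr1 lerD2r; rewrite Num.Theory.truncn_le divr_ge0 ?(ltW rho0)//; lra.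
have nrho : 2 * mu + 1 < n%:R * rho <= T.
  rewrite -ltr_pdivrMr// nlt /=; apply: (@le_trans _ _ (((2 * mu + 1) / rho + 1) * rho)).
    by rewrite ler_pM2r.
  by rewrite mulrDl divfK ?gt_eqF// mul1r /T; lra.
have nr : n%:R * r <= eps * T by rewrite /r mulrCA ler_pM2l//; case/andP: nrho.
have d01 : 0 < d < 1 by rewrite d0 /=; lra.
have bn : eps * b < n%:R * ((1 - d) * r).
  rewrite /r (_ : n%:R * ((1 - d) * (eps * rho)) = eps * ((1 - d) * (n%:R * rho))); last ring.
  rewrite ltr_pM2l//; have /andP[h _] := nrho; nra.
have [a1 [a2 [[a1l a1x xa2 a2r aa] [rich1 rich2]]]] : exists a1 a2, [/\ x - n%:R * r <= a1, a1 + r <= x, x <= a2, a2 + r <= x + n%:R * r &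
    a2 + r - a1 <= (eps * b) / (1 - d) + 2 * r] /\
  ((d * r)%:E <= leb (`[a1, (a1 + r)%R[ `\` B))%E /\
  ((d * r)%:E <= leb (`[a2, (a2 + r)%R[ `\` B))%E.
  apply: (rich_cells mB r0 d01 bn); apply: le_trans hB; apply: le_measure; rewrite ?inE//; [exact: measurableI..|].
  by apply: setIS; apply: subset_itv; rewrite bnd_simp; lra.
pose Q j t := eps ^+ j.+1 * q j (0 + eps * t).
have cQ : chain Q m.
  move=> j jm t; have := is_deriveZ eps (chain_affine 0 eps cq jm t).
  have -> : eps *: (eps ^+ j.+1 * q j.+1 (0 + eps * t)) = Q j.+1 t.
    by rewrite /Q [in RHS]exprS -mulrA.
  by congr (is_derive _ _ _ _); apply/funext => u; rewrite /Q exprS -mulrA.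
have QH s t : x / eps - T <= s -> s <= t -> t <= x / eps + T -> `|Q m t - Q m s| <= A * Num.sqrt (t - s).
  move=> h1 h2 h3; rewrite /Q -mulrBr normrM normrX (gtr0_norm e0) !add0r.
  have ep : 0 < eps ^+ m.+1 by rewrite exprn_gt0.
  rewrite [leLHS]mulrC -ler_pdivlMr// mulrAC.
  have -> : t - s = (eps * t - eps * s) / eps by field; rewrite gt_eqF.
  apply: hH.
  - move: h1; rewrite -(ler_pM2l e0) mulrBr mulrCA divff ?gt_eqF// mulr1; lra.
  - by rewrite ler_pM2l.
  - by move: h3; rewrite -(ler_pM2l e0) mulrDr mulrCA divff ?gt_eqF// mulr1; lra.
have cellflat a : x - n%:R * r <= a -> a + r <= x + n%:R * r ->
   ((d * r)%:E <= leb (`[a, (a + r)%R[ `\` B))%E ->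
   exists y, a <= y <= a + r /\ y < a + r /\ forall j, (j <= m)%N -> `|Q j (y / eps)| <= w.
  move=> al ar hr; pose dd := eps * sig; have dd0 : 0 < dd by exact: mulr_gt0.
  have Sab : (`[a, a + r[ `\` B)%classic `<=` `[a, a + r]%classic.
    by move=> u [/= + _]; rewrite !in_itv /= => /andP[-> /ltW].
  have mS : measurable (`[a, a + r[ `\` B)%classic by exact: measurableD.
  have hN : ((2 * N%:R * dd)%:E < leb (`[a, (a + r)%R[ `\` B))%E.
    apply: lt_le_trans hr; rewrite lte_fin /dd /sig /r.
    rewrite (_ : 2 * N%:R * _ = d * (eps * rho) / 2); last by field; rewrite gt_eqF.
    by rewrite ltr_pdivrMr// ltr_pMr ?mulr_gt0// ltr1n.
  have [z [z1 z2]] := separated_points mS Sab dd0 hN.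
  have N0' : (0 < N)%N by rewrite expn_gt0.
  have [z0I _] := z1 0%N N0'; rewrite /= in_itv /= in z0I.
  exists (z 0%N); case/andP: z0I => z0a z0r; split; [by rewrite z0a ltW|split=> //].
  have h := @flat_cell R Q m (a / eps) rho sig (Num.sqrt eps) (A * Num.sqrt rho) (fun i => z i / eps) cQ.
  have s01 : 0 < sig <= 1 by rewrite sig0.
  have r01 : 0 <= rho <= 1 by rewrite ltW//=; lra.
  have arE : a / eps + rho = (a + r) / eps by rewrite /r; field; rewrite gt_eqF.
  have {}h := h s01 r01 (sqrtr_ge0 _).
  move=> j jm; apply: le_trans (h _ _ _ j jm _ _) _.
  - move=> i iN; have [/= zi nB] := z1 i iN; move: zi; rewrite in_itv /= => /andP[zi1 zi2]; split.
      by rewrite arE !ler_pM2r ?invr_gt0// zi1 ltW.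
    rewrite /Q add0r expr1 (_ : eps * (z i / eps) = z i); last by field; rewrite gt_eqF.
    rewrite -[X in X <= _]ger0_norm// -sqrtr_sqr ler_wsqrtr// real_normK ?num_real// exprMn.
    move/negP: nB; rewrite /B /= -leNgt => qe.
    rewrite expr2 -mulrA -[leRHS]mulr1 ler_pM2l// mulrC -ler_pdivlMr// mul1r//.
  - move=> i iN; have := z2 i iN; rewrite /dd => hz.
    have -> : z i / eps + sig = (z i + eps * sig) / eps by field; rewrite gt_eqF.
    by rewrite ler_pM2r ?invr_gt0.
  - move=> s t /andP[s1 s2] /andP[t1 t2].
    have lo : x / eps - T <= a / eps.
      by rewrite lerBlDr ler_pdivrMr// mulrDl divfK ?gt_eqF//; move: al nr; clear; lra.
    have hi : a / eps + rho <= x / eps + T.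
      by rewrite arE ler_pdivrMr// mulrDl divfK ?gt_eqF//; move: ar nr; clear; lra.
    have [st|ts] := leP s t.
      apply: le_trans (QH s t _ _ _) _ => //; [exact: le_trans lo s1|exact: le_trans t2 hi|].
      by rewrite ler_pM2l// ler_wsqrtr//; move: s1 t2; clear; lra.
    rewrite distrC; apply: le_trans (QH t s _ _ _) _ => //; [exact: le_trans lo t1|exact: ltW|exact: le_trans s2 hi|].
    by rewrite ler_pM2l// ler_wsqrtr//; move: t1 s2; clear; lra.
  - by rewrite arE !ler_pM2r ?invr_gt0// z0a ltW.
  - by move: Ke Arho; rewrite /K; set u := (2 / sig) ^+ m; lra.
have [y1 [/andP[y1a _] [y1r f1]]] := cellflat a1 a1l ltac:(lra) rich1.
have [y2 [/andP[y2a y2r'] [y2r f2]]] := cellflat a2 ltac:(lra) a2r rich2.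
set bb := b / (1 - d) + 2 * d.
have hT : y2 / eps - y1 / eps <= b / (1 - d) + 2 * rho.
  rewrite -mulrBl ler_pdivrMr// mulrDl.
  have -> : b / (1 - d) * eps = eps * b / (1 - d) by field; lra.
  have -> : 2 * rho * eps = 2 * r by rewrite /r; ring.
  lra.
have b2 : b / (1 - d) <= 2 * mu by rewrite ler_pdivrMr; [nra|lra].
have c1 : 0 <= y2 / eps - y1 / eps by rewrite -mulrBl divr_ge0 ?ltW// subr_gt0; move: y1r a1x xa2 y2a; clear; lra.
have cbb : y2 / eps - y1 / eps <= bb by rewrite /bb; lra.
have bb0 : 0 <= bb by lra.
have Q0 : Q 0%N (x / eps) = eps * q 0%N x.
  by rewrite /Q add0r expr1 mulrCA divff ?gt_eqF// mulr1.
have := HC Q (x / eps) (y1 / eps) (y2 / eps) w (d + A * Num.sqrt bb) T cQ.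
rewrite Q0 normrM (gtr0_norm e0) => /(_ _ _ _ _ _ _)/le_trans; apply => //.
- by rewrite !ler_pM2r ?invr_gt0//; move: y1r a1x xa2 y2a; clear => *; apply/andP; split; lra.
- by rewrite ltr_pM2r ?invr_gt0//; move: y1r a1x xa2 y2a; clear; lra.
- by rewrite /T; lra.
- by move=> j jm; split; [apply: f1|apply: f2]; exact: ltnW.
- move=> t /andP[t1 t2].
  have := QH (y1 / eps) t _ t1 _ => /(_ _ _).
  have h1 : x / eps - T <= y1 / eps.
    by rewrite lerBlDr ler_pdivrMr// mulrDl divfK ?gt_eqF//; move: a1l y1a nr; clear; lra.
  have h2 : t <= x / eps + T.
    by apply: (le_trans t2); rewrite ler_pdivrMr// mulrDl divfK ?gt_eqF//; move: y2r' a2r nr; clear; lra.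
  move=> /(_ h1 h2) h3; have h4 := f1 m (leqnn m).
  have h5 : A * Num.sqrt (t - y1 / eps) <= A * Num.sqrt bb.
    by rewrite ler_pM2l// ler_wsqrtr//; move: t2 cbb; clear; lra.
  have := ler_normD (Q m t - Q m (y1 / eps)) (Q m (y1 / eps)); rewrite subrK; lra.
- apply: lerD => //; apply: ler_wpM2r; first by rewrite addr_ge0 ?(ltW d0)// mulr_ge0 ?sqrtr_ge0// ltW.
  by apply: ler_wpM2l; [rewrite ltW ?kap_gt0|rewrite lerXn2r ?nnegrE].
Qed.

End bad_sets.

(** * Smooth bumps *)

Section bumps.
Context {R : realType}.
Implicit Types (f g u v : R -> R) (p : {poly R}) (x y s t r : R) (m n N : nat).

(** Polynomials in [1 / t] times [exp (- 1 / t)], extended by 0: a class closed under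
    differentiation. *)
Definition bumpexp p (t : R) : R := if t <= 0 then 0 else p.[t^-1] * expR (- t^-1).

Lemma poly_bound p : exists C : R, forall y, 1 <= y -> `|p.[y]| <= C * y ^+ size p.
Proof.
exists (\sum_(i < size p) `|p`_i|) => y y1.
rewrite horner_coef mulr_suml; apply: le_trans (ler_norm_sum _ _ _) _.
apply: ler_sum => i _; rewrite normrM ler_wpM2l// normrX ger0_norm ?(le_trans ler01)//.
by apply: ler_weXn2l => //; exact: ltnW.
Qed.

(** One term of the exponential series, of degree one more than the power bounding p, beats the
    polynomial. *)
Lemma poly_expRN p (e : R) : 0 < e -> exists2 d, 0 < d &
  forall t, 0 < t < d -> `|p.[t^-1] * expR (- t^-1)| <= e.
Proof.
move=> e0; have [C hC] := poly_bound p; set n := size p in hC.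
have C0 : 0 <= C by have := hC 1 (lexx _); rewrite expr1n mulr1; apply: le_trans.
pose K := (C + 1) * n.+1`!%:R.
have K0 : 0 < K by rewrite mulr_gt0 ?ltr_wpDl// ltr0n fact_gt0.
exists (Num.min 1 (e / K)); first by rewrite lt_min ltr01 divr_gt0.
move=> t /andP[t0]; rewrite lt_min => /andP[t1 te].
set y := t^-1; have y1 : 1 <= y by rewrite invf_ge1// ltW.
have y0 : 0 < y by rewrite invr_gt0.
rewrite normrM (gtr0_norm (expR_gt0 _)) expRN ler_pdivrMr ?expR_gt0//.
apply: le_trans (hC y y1) _.
have h : y ^+ n.+1 / n.+1`!%:R <= expR y.
  by apply: le_trans (expR_ge1Dxn n (ltW y0)); rewrite lerDr.
apply: (@le_trans _ _ (e * (y ^+ n.+1 / n.+1`!%:R))); last by rewrite ler_pM2l.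
rewrite exprS mulrA ler_pdivlMr ?ltr0n ?fact_gt0// mulrA mulrAC ler_pM2r ?exprn_gt0//.
move: te; rewrite ltr_pdivlMr// => te.
have yt : y * t = 1 by rewrite /y mulVf ?gt_eqF.
rewrite -(ler_pM2r t0) -[leRHS]mulrA yt mulr1; apply: (le_trans _ (ltW te)).
rewrite mulrC ler_pM2l// /K mulrDl mul1r lerDl ler0n//.
Qed.

Lemma is_derive_bumpexp p t :
  is_derive t (1 : R) (bumpexp p) (bumpexp ('X^2 * (p - p^`())) t).
Proof.
apply/is_deriveP => e e0; rewrite /bumpexp; have [t0|t0] := leP t 0.
  move: t0; rewrite le_eqVlt => /predU1P[->|t0].
    (* At 0 the difference quotient of [bumpexp p] is [bumpexp ('X * p)]. *)
    have [d d0 hd] := poly_expRN ('X * p) e0; exists d => // h hd'.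
    rewrite add0r subr0 mul0r subr0; case: ifPn => [_|]; first by rewrite normr0 mulr_ge0// ltW.
    rewrite -ltNge => h0; have := hd h; rewrite h0 (le_lt_trans (ler_norm _) hd') => /(_ isT).
    rewrite hornerM hornerX -mulrA normrM => hh.
    rewrite (gtr0_norm h0) -ler_pdivrMr// mulrC; move: hh.
    by rewrite gtr0_norm// invr_gt0.
  exists (- t); first by rewrite oppr_gt0.
  move=> h; rewrite ltr_norml => /andP[h1 h2]; have -> : t + h <= 0 by lra.
  by rewrite subrr mul0r subr0 normr0 mulr_ge0// ltW.
have dV : is_derive t (1 : R) (fun z : R => z^-1) (- t ^- 2).
  have := is_deriveV (f := id) (x := t) (lt0r_neq0 t0) (is_derive_id t (1 : R)).
  by move/is_derive_eq; apply; rewrite /GRing.scale /= mulr1.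
have d1 : is_derive t (1 : R) (fun z => p.[z^-1]) (p^`().[t^-1] * - t ^- 2).
  exact: (@is_derive1_comp R (horner p) (fun z => z^-1) t _ _ (is_derive_poly p t^-1) dV).
have d2 : is_derive t (1 : R) (fun z => expR (- z^-1)) (expR (- t^-1) * t ^- 2).
  have dN : is_derive t (1 : R) (fun z : R => - z^-1) (t ^- 2).
    by have := is_deriveN dV; move/is_derive_eq; apply; rewrite opprK.
  exact: (@is_derive1_comp R expR (fun z => - z^-1) t _ _ (is_derive_expR _) dN).
have := is_deriveM d1 d2 => /is_deriveP /(_ e e0) [d d0 hd].
exists (Num.min d t); first by rewrite lt_min d0.
move=> h; rewrite lt_min => /andP[h1 h2].
have -> : (t + h <= 0) = false.
  by apply/negbTE; rewrite -ltNge; move: h2; rewrite ltr_norml => /andP[]; lra.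
apply: le_trans (hd h h1); rewrite le_eqVlt; apply/orP; left; apply/eqP; congr (`| _ - _ * _ |).
rewrite /GRing.scale /= hornerM hornerXn hornerD hornerN -exprVn; ring.
Qed.

(** A class of functions stable under derivation by construction; smoothness of products and
    translates then needs a single derivative, not a formula for all orders. *)
Inductive smoothgen : (R -> R) -> Prop :=
| smoothgen_bump p (a c : R) : smoothgen (fun t => bumpexp p (a + c * t))
| smoothgen_add f g : smoothgen f -> smoothgen g -> smoothgen (fun t => f t + g t)
| smoothgen_mul f g : smoothgen f -> smoothgen g -> smoothgen (fun t => f t * g t)
| smoothgen_scale (c : R) f : smoothgen f -> smoothgen (fun t => c * f t).

Lemma smoothgen_derive f : smoothgen f -> exists2 f', smoothgen f' & forall t, is_derive t (1 : R) f (f' t).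
Proof.
elim=> [p a c|{}f g sf [f' sf' df] sg [g' sg' dg]|{}f g sf [f' sf' df] sg [g' sg' dg]|c {}f sf [f' sf' df]].
- exists (fun t => c * bumpexp ('X^2 * (p - p^`())) (a + c * t)).
    exact/smoothgen_scale/smoothgen_bump.
  by move=> t; apply: is_derive_affine; exact: is_derive_bumpexp.
- exists (fun t => f' t + g' t); first exact: smoothgen_add.
  by move=> t; have := df t; have := dg t => ? ?; exact: is_deriveD.
- exists (fun t => f t * g' t + g t * f' t).
    by apply: smoothgen_add; exact: smoothgen_mul.
  by move=> t; exact: is_deriveM (df t) (dg t).
- exists (fun t => c * f' t); first exact: smoothgen_scale.
  by move=> t; exact: is_deriveZ (df t).
Qed.

Definition smooth (f : R -> R) := forall n t, derivable (derive1n n f) t 1.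

Lemma derive1P (f f' : R -> R) : (forall t, is_derive t (1 : R) f (f' t)) -> derive1 f = f'.
Proof. by move=> df; apply/funext => t; rewrite derive1E; have [_ ->] := df t. Qed.

Lemma smoothgen_smooth f : smoothgen f -> smooth f.
Proof.
move=> sf n; have : smoothgen (derive1n n f).
  elim: n => // n IH; rewrite derive1nS.
  by have [f' sf' df] := smoothgen_derive IH; rewrite (derive1P df).
by move=> /smoothgen_derive[f' _ df] t; have [] := df t.
Qed.

Lemma smooth_primitive (f F : R -> R) : smooth f -> (forall t, is_derive t (1 : R) F (f t)) -> smooth F.
Proof.
move=> sf dF [|n] t; first by have [] := dF t.
by rewrite derive1Sn (derive1P dF); exact: sf.
Qed.

Lemma smooth_derive (f : R -> R) : smooth f -> smooth (derive1 f).
Proof. by move=> sf n t; rewrite -derive1Sn; exact: sf. Qed.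

Lemma smooth_is_derive (f : R -> R) n : smooth f ->
  forall t, is_derive t (1 : R) (derive1n n f) (derive1n n.+1 f t).
Proof. by move=> sf t; rewrite derive1nS derive1E; apply: DeriveDef. Qed.

Lemma smooth_continuous (f : R -> R) n : smooth f -> continuous (derive1n n f).
Proof. move=> sf; apply: is_derive_continuous; exact: smooth_is_derive. Qed.

(* Vanishes outside ]a, b[ and increases to its indicator as [m -> oo]. *)
Definition sbump (a b : R) m (t : R) : R :=
  bumpexp 1 (- (m.+1%:R * a) + m.+1%:R * t) * bumpexp 1 (m.+1%:R * b + - m.+1%:R * t).

Lemma bumpexp1E t : bumpexp 1 t = if t <= 0 then 0 else expR (- t^-1).
Proof. by rewrite /bumpexp hornerC mul1r. Qed.

Lemma bumpexp1_itv t : 0 <= bumpexp 1 t <= 1.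
Proof.
rewrite bumpexp1E; case: ifPn => [_|]; first by rewrite lexx ler01.
by rewrite -ltNge => t0; rewrite expR_ge0 -expR0 ler_expR oppr_le0 invr_ge0 ltW.
Qed.

Lemma bump_itv a b m t : 0 <= sbump a b m t <= 1.
Proof.
rewrite /sbump; have /andP[h1 h2] := bumpexp1_itv (- (m.+1%:R * a) + m.+1%:R * t).
have /andP[h3 h4] := bumpexp1_itv (m.+1%:R * b + - m.+1%:R * t).
by rewrite mulr_ge0//= mulr_ile1.
Qed.

Lemma bump_out a b m t : ~~ (a < t < b) -> sbump a b m t = 0.
Proof.
have m0 : 0 < m.+1%:R :> R by rewrite ltr0n.
rewrite negb_and -!leNgt => /orP[ta|bt]; rewrite /sbump !bumpexp1E.
  have -> : - (m.+1%:R * a) + m.+1%:R * t <= 0 by rewrite addrC subr_le0 ler_pM2l.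
  by rewrite mul0r.
have -> : m.+1%:R * b + - m.+1%:R * t <= 0 by rewrite mulNr subr_le0 ler_pM2l.
by rewrite mulr0.
Qed.

Lemma smooth_bump a b m : smooth (sbump a b m).
Proof. by apply: smoothgen_smooth; apply: smoothgen_mul; exact: smoothgen_bump. Qed.

Lemma bumpexp1_cvg (x : R) : 0 < x -> (fun m => bumpexp 1 (m.+1%:R * x)) @ \oo --> (1 : R).
Proof.
move=> x0; have -> : (fun m => bumpexp 1 (m.+1%:R * x)) = (fun m => expR (- (x^-1 * (m.+1%:R)^-1))).
  apply/funext => m; rewrite bumpexp1E ifF; first by rewrite invfM mulrC.
  by apply/negbTE; rewrite -ltNge mulr_gt0.
rewrite -[X in _ --> X]expR0; apply: continuous_cvg; first exact: continuous_expR.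
rewrite -[X in _ --> X]oppr0; apply: cvgN; rewrite -[X in _ --> X](mulr0 (x^-1)); apply: cvgM; [exact: cvg_cst|]. exact: cvg_harmonic.
Qed.

Lemma bump_cvg a b t : (fun m => sbump a b m t) @ \oo --> (\1_(`]a, b[%classic) t : R).
Proof.
rewrite indicE; have [|] := boolP (t \in _).
  rewrite inE /= in_itv /= => /andP[at_ tb]; rewrite -[1%:R]mulr1.
  have -> : (fun m => sbump a b m t) = (fun m => bumpexp 1 (m.+1%:R * (t - a)) * bumpexp 1 (m.+1%:R * (b - t))).
    by apply/funext => m; rewrite /sbump; congr (bumpexp _ _ * bumpexp _ _); ring.
  by apply: cvgM; apply: bumpexp1_cvg; rewrite subr_gt0.
rewrite notin_setE /= in_itv /= => /negP /bump_out h; have -> : (fun m => sbump a b m t) = (fun=> 0) by apply/funext => m; exact: h.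
exact: cvg_cst.
Qed.

End bumps.

(** * Primitives of integrable functions *)

Section primitives.
Context {R : realType}.
Implicit Types (f g u v : R -> R) (p : {poly R}) (x y s t r : R) (m n N : nat).
Local Notation leb := (@lebesgue_measure R).
Local Notation I := (@I01 R).

Lemma aeS (P Q : R -> Prop) : (forall t, P t -> Q t) -> {ae leb, forall t, P t} -> {ae leb, forall t, Q t}.
Proof. by move=> PQ [A [mA A0 PA]]; exists A; split=> // t Qt; apply: PA => /PQ. Qed.

Lemma aeI (P Q : R -> Prop) : {ae leb, forall t, P t} -> {ae leb, forall t, Q t} ->
  {ae leb, forall t, P t /\ Q t}.
Proof.
move=> [A [mA A0 PA]] [B [mB B0 QB]]; exists (A `|` B); split; first exact: measurableU.
  by rewrite measureU0.
move=> t /not_andP[nP|nQ]; [left; exact: PA|right; exact: QB].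
Qed.

Lemma measurable_I01 : measurable I.
Proof. exact: measurable_itv. Qed.
Hint Resolve measurable_I01 : core.

Lemma leb_I01 : leb I = 1%E.
Proof. by rewrite /I01 lebesgue_measure_itv /= lte_fin ltr01 -EFinD subr0. Qed.

Lemma I01E t : I t <-> 0 < t < 1.
Proof. by rewrite /I01 /= in_itv. Qed.

Lemma Rintegral_dominated (D : set R) (fn : nat -> R -> R) f g : measurable D ->
  (forall n, measurable_fun D (fn n)) -> measurable_fun D f ->
  {ae leb, forall t, D t -> fn ^~ t @ \oo --> f t} ->
  leb.-integrable D (EFin \o g) ->
  (forall t n, D t -> `|fn n t| <= g t) ->
  leb.-integrable D (EFin \o f) /\
  (fun n => \int[leb]_(t in D) fn n t) @ \oo --> \int[leb]_(t in D) f t.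
Proof.
move=> mD mfn mf fnf ig fng.
have [||||h1 _ h3] := @dominated_convergence _ _ R leb D mD (fun n => EFin \o fn n) (EFin \o f) (EFin \o g) _ _ _ ig.
- by move=> n; apply/measurable_EFinP; exact: mfn.
- exact/measurable_EFinP.
- by apply: aeS fnf => t ht Dt; apply: cvg_EFin; [exact: nearW|exact: ht].
- by apply: aeW => t n Dt /=; rewrite lee_fin fng.
split=> //; apply: fine_cvg; rewrite fineK; first exact: h3.
exact: integrable_fin_num.
Qed.

Definition Prim f (t : R) : R := \int[leb]_(s in `]-oo, t]) f s.

Lemma PrimB f s t : leb.-integrable setT (EFin \o f) -> s <= t ->
  Prim f t - Prim f s = \int[leb]_(x in `]s, t]) f x.
Proof.
move=> fi st; rewrite /Prim Rintegral_itvB ?bnd_simp//.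
by apply: integrableS fi.
Qed.

Lemma le_PrimB f s t : leb.-integrable setT (EFin \o f) -> s <= t ->
  `|Prim f t - Prim f s| <= \int[leb]_(x in `]s, t]) `|f x|.
Proof.
move=> fi st; rewrite PrimB//; apply: le_normr_Rintegral => //.
by apply: integrableS fi.
Qed.

Lemma Prim_is_derive f t : leb.-integrable setT (EFin \o f) -> {for t, continuous f} ->
  is_derive t (1 : R) (Prim f) (f t).
Proof.
move=> fi cf; have t1 : t < t + 1 by rewrite ltrDl.
have fi' : leb.-integrable [set` Interval -oo%O (BRight (t + 1))] (EFin \o f) by apply: integrableS fi.
have [|d dE] := continuous_FTC1 t1 fi' _ cf; first by rewrite ltNyr.
by apply: DeriveDef; [exact: d|rewrite -derive1E; exact: dE].
Qed.

Lemma Prim_ae_derive f : leb.-integrable setT (EFin \o f) ->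
  {ae leb, forall t, is_derive t (1 : R) (Prim f) (f t)}.
Proof.
move=> fi; have := @FTC1Ny R f _ _.
have fl : locally_integrable setT f by apply: open_integrable_locally => //; exact: openT.
move=> /(_ _ fl); have h y : leb.-integrable `]-oo, y] (EFin \o f) by apply: integrableS fi.
move=> /(_ h); apply: aeS => t [d dE].
by apply: DeriveDef; [exact: d|rewrite -derive1E; exact: dE].
Qed.

Lemma Prim_continuous f : leb.-integrable setT (EFin \o f) -> continuous (Prim f).
Proof.
move=> fi t; apply/cvgrPdist_lt => e e0.
have fi' : leb.-integrable [set: R] (EFin \o f) by [].
have [d [d0 hd]] := integral_normr_continuous fi' e0.
apply/nbhs_ballP; exists d => //= s; rewrite /ball /= => sd.
have key x y : x <= y -> y - x < d -> `|Prim f y - Prim f x| < e.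
  move=> xy yx; apply: (le_lt_trans (le_PrimB fi xy)); apply: hd => //.
  rewrite -[X in (X < _)%E]/(leb `]x, y]%classic) lebesgue_measure_itv /=; case: ifP => _; last by rewrite lte_fin.
  by rewrite -EFinD lte_fin.
have [st|ts] := leP s t.
  by apply: key => //; move: sd; rewrite ltr_norml => /andP[_].
rewrite distrC; apply: key; [exact: ltW|].
by move: sd; rewrite ltr_norml => /andP[]; lra.
Qed.

Definition prim f : R -> R := Prim (f \_ I).

Lemma integrable_patch f : leb.-integrable I (EFin \o f) -> leb.-integrable setT (EFin \o (f \_ I)).
Proof. by move=> fi; rewrite -restrict_EFin; apply/integrable_restrict => //; rewrite setTI. Qed.

Lemma prim_continuous f : L1 f -> continuous (prim f).
Proof. by move=> /integrable_patch; exact: Prim_continuous. Qed.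

Lemma prim_ae_derive f : L1 f -> {ae leb, forall t, I t -> is_derive t (1 : R) (prim f) (f t)}.
Proof.
move=> /integrable_patch/Prim_ae_derive; apply: aeS => t h It.
by move: h; rewrite patchE mem_set.
Qed.

Lemma primB f s t : L1 f -> 0 <= s -> s <= t -> t <= 1 ->
  prim f t - prim f s = \int[leb]_(x in `]s, t[) f x.
Proof.
move=> fi s0 st t1; rewrite /prim PrimB//; last exact: integrable_patch.
rewrite -Rintegral_itv_bndo_bndc; last by apply: integrableS (integrable_patch fi).
apply: eq_Rintegral => x; rewrite inE /= in_itv /= => /andP[sx xt].
by rewrite patchE mem_set//; apply/I01E; rewrite (le_lt_trans s0)// (lt_le_trans xt).
Qed.

Lemma test_bounded (f : R -> R) : continuous f -> exists2 M : R, 0 < M & forall t, 0 <= t <= 1 -> `|f t| <= M.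
Proof.
move=> cf; have [c _ hc] := @EVT_max R (fun t => `|f t|) 0 1 ler01 ltac:(apply: continuous_subspaceT => t; apply: continuous_comp; [exact: cf|exact: norm_continuous]).
by exists (`|f c| + 1) => [|t t01]; [rewrite ltr_wpDl|rewrite (le_trans (hc _ _)) ?in_itv//= lerDl].
Qed.

Lemma integrable_mul_continuous f g : L1 f -> continuous g -> L1 (fun t => f t * g t).
Proof.
move=> fi cg; have [M M0 hM] := test_bounded cg.
have := @integrableMr _ _ R leb I measurable_I01 g (EFin \o f).
move=> /(_ _ _ fi) h; apply: eq_integrable (h _ _) => //.
- by move=> t _ /=; rewrite -EFinM mulrC.
- by apply: measurable_funTS; exact: continuous_measurable_fun.
- exists M; split; first exact: num_real.
  move=> x Mx t /I01E/andP[t0 t1] /=; apply: ltW; apply: le_lt_trans Mx.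
  by apply: hM; rewrite !ltW.
Qed.

Lemma L1_continuous f : continuous f -> L1 f.
Proof.
move=> cf; have h1 : L1 (fun=> 1 : R).
  rewrite /L1; apply: measurable_bounded_integrable => //; first by rewrite [X in (X < _)%E]leb_I01 ltry.
  by exists 1; split=> // x x1 t _ /=; rewrite normr1 ltW.
have := integrable_mul_continuous h1 cf; apply: eq_integrable => // t _ /=.
by rewrite mul1r.
Qed.

Lemma L1_measurable f : L1 f -> measurable_fun I f.
Proof. by move=> /(measurable_int leb)/measurable_EFinP. Qed.

Lemma test_smooth phi : @test_function R phi -> smooth phi.
Proof. by case. Qed.

Lemma test_derive phi n : @test_function R phi -> test_function (derive1n n phi).
Proof.
move=> [sphi [a [b [a0 b1 hab]]]]; split.
  by elim: n => [|n IH]; [exact: sphi|rewrite derive1nS; exact: smooth_derive].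
exists a, b; split=> //; elim: n => // n IH t tab.
rewrite derive1nS derive1E; apply: (@derive_val _ _ _ _ _ _ _ _); apply/is_deriveP => e e0.
have [at_|ta] := leP a t; last first.
  exists (a - t); first by rewrite subr_gt0.
  move=> h; rewrite ltr_norml => /andP[h1 h2]; rewrite !IH.
  - by rewrite subrr mul0r subrr normr0 mulr_ge0// ltW.
  - by rewrite /= in_itv /= => /andP[]; lra.
  - by rewrite /= in_itv /= => /andP[]; lra.
have [tb|bt] := leP t b; first by case: tab; rewrite /= in_itv /= at_.
exists (t - b); first by rewrite subr_gt0.
move=> h; rewrite ltr_norml => /andP[h1 h2]; rewrite !IH.
- by rewrite subrr mul0r subrr normr0 mulr_ge0// ltW.
- by rewrite /= in_itv /= => /andP[]; lra.
- by rewrite /= in_itv /= => /andP[]; lra.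
Qed.

Lemma integral_derive_tail phi s : @test_function R phi -> 0 <= s ->
  \int[leb]_(t in I `&` `[s, +oo[) derive1 phi t = - phi s.
Proof.
move=> tphi s0; have sp := test_smooth tphi.
have phi_out t : ~~ (0 < t < 1) -> phi t = 0.
  move=> ht; have [_ [a [b [a0 b1 hab]]]] := tphi; apply: hab.
  by rewrite /= in_itv /= => /andP[h1 h2]; move: ht; rewrite (lt_le_trans a0 h1) (le_lt_trans h2 b1).
have [s1|s1] := leP 1 s.
  have -> : I `&` `[s, +oo[ = set0.
    by apply/seteqP; split => // t [/I01E/andP[_ t1]] /=; rewrite in_itv /= andbT leNgt (lt_le_trans t1 s1).
  by rewrite Rintegral_set0 phi_out ?oppr0// negb_and -!leNgt s1 orbT.
have c0 : continuous phi := @smooth_continuous R _ 0 sp.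
have c1 : continuous (derive1 phi) := @smooth_continuous R _ 1 sp.
have d0 t : is_derive t (1 : R) phi (derive1 phi t) := @smooth_is_derive R _ 0 sp t.
have ftc : (\int[leb]_(t in `[s, 1%R]) (derive1 phi t)%:E = (phi 1)%:E - (phi s)%:E)%E.
  apply: continuous_FTC2 => //.
  - by apply: continuous_subspaceT.
  - split; [by move=> t _; have [] := d0 t|exact: cvg_at_right_filter (c0 s)|exact: cvg_at_left_filter (c0 1)].
rewrite (phi_out 1) ?ltxx ?andbF// sub0e in ftc.
rewrite /Rintegral.
have -> : (\int[leb]_(t in I `&` `[s, +oo[) (derive1 phi t)%:E = \int[leb]_(t in `[s, 1%R]) (derive1 phi t)%:E)%E.
  have mm : measurable_fun (`[s, 1[ : set R) (EFin \o derive1 phi).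
    by apply/measurable_EFinP; apply: measurable_funTS; exact: continuous_measurable_fun.
  rewrite -(integral_itv_bndo_bndc (a := BLeft s))//.
  move: s0; rewrite le_eqVlt => /predU1P[s0|s0].
    rewrite -s0 -(integral_itv_obnd_cbnd (b := BLeft 1)).
      congr integral; apply/seteqP; split => t; rewrite /I01 /= !in_itv /= andbT.
        by case.
      by move=> h; split=> //; case/andP: h => /ltW.
    by apply/measurable_EFinP; apply: measurable_funTS; exact: continuous_measurable_fun.
  congr integral; apply/seteqP; split => t; rewrite /I01 /= !in_itv /= andbT.
    by case=> /andP[_ ->] ->.
  by move=> /andP[h1 h2]; rewrite h1 h2 (lt_le_trans s0 h1).
by rewrite ftc.
Qed.

Lemma mem_itvcy x y : (y \in `[x, +oo[%classic) = (x <= y).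
Proof. by apply/idP/idP; rewrite inE /= in_itv /= andbT. Qed.

Lemma mem_itvNyc x y : (x \in `]-oo, y]%classic) = (x <= y).
Proof. by apply/idP/idP; rewrite inE /= in_itv. Qed.

Lemma mem_le_pair x y : ((x, y) \in [set z : R * R | z.1 <= z.2]) = (x <= y).
Proof. by apply/idP/idP; rewrite inE. Qed.

(** [prim f] is differentiable only almost everywhere, so the formula comes from Fubini's theorem
    for [f x * derive1 phi y] on the set [x <= y]; the integral in y is [- phi x]. *)
Lemma integration_by_parts_prim f phi : L1 f -> @test_function R phi ->
  \int[leb]_(t in I) (prim f t * derive1 phi t) = - \int[leb]_(t in I) (f t * phi t).
Proof.
move=> fi tphi; have sp := test_smooth tphi.
have c0 : continuous phi := @smooth_continuous R _ 0 sp.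
have c1 : continuous (derive1 phi) := @smooth_continuous R _ 1 sp.
have [M M0 hM] := test_bounded c1.
have fpi := integrable_patch fi.
have mf : measurable_fun setT (f \_ I) by move/(measurable_int leb)/measurable_EFinP: fpi.
have mpsi : measurable_fun setT (derive1 phi \_ I).
  by apply/(measurable_restrictT _ _).1 => //; apply: measurable_funTS; exact: continuous_measurable_fun.
pose ind (z : R * R) : R := \1_[set z : R * R | z.1 <= z.2] z.
have mind : measurable_fun setT ind.
  apply: measurable_indic.
  have := @measurable_fun_ler _ (R * R)%type R setT fst snd (@measurable_fst _ _ _ _) (@measurable_snd _ _ _ _).
  by move=> /(_ measurableT [set true] Logic.I); rewrite setTI; congr measurable; apply/seteqP; split.
pose F (z : R * R) : R := (f \_ I) z.1 * (ind z * (derive1 phi \_ I) z.2).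
have mF : measurable_fun setT F.
  apply: measurable_funM; first exact: measurableT_comp.
  by apply: measurable_funM => //; exact: measurableT_comp.
have iF : (leb \x leb)%E.-integrable setT (EFin \o F).
  apply/integrable12ltyP; first exact/measurable_EFinP.
  apply: (@le_lt_trans _ _ (\int[leb]_x (M%:E * `|(f \_ I) x|%:E))%E).
    apply: ge0_le_integral => //=.
    - by move=> x _; apply: integral_ge0.
    - apply: (@measurable_fun_fubini_tonelli_F _ _ _ _ R leb (fun z => `|(F z)%:E|%E)) => //=.
      by apply/measurable_EFinP; exact: measurableT_comp.
    - by apply: measurable_funeM; apply/measurable_EFinP; exact: measurableT_comp.
    - move=> x _; apply: (@le_trans _ _ (\int[leb]_y (`|(f \_ I) x| * M * \1_I y)%:E)%E).
        apply: ge0_le_integral => //=.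
        + apply/measurable_EFinP; apply: measurableT_comp => //.
          exact: (measurableT_comp mF (pair1_measurable x)).
        + by apply/measurable_EFinP; apply: measurable_funM => //; exact: measurable_indic.
        + move=> y _; rewrite lee_fin /F /= normrM -mulrA ler_wpM2l// normrM patchE indicE.
          case: ifPn => yI; last by rewrite normr0 !mulr0.
          rewrite mulr1 -[leRHS]mul1r ler_pM//.
            by rewrite /ind indicE; case: (_ \in _); rewrite ?normr1 ?normr0.
          by apply: hM; move: yI; rewrite inE => /I01E/andP[? ?]; rewrite !ltW.
      under eq_integral do rewrite EFinM.
      rewrite ge0_integralZl//; last 2 first.
        by apply/measurable_EFinP; exact: measurable_indic.
        by rewrite lee_fin mulr_ge0// ltW.
      by rewrite integral_indic// setIT [X in (_ * X <= _)%E](leb_I01 : _ = 1%E) mule1 EFinM muleC.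
  rewrite ge0_integralZl//; last 2 first.
    by apply/measurable_EFinP; exact: measurableT_comp.
    by rewrite lee_fin ltW.
  by move/integrableP: fpi => [_ h]; apply: lte_mul_pinfty => //; rewrite lee_fin ltW.
have fub : (\int[leb]_x \int[leb]_y (F (x, y))%:E = \int[leb]_y \int[leb]_x (F (x, y))%:E)%E := Fubini iF.
have E1 : (\int[leb]_x \int[leb]_y (F (x, y))%:E = (- \int[leb]_(t in I) (f t * phi t))%:E)%E.
  transitivity (\int[leb]_(x in I) (- (f x * phi x))%:E)%E.
    rewrite [RHS]integral_mkcond; apply: eq_integral => x _; rewrite patchE.
    case: ifPn => xI; last first.
      under eq_integral do rewrite /F /= patchE (negbTE xI) mul0r.
      by rewrite integral0.
    have x0 : 0 <= x by move: xI; rewrite inE => /I01E/andP[/ltW].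
    have mIx : measurable (I `&` `[x, +oo[ : set R).
      by apply: measurableI; [exact: measurable_I01|exact: measurable_itv].
    have gi : leb.-integrable (I `&` `[x, +oo[) (EFin \o derive1 phi).
      have L : leb.-integrable I (EFin \o derive1 phi) := L1_continuous c1.
      apply: integrableS L; [exact: measurable_I01|exact: mIx|exact: subIsetl].
    transitivity (\int[leb]_(y in I `&` `[x, +oo[) (f x * derive1 phi y)%:E)%E.
      rewrite [RHS]integral_mkcond; apply: eq_integral => y _; rewrite /F /= !patchE xI in_setI.
      rewrite /ind indicE mem_itvcy mem_le_pair.
      by case: (y \in I); case: (x <= y) => /=; rewrite ?mul1r ?mul0r ?mulr0.
    under eq_integral do rewrite EFinM.
    rewrite (integralZl _ gi); last exact: mIx.
    have := integral_derive_tail tphi x0; rewrite /Rintegral => h.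
    rewrite -[X in (_ * X)%E]fineK; last by apply: integrable_fin_num gi; exact: mIx.
    by rewrite h -EFinM mulrN.
  have fphi := integrable_mul_continuous fi c0.
  rewrite /Rintegral EFinN fineK; last by apply: integrable_fin_num fphi; exact: measurable_I01.
  rewrite -integralN; last by apply: integrable_add_def fphi; exact: measurable_I01.
  by apply: eq_integral => x _; rewrite EFinN.
have E2 : (\int[leb]_y \int[leb]_x (F (x, y))%:E = \int[leb]_(t in I) (prim f t * derive1 phi t)%:E)%E.
  rewrite [RHS]integral_mkcond; apply: eq_integral => y _; rewrite patchE.
  case: ifPn => yI; last first.
    under eq_integral do rewrite /F /= !patchE (negbTE yI) !mulr0.
    by rewrite integral0.
  transitivity (\int[leb]_(x in `]-oo, y]) (derive1 phi y * (f \_ I) x)%:E)%E.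
    rewrite [RHS]integral_mkcond; apply: eq_integral => x _; rewrite /F /= [(derive1 phi \_ I) y]patchE yI.
    rewrite /ind indicE [in RHS]patchE mem_itvNyc mem_le_pair.
    by case: ifP => _; [rewrite mul1r mulrC|rewrite mul0r mulr0].
  under eq_integral do rewrite EFinM.
  have gi : leb.-integrable (`]-oo, y]) (EFin \o (f \_ I)).
    by apply: integrableS fpi; [exact: measurableT|exact: measurable_itv|exact: subsetT].
  have mit : measurable (`]-oo, y]%classic : set R) by exact: measurable_itv.
  rewrite (integralZl _ gi); last exact: mit.
  rewrite [in RHS]mulrC EFinM /prim /Prim /Rintegral fineK; last by apply: integrable_fin_num gi; exact: mit.
  by [].
have h := etrans (etrans (esym E1) fub) E2.
by rewrite [LHS]/Rintegral -h.
Qed.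

End primitives.

(** * Weak derivatives *)

Section du_bois_reymond.
Context {R : realType}.
Implicit Types (f g u v : R -> R) (p : {poly R}) (x y s t r : R) (m n N : nat).
Local Notation leb := (@lebesgue_measure R).
Local Notation I := (@I01 R).

Lemma subitv_I01 (a b : R) : 0 < a -> b < 1 -> `[a, b]%classic `<=` I.
Proof.
move=> a0 b1 t; rewrite /= in_itv /= => /andP[at_ tb]; apply/I01E.
by rewrite (lt_le_trans a0 at_) (le_lt_trans tb b1).
Qed.

Lemma locint_itv f (a b : R) : locally_integrable I f -> 0 < a -> b < 1 ->
  leb.-integrable `[a, b] (EFin \o f).
Proof.
move=> [mf _ hf] a0 b1; apply/integrableP; split.
  apply/measurable_EFinP; apply: measurable_funS mf; [exact: measurable_I01|exact: subitv_I01].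
by apply: hf; [exact: subitv_I01|exact: segment_compact].
Qed.

Lemma L1_locint f : L1 f -> locally_integrable I f.
Proof. by move=> fi; apply: open_integrable_locally; [exact: interval_open|exact: fi]. Qed.

Lemma locint_test f phi : locally_integrable I f -> @test_function R phi -> L1 (fun t => f t * phi t).
Proof.
move=> lf tphi; have [sphi [a [b [a0 b1 hab]]]] := tphi.
have [mf _ _] := lf.
have cphi : continuous phi := @smooth_continuous R _ 0 sphi.
have [M M0 hM] := test_bounded cphi.
have mphi : measurable_fun I phi by apply: measurable_funTS; exact: continuous_measurable_fun.
have mfp : measurable_fun I (fun t => f t * phi t) by exact: measurable_funM.
apply/integrableP; split; first exact/measurable_EFinP.
pose G : R -> R := (fun s => `|f s| * M) \_ `[a, b].
apply: (@le_lt_trans _ _ (\int[leb]_(t in I) (G t)%:E)%E).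
  apply: ge0_le_integral.
  - exact: measurable_I01.
  - by move=> t _; exact: abse_ge0.
  - by apply/measurable_EFinP; apply: measurableT_comp.
  - apply/measurable_EFinP; apply/(measurable_restrict _ (measurable_itv _) measurable_I01).
    rewrite setIidr; last exact: subitv_I01.
    apply: measurable_funM; last exact: measurable_cst.
    apply: measurableT_comp; [exact: normr_measurable|].
    by apply: measurable_funS mf; [exact: measurable_I01|exact: subitv_I01].
  - move=> t It; rewrite /G patchE /= normrM; case: ifPn => tab.
      by rewrite lee_fin ler_wpM2l// hM//; move/I01E: It => /andP[? ?]; rewrite !ltW.
    by rewrite hab ?normr0 ?mulr0//; move: tab; rewrite notin_setE.
rewrite [X in (X < _)%E](_ : _ = \int[leb]_(t in I `&` `[a, b]) (`|f t| * M)%:E)%E; last first.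
  by rewrite integral_mkcondr; apply: eq_integral => t _; rewrite /G !patchE; case: ifP.
rewrite setIidr; last exact: subitv_I01.
have fi := locint_itv lf a0 b1.
pose nf : R -> \bar R := fun s => (`|f s|%R)%:E.
have nfi : leb.-integrable `[a, b] nf by exact: integrable_norm.
have nM : leb.-integrable `[a, b] (nf \* cst M%:E)%E.
  by apply: integrableZr nfi; exact: measurable_itv.
have nMy : (\int[leb]_(t in `[a, b]) (nf t * M%:E) < +oo)%E.
  by apply: integrable_lty nM; exact: measurable_itv.
apply: le_lt_trans nMy; rewrite le_eqVlt; apply/orP; left; apply/eqP.
by apply: eq_integral => t _; rewrite /nf EFinM.
Qed.

(** Near 0 and 1 a locally integrable f may fail to be integrable. Lebesgue differentiation is
    applied on a countable exhaustion of []0, 1[] by compact intervals. *)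
Lemma locint_ae_Prim f : locally_integrable I f ->
  {ae leb, forall t, forall n, I t -> n.+1%:R^-1 < t < 1 - n.+1%:R^-1 ->
     is_derive t (1 : R) (Prim (f \_ `[n.+1%:R^-1, 1 - n.+1%:R^-1])) (f t)}.
Proof.
move=> lf; apply: ae_foralln => n.
have fi : leb.-integrable setT (EFin \o (f \_ `[n.+1%:R^-1, 1 - n.+1%:R^-1])).
  rewrite -restrict_EFin; apply/integrable_restrict => //; rewrite setTI.
  by apply: locint_itv => //; rewrite ltrBlDr ltrDl.
have := Prim_ae_derive fi; apply: aeS => t h It /andP[t1 t2].
by move: h; rewrite patchE mem_set//= in_itv /= !ltW.
Qed.

Lemma sbump_continuous (a b : R) m : continuous (sbump a b m).
Proof.
have sb : smooth (sbump a b m) := @smooth_bump R a b m.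
by have h : continuous (sbump a b m) := @smooth_continuous R _ 0 sb.
Qed.

Lemma bump_integrable (a b : R) m : leb.-integrable setT (EFin \o sbump a b m).
Proof.
have -> : EFin \o sbump a b m = EFin \o (sbump a b m \_ `[a, b]).
  apply/funext => t; rewrite /= patchE; case: ifPn => //; rewrite notin_setE /= in_itv /= => /negP h.
  by rewrite bump_out//; apply: contra h => /andP[h1 h2]; rewrite !ltW.
rewrite -restrict_EFin; apply/integrable_restrict => //; rewrite setTI.
apply: continuous_compact_integrable; first exact: segment_compact.
apply: continuous_subspaceT => t; exact: sbump_continuous.
Qed.

Lemma bump_shift (a b : R) m (d t : R) : sbump a b m (t - d) = sbump (a + d) (b + d) m t.
Proof. by rewrite /sbump; congr (bumpexp _ _ * bumpexp _ _); ring. Qed.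

(** A bump minus its translate has integral 0, so its primitive [B t - B (t - d)], the integral of
    the bump over []t - d, t]], has compact support. *)
Lemma bump_diff_test (a b : R) m (d : R) : 0 < a -> a <= b -> 0 <= d -> b + d < 1 ->
  exists2 phi, @test_function R phi & forall t, derive1 phi t = sbump a b m t - sbump (a + d) (b + d) m t.
Proof.
move=> a0 ab d0 bd1; pose B := Prim (sbump a b m).
have sb := @smooth_bump R a b m.
have cb := @sbump_continuous a b m.
have dB t : is_derive t (1 : R) B (sbump a b m t).
  by apply: Prim_is_derive; [exact: bump_integrable|exact: cb].
have dphi t : is_derive t (1 : R) (fun t => B t - B (t - d)) (sbump a b m t - sbump (a + d) (b + d) m t).
  apply: is_deriveB; rewrite -bump_shift.
  have := @is_derive_affine R B (- d) 1 (sbump a b m (t - d)) t.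
  rewrite mul1r mul1r addrC => /(_ (dB _)).
  by congr (is_derive _ _ _ _); apply/funext => s; rewrite mul1r addrC.
exists (fun t => B t - B (t - d)); last by move=> t; rewrite (derive1P dphi).
split.
  apply: (smooth_primitive _ dphi).
  apply: smoothgen_smooth.
  have -> : (fun t => sbump a b m t - sbump (a + d) (b + d) m t) = (fun t => sbump a b m t + (-1) * sbump (a + d) (b + d) m t).
    by apply/funext => t; rewrite mulN1r.
  apply: smoothgen_add; first by apply: smoothgen_mul; exact: smoothgen_bump.
  by apply: smoothgen_scale; apply: smoothgen_mul; exact: smoothgen_bump.
exists a, (b + d); split=> // t; rewrite /= in_itv /= => /negP tab.
have td : t - d <= t by rewrite lerBlDr lerDl.
rewrite /B PrimB//; last exact: bump_integrable.
rewrite -[RHS](Rintegral_set0 leb (sbump a b m)) Rintegral_mkcond [RHS]Rintegral_mkcond.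
apply: eq_Rintegral => s _; rewrite !patchE in_set0; case: ifPn => //.
rewrite inE /= in_itv /= => /andP[s1 s2]; apply: bump_out.
by apply: contra tab => /andP[h1 h2]; apply/andP; split; lra.
Qed.

Lemma Rintegral_indic_itv f (a b : R) : 0 <= a -> b <= 1 -> 
  \int[leb]_(t in I) (f t * \1_(`]a, b[%classic) t) = \int[leb]_(t in `]a, b[) f t.
Proof.
move=> a0 b1; rewrite Rintegral_mkcond [RHS]Rintegral_mkcond; apply: eq_Rintegral => t _.
rewrite !patchE indicE; have [tab|] := boolP (t \in `]a, b[%classic); last by rewrite mulr0; case: ifP.
rewrite mulr1 mem_set//; move: tab; rewrite inE /= in_itv /= => /andP[h1 h2]; apply/I01E.
by rewrite (le_lt_trans a0 h1) (lt_le_trans h2 b1).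
Qed.

(* Testing against primitives of differences of translated bumps shows that
   the integral of [f] over an interval depends only on its length. *)
Lemma zero_weak_derivative_shift f (a h d : R) : locally_integrable I f ->
  (forall phi, @test_function R phi -> \int[leb]_(t in I) (f t * derive1 phi t) = 0) ->
  0 < a -> 0 <= h -> 0 <= d -> a + h + d < 1 ->
  \int[leb]_(t in `]a, (a + h)%R[) f t = \int[leb]_(t in `](a + d)%R, (a + h + d)%R[) f t.
Proof.
move=> lf f0 a0 h0 d0 ahd1; have [mf _ _] := lf.
pose fn m t := f t * (sbump a (a + h) m t - sbump (a + d) (a + h + d) m t).
pose fl t := f t * (\1_(`]a, (a + h)%R[%classic) t - \1_(`](a + d)%R, (a + h + d)%R[%classic) t).
have fi := locint_itv lf a0 ahd1.
pose g := (fun t => 2 * `|f t|) \_ `[a, a + h + d].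
have gi : leb.-integrable I (EFin \o g).
  rewrite -restrict_EFin; apply/integrable_restrict => //.
    exact: measurable_I01.
  rewrite setIidr; last exact: subitv_I01.
  pose nf : R -> \bar R := fun s => (`|f s|%R)%:E.
  have nfi : leb.-integrable `[a, a + h + d] nf by exact: integrable_norm.
  have n2 : leb.-integrable `[a, a + h + d] (fun s => 2%:E * nf s)%E.
    by apply: integrableZl nfi; exact: measurable_itv.
  by apply: eq_integrable n2; [exact: measurable_itv|move=> t _].
have mI : measurable I by exact: measurable_I01.
have mb x y m : measurable_fun I (sbump x y m).
  by apply: measurable_funTS; apply: continuous_measurable_fun; exact: sbump_continuous.
have [||||fli cv] := @Rintegral_dominated R I fn fl g mI _ _ _ gi.
- by move=> m; apply: measurable_funM => //; exact: measurable_funB.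
- apply: measurable_funM => //; apply: measurable_funB; apply: measurable_indic; exact: measurable_itv.
- apply: aeW => t _; apply: cvgM; first exact: cvg_cst.
  by apply: cvgB; exact: bump_cvg.
- move=> t m _; rewrite /fn /g patchE; case: ifPn.
    move=> _; rewrite normrM mulrC ler_wpM2r//.
    have /andP[b1 b2] := bump_itv a (a + h) m t; have /andP[b3 b4] := bump_itv (a + d) (a + h + d) m t.
    by rewrite ler_norml; apply/andP; split; lra.
  rewrite notin_setE /= in_itv /= => /negP nt.
  rewrite !bump_out ?subrr ?mulr0 ?normr0//.
    by apply: contra nt => /andP[h1 h2]; apply/andP; split; lra.
  by apply: contra nt => /andP[h1 h2]; apply/andP; split; lra.
have fn0 m : \int[leb]_(t in I) fn m t = 0.
  have [phi tphi dphi] := @bump_diff_test a (a + h) m d a0 ltac:(lra) d0 ahd1.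
  rewrite -(f0 _ tphi); apply: eq_Rintegral => t _; rewrite /fn dphi//.
have fl0 : \int[leb]_(t in I) fl t = 0.
  move: cv; rewrite (_ : (fun n => _) = fun=> 0); last by apply/funext => m; exact: fn0.
  by move=> cv; apply: (cvg_unique _ cv); [exact: Rhausdorff|exact: cvg_cst].
have fli1 x y : a <= x -> y <= a + h + d -> leb.-integrable I (EFin \o (fun t => f t * \1_(`]x, y[%classic) t)).
  move=> ax ya; apply: le_integrable gi; first exact: mI.
    by apply/measurable_EFinP; apply: measurable_funM => //; apply: measurable_indic; exact: measurable_itv.
  move=> t _; rewrite /= lee_fin /g patchE indicE; have [|_] := boolP (t \in `]x, y[%classic); last by rewrite mulr0 normr0.
  rewrite inE /= in_itv /= => /andP[h1 h2]; rewrite mem_set ?mulr1.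
    by rewrite normrM normr_id ger0_norm//; have := normr_ge0 (f t); lra.
  by rewrite /= in_itv /=; apply/andP; split; lra.
have e1 := fli1 a (a + h) (lexx _) ltac:(lra).
have e2 := fli1 (a + d) (a + h + d) ltac:(lra) (lexx _).
rewrite -(@Rintegral_indic_itv f a (a + h)) ?(ltW a0)//; last lra.
rewrite -(@Rintegral_indic_itv f (a + d) (a + h + d)) ?(ltW ahd1)//; last lra.
apply/eqP; rewrite -subr_eq0 -RintegralB//; apply/eqP; rewrite -[RHS]fl0.
by apply: eq_Rintegral => t _; rewrite /fl mulrBr.
Qed.

(** At two points where the local primitive F is differentiable, the increments of F over intervals
    of equal length agree by [zero_weak_derivative_shift], hence so do the derivatives. The
    tolerance e is a quarter of the supposed gap: two errors leave half of it. *)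
Lemma du_bois_reymond f : locally_integrable I f ->
  (forall phi, @test_function R phi -> \int[leb]_(t in I) (f t * derive1 phi t) = 0) ->
  exists C : R, {ae leb, forall t, I t -> f t = C}.
Proof.
move=> lf f0; have hae := locint_ae_Prim lf.
have [s0 [Is0 good0]] : exists s0, I s0 /\ (forall n, I s0 -> n.+1%:R^-1 < s0 < 1 - n.+1%:R^-1 ->
     is_derive s0 (1 : R) (Prim (f \_ `[n.+1%:R^-1, 1 - n.+1%:R^-1])) (f s0)).
  apply: contrapT => nex; have [A [mA A0 hA]] := hae.
  have : (leb I <= leb A)%E.
    apply: le_measure; rewrite ?inE//; first exact: measurable_I01.
    by move=> t It; apply: hA => ht; apply: nex; exists t.
  by rewrite A0 leb_I01 lee_fin ler10.
exists (f s0); apply: aeS hae => t good It.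
have main s s' n : I s -> I s' -> s <= s' -> n.+1%:R^-1 < s < 1 - n.+1%:R^-1 -> n.+1%:R^-1 < s' < 1 - n.+1%:R^-1 ->
   is_derive s (1 : R) (Prim (f \_ `[n.+1%:R^-1, 1 - n.+1%:R^-1])) (f s) ->
   is_derive s' (1 : R) (Prim (f \_ `[n.+1%:R^-1, 1 - n.+1%:R^-1])) (f s') -> f s = f s'.
  set a := n.+1%:R^-1; set b := 1 - a; move=> Is Is' ss' /andP[as_ sb] /andP[as' sb'] d1 d2.
  have a0 : 0 < a by rewrite invr_gt0 ltr0n.
  have b1 : b < 1 by rewrite /b; lra.
  set F := Prim _ in d1 d2.
  have fi : leb.-integrable setT (EFin \o (f \_ `[a, b])).
    rewrite -restrict_EFin; apply/integrable_restrict => //; rewrite setTI.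
    exact: locint_itv.
  have FE x h : a < x -> 0 <= h -> x + h < b -> F (x + h) - F x = \int[leb]_(u in `]x, (x + h)%R[) f u.
    move=> ax h0 xb; rewrite /F PrimB ?lerDl// -Rintegral_itv_bndo_bndc; last first.
      by apply: integrableS fi; [exact: measurableT|exact: measurable_itv|exact: subsetT].
    apply: eq_Rintegral => u; rewrite inE /= in_itv /= => /andP[h1 h2].
    by rewrite patchE mem_set//= in_itv /=; apply/andP; split; lra.
  apply/eqP; apply/negPn/negP => ne.
  pose e := `|f s - f s'| / 4; have e0 : 0 < e by rewrite divr_gt0// normr_gt0 subr_eq0.
  have [r1 r10 hr1] := (is_deriveP F s (f s)).1 d1 e e0.
  have [r2 r20 hr2] := (is_deriveP F s' (f s')).1 d2 e e0.
  pose h := Num.min (Num.min r1 r2) (b - s') / 2.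
  have m0 : 0 < Num.min (Num.min r1 r2) (b - s') by rewrite !lt_min r10 r20 subr_gt0.
  have h0 : 0 < h by rewrite divr_gt0.
  have hm : h < Num.min (Num.min r1 r2) (b - s') by rewrite /h; lra.
  move: (hm); rewrite !lt_min => /andP[/andP[hh1 hh2] hh3].
  have := hr1 h; rewrite gtr0_norm// => /(_ hh1); have := hr2 h; rewrite gtr0_norm// => /(_ hh2).
  have F1 : F (s + h) - F s = _ := FE s h ltac:(lra) (ltW h0) ltac:(lra).
  have F2 : F (s' + h) - F s' = _ := FE s' h ltac:(lra) (ltW h0) ltac:(lra).
  rewrite F1 F2.
  have := @zero_weak_derivative_shift f s h (s' - s) lf f0 ltac:(lra) (ltW h0) ltac:(lra) ltac:(lra).
  have -> : s + (s' - s) = s' by ring.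
  have -> : s + h + (s' - s) = s' + h by ring.
  move=> ->; set J := Rintegral _ _ _ => k2 k1.
  have k3 : `|f s * h - f s' * h| <= 2 * e * h.
    have -> : f s * h - f s' * h = (J - f s' * h) - (J - f s * h) by ring.
    by apply: le_trans (ler_normB _ _) _; lra.
  move: k3; rewrite -mulrBl normrM (gtr0_norm h0) ler_pM2r// /e.
  have : 0 < `|f s - f s'| by rewrite normr_gt0 subr_eq0.
  lra.
have /andP[t0 t1] := (I01E t).1 It; have /andP[s00 s01] := (I01E s0).1 Is0.
pose m0 := Num.min (Num.min t (1 - t)) (Num.min s0 (1 - s0)).
have m00 : 0 < m0 by rewrite !lt_min t0 s00 !subr_gt0 t1 s01.
pose n := Num.truncn m0^-1.
have nm : n.+1%:R^-1 < m0.
  by rewrite -[ltRHS]invrK ltf_pV2 ?posrE ?invr_gt0 ?ltr0n//; exact: truncnS_gt.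
move: nm; rewrite !lt_min => /andP[/andP[n1 n2] /andP[n3 n4]].
have nt : n.+1%:R^-1 < t < 1 - n.+1%:R^-1 by rewrite n1 /= ltrBrDr addrC -ltrBrDr.
have ns : n.+1%:R^-1 < s0 < 1 - n.+1%:R^-1 by rewrite n3 /= ltrBrDr addrC -ltrBrDr.
have [ts|st] := leP t s0.
  by apply: (main t s0 n) => //; [exact: good|exact: good0].
by apply/esym; apply: (main s0 t n) => //; [exact: ltW|exact: good0|exact: good].
Qed.

End du_bois_reymond.

(** * Sobolev functions and their continuous representatives *)

Section sobolev.
Context {R : realType}.
Implicit Types (f g u v : R -> R) (p : {poly R}) (x y s t r : R) (m n N : nat).
Local Notation leb := (@lebesgue_measure R).
Local Notation I := (@I01 R).

Lemma sbump_test (a b : R) m : 0 < a -> b < 1 -> @test_function R (sbump a b m).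
Proof.
move=> a0 b1; split; first exact: (@smooth_bump R a b m).
exists a, b; split=> // t; rewrite /= in_itv /= => /negP h.
by apply: bump_out; apply: contra h => /andP[h1 h2]; rewrite !ltW.
Qed.

(** Derivatives of test functions are test functions, so f is a constant C almost everywhere.
    Testing against bumps that increase to the indicator of an interval of length 1/2 gives
    [C / 2 = 0]. *)
Lemma zero_of_test f : locally_integrable I f ->
  (forall phi, @test_function R phi -> \int[leb]_(t in I) (f t * phi t) = 0) ->
  {ae leb, forall t, I t -> f t = 0}.
Proof.
move=> lf f0.
have [C fC] := du_bois_reymond lf (fun phi tphi => f0 _ (test_derive 1 tphi)).
suff C0 : C = 0 by apply: aeS fC => t h /h ->.
have mI : measurable I by exact: measurable_I01.
have mb m : measurable_fun I (sbump (4^-1) (3/4) m).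
  by apply: measurable_funTS; apply: continuous_measurable_fun; exact: sbump_continuous.
have i1 : leb.-integrable I (EFin \o (fun=> 1 : R)) by apply: L1_continuous => t; exact: cvg_cst.
have [|||_ cv] := @Rintegral_dominated R I (sbump (4^-1) (3/4)) (\1_(`]4^-1, (3/4)[%classic)) (fun=> 1) mI mb _ _ i1.
- by apply: measurable_indic; exact: measurable_itv.
- by apply: aeW => t _; exact: bump_cvg.
- by move=> t m _; have /andP[b0 b1] := bump_itv (4^-1) (3/4) m t; rewrite ger0_norm.
have lim : \int[leb]_(t in I) \1_(`]4^-1, (3/4)[%classic) t = 2^-1.
  have := @Rintegral_indic_itv R (fun=> 1) (4^-1) (3/4) ltac:(lra) ltac:(lra).
  have -> : \int[leb]_(t in `]4^-1, (3 / 4)[) (1 : R) = 2^-1.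
    rewrite Rintegral_cst ?mul1r; last exact: measurable_itv.
    have lm : leb `]4^-1, (3 / 4)[%classic = (2^-1)%:E.
      by rewrite lebesgue_measure_itv /= lte_fin ifT -?EFinD; [congr (_%:E)|]; lra.
    by rewrite [X in fine X](lm : _ = (2^-1)%:E).
  by move=> <-; apply: eq_Rintegral => t _; rewrite mul1r.
have z m : C * \int[leb]_(t in I) sbump (4^-1) (3/4) m t = 0.
  have tb : @test_function R (sbump (4^-1) (3/4) m) by apply: sbump_test; lra.
  have ib : leb.-integrable I (EFin \o sbump (4^-1) (3/4) m) by apply: L1_continuous; exact: sbump_continuous.
  rewrite -RintegralZl; [|exact: mI|exact: ib].
  rewrite -(f0 _ tb) /Rintegral; congr fine; apply: ae_eq_integral; first exact: mI.
  - by apply/measurable_EFinP; apply: measurable_funM => //; exact: mb.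
  - by apply/measurable_EFinP; apply: measurable_funM; [case: lf|exact: mb].
  - by apply: aeS fC => t h It; rewrite /= (h It).
have cv0 : (fun m => C * \int[leb]_(t in I) sbump (4^-1) (3/4) m t) @ \oo --> C * 2^-1.
  by apply: cvgM; [exact: cvg_cst|rewrite -lim].
move: cv0; rewrite (_ : (fun m => _) = fun=> 0); last by apply/funext => m; exact: z.
move=> cv0; have : C * 2^-1 = 0.
  by apply/esym; apply: (cvg_unique _ (cvg_cst 0) cv0); exact: Rhausdorff.
by move/eqP; rewrite mulf_eq0 invr_eq0 pnatr_eq0 orbF => /eqP.
Qed.

Lemma weak_derivative_unique j u f g : is_weak_derivative j u f -> is_weak_derivative j u g ->
  {ae leb, forall t, I t -> f t = g t}.
Proof.
move=> [_ lf hf] [_ lg hg].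
have : {ae leb, forall t, I t -> (f \- g) t = 0}.
  apply: zero_of_test; first exact: locally_integrableB.
  move=> phi tphi; have fi := locint_test lf tphi; have gi := locint_test lg tphi.
  have sg : (-1) ^+ j != 0 :> R by rewrite expf_neq0// oppr_eq0 oner_eq0.
  apply: (mulfI sg); rewrite mulr0.
  have -> : \int[leb]_(t in I) ((f \- g) t * phi t) =
            \int[leb]_(t in I) (f t * phi t) - \int[leb]_(t in I) (g t * phi t).
    rewrite -RintegralB; [|exact: measurable_I01|exact: fi|exact: gi].
    by apply: eq_Rintegral => t _; rewrite /= mulrBl.
  by rewrite mulrBr -hf// -hg// subrr.
by apply: aeS => t h /h /eqP; rewrite /= subr_eq0 => /eqP.
Qed.

(** [prim f] is constant outside the unit interval, whereas a chain needs derivatives on the whole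
    line. There f may fail to be integrable, so it is cut to [[- n, n]] with n depending on t, which
    leaves the primitive based at 0 unchanged. *)
Lemma antiderivative f : continuous f ->
  exists2 F : R -> R, (forall t, is_derive t (1 : R) F (f t)) & forall t, 0 <= t <= 1 -> F t = prim f t.
Proof.
move=> cf; pose Q (n t : R) : R := Prim (f \_ `[- n, n]) t - Prim (f \_ `[- n, n]) 0.
have fi (n : R) : leb.-integrable setT (EFin \o (f \_ `[- n, n])).
  rewrite -restrict_EFin; apply/integrable_restrict => //; rewrite setTI.
  apply: continuous_compact_integrable; first exact: segment_compact.
  by apply: continuous_subspaceT => t; exact: cf.
have QE (n n' s : R) : `|s| <= n -> n <= n' -> Q n s = Q n' s.
  move=> sn nn'; have n0 : 0 <= n by apply: le_trans sn.
  have key x y : - n <= x -> x <= y -> y <= n ->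
      Prim (f \_ `[- n, n]) y - Prim (f \_ `[- n, n]) x = Prim (f \_ `[- n', n']) y - Prim (f \_ `[- n', n']) x.
    move=> nx xy yn; rewrite !PrimB//.
    apply: eq_Rintegral => z; rewrite inE /= in_itv /= => /andP[xz zy].
    have h1 : - n <= z <= n by apply/andP; split; lra.
    have h2 : - n' <= z <= n' by apply/andP; split; lra.
    by rewrite !patchE !mem_set//= in_itv.
  move: sn; rewrite ler_norml => /andP[s1 s2]; rewrite /Q; have [s0|s0] := leP 0 s.
    by apply: key; lra.
  by apply: oppr_inj; rewrite !opprB; apply: key => //; exact: ltW.
exists (fun t => Q (`|t| + 1) t).
  move=> t; pose n := `|t| + 2.
  have tn : - n < t < n.
    by rewrite -ltr_norml /n ltrDl.
  have dQ : is_derive t (1 : R) (Q n) (f t).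
    have cft : {for t, continuous (f \_ `[- n, n])}.
      have near_eq : \forall s \near t, (f \_ `[- n, n]) s = f s.
        have : \forall s \near t, s \in `]- n, n[ by apply: near_in_itvoo; rewrite in_itv.
        apply: filterS => s; rewrite in_itv /= => /andP[h1 h2].
        by rewrite patchE mem_set//= in_itv /= !ltW.
      rewrite /prop_for /continuous_at (nbhs_singleton near_eq).
      apply: cvg_trans (cf t); apply: near_eq_cvg.
      by apply: filterS near_eq => s ->.
    have := Prim_is_derive (fi n) cft.
    have -> : (f \_ `[- n, n]) t = f t.
      by rewrite patchE mem_set//= in_itv /=; case/andP: tn => ? ?; rewrite !ltW.
    move=> h; have := is_deriveB h (is_derive_cst (Prim (f \_ `[- n, n]) 0) t (1 : R)).
    by rewrite subr0.
  apply/is_deriveP => e e0; have [d d0 hd] := (is_deriveP _ _ _).1 dQ e e0.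
  exists (Num.min d 1); first by rewrite lt_min d0 ltr01.
  move=> h; rewrite lt_min => /andP[h1 h2]; have := hd h h1.
  rewrite (QE (`|t| + 1) n t) ?lerDl//; last by rewrite /n; lra.
  rewrite (QE (`|t + h| + 1) (`|t + h| + `|t| + 3) (t + h)) ?lerDl//; last by have := normr_ge0 t; lra.
  rewrite -(QE n (`|t + h| + `|t| + 3) (t + h))//.
    by apply: (le_trans (ler_normD _ _)); rewrite /n; lra.
  by have := normr_ge0 (t + h); rewrite /n; lra.
move=> t /andP[t0 t1].
have fI : leb.-integrable setT (EFin \o (f \_ I)).
  by apply: integrable_patch; exact: L1_continuous.
have p0 : prim f 0 = 0.
  rewrite /prim /Prim -[RHS](Rintegral_set0 leb f) Rintegral_mkcond [RHS]Rintegral_mkcond.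
  apply: eq_Rintegral => s _; rewrite !patchE in_set0; case: ifPn => //.
  rewrite inE /= in_itv /= => s0; case: ifPn => //; rewrite inE => /I01E/andP[h1 _]; lra.
rewrite -[RHS]subr0 -p0 /prim PrimB//.
rewrite /Q PrimB//.
rewrite -Rintegral_itv_bndo_bndc; last first.
  by apply: integrableS (fi _); [exact: measurableT|exact: measurable_itv|exact: subsetT].
rewrite -[RHS]Rintegral_itv_bndo_bndc; last first.
  by apply: integrableS fI; [exact: measurableT|exact: measurable_itv|exact: subsetT].
apply: eq_Rintegral => s; rewrite inE /= in_itv /= => /andP[s0 st].
rewrite !patchE !mem_set//; last by rewrite /= in_itv /= (ger0_norm t0); apply/andP; split; lra.
by apply/I01E; apply/andP; split; lra.
Qed.

(** Induction from the top: the last weak derivative is only integrable, but its primitive is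
    continuous, and every lower order is an antiderivative of a continuous function up to the
    constant given by du Bois-Reymond's lemma. *)
Lemma weak_chain m (w : nat -> R -> R) : (forall j, (j <= m.+1)%N -> locally_integrable I (w j)) ->
  L1 (w m.+1) ->
  (forall j phi, (j <= m)%N -> @test_function R phi ->
    \int[leb]_(t in I) (w j t * derive1 phi t) = - \int[leb]_(t in I) (w j.+1 t * phi t)) ->
  exists P : nat -> R -> R, [/\ chain P m, continuous (P 0%N),
    forall s t, 0 <= s -> s <= t -> t <= 1 -> P m t - P m s = \int[leb]_(x in `]s, t[) w m.+1 x &
    forall j, (j <= m)%N -> {ae leb, forall t, I t -> w j t = P j t}].
Proof.
have mI : measurable I by exact: measurable_I01.
(* an integrable [h] with [w 1 = h] almost everywhere yields [w 0 = C + prim h] *)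
have step (w0 w1 h : R -> R) : locally_integrable I w0 -> locally_integrable I w1 -> L1 h ->
    (forall phi, @test_function R phi ->
      \int[leb]_(t in I) (w0 t * derive1 phi t) = - \int[leb]_(t in I) (w1 t * phi t)) ->
    {ae leb, forall t, I t -> w1 t = h t} ->
    exists C : R, {ae leb, forall t, I t -> w0 t = C + prim h t}.
  move=> l0 l1 hi hw hae.
  have lp : locally_integrable I (prim h) by apply: L1_locint; apply: L1_continuous; exact: prim_continuous.
  have [|C hC] := @du_bois_reymond R (w0 \- prim h) (locally_integrableB l0 lp).
    move=> phi tphi; have tphi' := test_derive 1 tphi.
    have i1 := locint_test l0 tphi'; have i2 := locint_test lp tphi'.
    have -> : \int[leb]_(t in I) ((w0 \- prim h) t * derive1 phi t) =
        \int[leb]_(t in I) (w0 t * derive1 phi t) - \int[leb]_(t in I) (prim h t * derive1 phi t).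
      rewrite -RintegralB; [|exact: mI|exact: i1|exact: i2].
      by apply: eq_Rintegral => t _; rewrite /= mulrBl.
    rewrite hw// integration_by_parts_prim// opprK addrC.
    apply/eqP; rewrite subr_eq0; apply/eqP; rewrite /Rintegral; congr fine.
    have mphi : measurable_fun I phi.
      apply: measurable_funTS; apply: continuous_measurable_fun.
      exact: (@smooth_continuous R _ 0 (test_smooth tphi)).
    apply: ae_eq_integral; first exact: mI.
    - by apply/measurable_EFinP; apply: measurable_funM => //; exact: L1_measurable.
    - by apply/measurable_EFinP; apply: measurable_funM => //; case: l1.
    - by apply: aeS hae => t ht It; rewrite /= (ht It).
  by exists C; apply: aeS hC => t ht It; rewrite -(ht It) /= subrK.
elim: m w => [|m IH] w lw w1 hw.
  have [C hC] := step (w 0%N) (w 1%N) (w 1%N) (lw 0%N isT) (lw 1%N isT) w1 (fun phi => hw 0%N phi isT)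
     (aeW leb (fun t (_ : I t) => erefl)).
  exists (fun _ t => C + prim (w 1%N) t); split.
  - by [].
  - by move=> t; apply: cvgD; [exact: cvg_cst|exact: prim_continuous].
  - move=> s t s0 st t1; rewrite -primB//; ring.
  - by move=> j; rewrite leqn0 => /eqP ->.
have [P [cP P0 hP aeP]] := IH (fun j => w j.+1) (fun j jm => lw j.+1 jm) w1 (fun j phi jm => hw j.+1 phi jm).
have [Q dQ QE] := antiderivative P0.
have [C hC] := step (w 0%N) (w 1%N) (P 0%N) (lw 0%N isT) (lw 1%N isT) (L1_continuous P0) (fun phi => hw 0%N phi isT) (aeP 0%N isT).
pose P' j t := if j is j'.+1 then P j' t else C + Q t.
have cP' : chain P' m.+1.
  move=> [|j] jm t /=; last exact: cP.
  have := is_deriveD (is_derive_cst C t (1 : R)) (dQ t).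
  by rewrite add0r.
exists P'; split=> //.
- exact: (chain_continuous cP').
- move=> [|j] jm; last exact: aeP.
  apply: aeS hC => t ht It; rewrite (ht It) /= QE//.
  by move/I01E: It => /andP[? ?]; rewrite !ltW.
Qed.

Lemma L2_L1 f : L2 f -> L1 f.
Proof.
move=> [mf f2]; apply/integrableP; split; first exact/measurable_EFinP.
apply: (@le_lt_trans _ _ (\int[leb]_(t in I) (1%:E + (f t ^+ 2)%:E))%E).
  apply: ge0_le_integral.
  - exact: measurable_I01.
  - by move=> t _; exact: abse_ge0.
  - by apply/measurable_EFinP; exact: measurableT_comp.
  - by apply/measurable_EFinP; apply: measurable_funD => //; exact: measurable_funX.
  - move=> t _; rewrite /= lee_fin.
    by have := sqr_ge0 (`|f t| - 1); have := real_normK (num_real (f t)); nra.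
rewrite ge0_integralD; [|exact: measurable_I01|by []| |by move=> t _; rewrite lee_fin sqr_ge0|].
- apply: lte_add_pinfty => //; rewrite integral_cst; last exact: measurable_I01.
  by rewrite [X in (_ * X)%E](leb_I01 : _ = 1%E) mule1 ltry.
- by apply/measurable_EFinP.
- by apply/measurable_EFinP; exact: measurable_funX.
Qed.

Lemma weak_derivativeP k u j : sobolevH k u -> (j <= k)%N ->
  is_weak_derivative j u (weak_derivative j u) /\ L2 (weak_derivative j u).
Proof.
move=> hu jk; have [g wg g2] := hu j jk.
have wd : is_weak_derivative j u (weak_derivative j u).
  by rewrite /weak_derivative; case: xgetP => [h _ //|/(_ g)]; case.
split=> //; have ae := weak_derivative_unique wd wg.
have mw : measurable_fun I (weak_derivative j u) by have [_ []] := wd.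
split=> //; case: g2 => mg; apply: le_lt_trans.
rewrite le_eqVlt; apply/orP; left; apply/eqP; apply: ge0_ae_eq_integral.
- exact: measurable_I01.
- by apply/measurable_EFinP; exact: measurable_funX.
- by apply/measurable_EFinP; exact: measurable_funX.
- by move=> t _; rewrite lee_fin sqr_ge0.
- by move=> t _; rewrite lee_fin sqr_ge0.
- by apply: aeS ae => t h It; rewrite (h It).
Qed.

Lemma sobolev_representative m u : sobolevH m.+1 u ->
  exists P : nat -> R -> R, [/\ chain P m,
    forall s t, 0 <= s -> s <= t -> t <= 1 -> P m t - P m s = \int[leb]_(x in `]s, t[) weak_derivative m.+1 u x,
    {ae leb, forall t, I t -> u t = P 0%N t} &
    (0 < m)%N -> {ae leb, forall t, I t -> weak_derivative 1 u t = P 1%N t}].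
Proof.
move=> hu; have wd j : (j <= m.+1)%N -> is_weak_derivative j u (weak_derivative j u).
  by move=> jm; have [] := weak_derivativeP hu jm.
pose w j := if j is j'.+1 then weak_derivative j'.+1 u else u.
have lw j : (j <= m.+1)%N -> locally_integrable I (w j).
  by case: j => [|j] jm; [have [] := wd 1%N isT|have [] := wd j.+1 jm].
have w1 : L1 (w m.+1) by apply: L2_L1; have [] := weak_derivativeP hu (leqnn m.+1).
have [|P [cP P0 hP aeP]] := weak_chain lw w1.
  (* Both w of order j + 1 and of order j + 2 are derivatives of u; testing the former against
     [derive1 phi] and the latter against phi links them. *)
  move=> [|j] phi jm tphi.
    by have [_ _ /(_ phi tphi)] := wd 1%N isT; rewrite expr1 mulN1r.
  have sg : (-1) ^+ j.+1 != 0 :> R by rewrite expf_neq0// oppr_eq0 oner_eq0.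
  have [_ _ h1] := wd j.+1 (leqW jm); have [_ _ h2] := wd j.+2 jm.
  have e1 := h1 _ (test_derive 1 tphi); have e2 := h2 _ tphi.
  have e3 : \int[leb]_(t in I) (u t * derive1n j.+1 (derive1n 1 phi) t) = \int[leb]_(t in I) (u t * derive1n j.+2 phi t).
    by apply: eq_Rintegral => t _; rewrite [in RHS]derive1Sn.
  apply: (mulfI sg); apply: etrans (etrans (esym e1) (etrans e3 e2)) _.
  by rewrite exprS mulN1r mulNr mulrN.
exists P; split=> //; first exact: (aeP 0%N).
by move=> m0; exact: (aeP 1%N).
Qed.

End sobolev.

(** * The cost of a jump *)

Section constants.
Context {R : realType}.
Implicit Types (f g u v : R -> R) (p : {poly R}) (x y s t r : R) (m n N : nat).
Local Notation leb := (@lebesgue_measure R).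
Local Notation I := (@I01 R).

(* At this price a bad set of measure [b * eps] and total cost [b] moves the function by at most
   [(b / mu) ^+ (n - 2)], up to a power of [n]. *)
Definition ck (mu : R) n : R := (kap (n - 2) * mu ^+ (n - 2)) ^+ 2 / n%:R ^+ 12.
(** The tolerance d given to [small_on_bad_set]. It makes [dk + kap (n - 2) * mu ^+ (n - 2) * dk]
    equal to [1 / n], so that both error terms that carry it vanish. *)
Definition dk (mu : R) n : R := (n%:R * (1 + kap (n - 2) * mu ^+ (n - 2)))^-1.
(** Bound, in units of eps, for the length separating the flat points around a bad set of measure
    [b * eps]. *)
Definition widen (mu : R) n (b : R) : R := b / (1 - dk mu n) + 2 * dk mu n.
(** The bound of [small_on_bad_set] at [m = n - 2]: the chain starts at the first derivative and
    ends at order [n - 1]. The square root of [mu / ck] is the Hoelder constant allowed by an energy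
    at most mu. *)
Definition flat_error (mu : R) n (b : R) : R := dk mu n + kap (n - 2) * widen mu n b ^+ (n - 2) *
  (dk mu n + Num.sqrt (mu / ck mu n) * Num.sqrt (widen mu n b)).

Lemma kapmu_gt0 (mu : R) n : 0 < mu -> 0 < kap n * mu ^+ n.
Proof. by move=> mu0; rewrite mulr_gt0 ?kap_gt0 ?exprn_gt0. Qed.

Lemma ck_gt0 (mu : R) n : 0 < mu -> (0 < n)%N -> 0 < ck mu n.
Proof. by move=> mu0 n0; rewrite /ck divr_gt0// exprn_gt0 ?kapmu_gt0// ltr0n. Qed.

Lemma dk_itv (mu : R) n : 0 < mu -> (0 < n)%N -> 0 < dk mu n <= n%:R^-1.
Proof.
move=> mu0 n0; have k0 := kapmu_gt0 (n - 2) mu0.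
have N0 : 0 < n%:R :> R by rewrite ltr0n.
have K1 : 1 <= 1 + kap (n - 2) * mu ^+ (n - 2) by rewrite lerDl ltW.
rewrite invr_gt0 mulr_gt0//=; last by rewrite (lt_le_trans ltr01).
by rewrite lef_pV2 ?posrE ?mulr_gt0// ?(lt_le_trans ltr01 K1)// ler_peMr// ltW.
Qed.

(** The term of degree 7 of the exponential series, at [- n * ln r], gives one power of n more than
    the 6 asked for. *)
Lemma poly_geometric (r : R) : 0 < r < 1 -> exists2 C : R, 0 < C & forall n, (0 < n)%N -> n%:R ^+ 6 * r ^+ n <= C / n%:R.
Proof.
move=> /andP[r0 r1]; pose a := - ln r.
have a0 : 0 < a by rewrite oppr_gt0 ln_lt0// r0.
have C0 : 0 < 7`!%:R / a ^+ 7 by rewrite divr_gt0 ?exprn_gt0.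
exists (7`!%:R / a ^+ 7) => // n n0.
have N0 : 0 < n%:R :> R by rewrite ltr0n.
have rE : r ^+ n = expR (- (n%:R * a)).
  by rewrite /a mulrN opprK mulrC expRM_natr lnK ?posrE.
have na0 : 0 <= n%:R * a by rewrite mulr_ge0// ltW.
have h : (n%:R * a) ^+ 7 / 7`!%:R <= expR (n%:R * a).
  by apply: le_trans (expR_ge1Dxn 6 na0); rewrite lerDr.
rewrite rE expRN ler_pdivrMr ?expR_gt0//.
apply: (@le_trans _ _ (7`!%:R / a ^+ 7 / n%:R * ((n%:R * a) ^+ 7 / 7`!%:R))).
  rewrite le_eqVlt; apply/orP; left; apply/eqP.
  have F0 : 7`!%:R != 0 :> R by rewrite pnatr_eq0.
  by field; rewrite F0 !lt0r_neq0.
by rewrite ler_pM2l// divr_gt0.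
Qed.

Lemma inv_nat_small (C e : R) : 0 < e -> exists N, forall n, (N <= n)%N -> C / n%:R <= e.
Proof.
move=> e0; exists (Num.truncn (`|C| / e)).+1 => n nN.
have n0 : 0 < n%:R :> R by rewrite ltr0n; apply: leq_trans nN.
rewrite ler_pdivrMr// mulrC -ler_pdivrMr//; apply: (@le_trans _ _ (`|C| / e)).
  by rewrite ler_pM2r ?invr_gt0// ler_norm.
by apply: (le_trans (ltW (truncnS_gt _))); rewrite ler_nat.
Qed.

(** The midpoint g of b and mu leaves room for the widening: [widen mu n b <= g] for large n. The
    factor [n ^ 6] coming from [ck] then meets [(g / mu) ^ (n - 2)], a geometric decay. *)
Lemma flat_error_small (mu b e : R) : 0 < mu -> 0 <= b < mu -> 0 < e ->
  exists N, forall n, (N <= n)%N -> 0 <= flat_error mu n b <= e.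
Proof.
move=> mu0 /andP[b0 bmu] e0; pose g := (b + mu) / 2.
have g0 : 0 < g by rewrite /g; lra.
have gmu : g < mu by rewrite /g; lra.
have [C C0 hC] := @poly_geometric (g / mu) ltac:(by rewrite divr_gt0//= ltr_pdivrMr// mul1r).
(* A tolerance d below this value satisfies [b / (1 - d) + 2 * d <= g]. *)
have gb : 0 < (g - b) / (g + 2) by rewrite divr_gt0//; rewrite /g; lra.
have [N1 hN1] := inv_nat_small 1 gb.
pose D := 2 + Num.sqrt (mu * mu) * C * (mu / g) ^+ 2.
have [N2 hN2] := inv_nat_small D e0.
exists (maxn 4 (maxn N1 N2)) => n; rewrite !geq_max => /and3P[n4 nN1 nN2].
have n0 : (0 < n)%N by apply: leq_trans n4.
have N0 : 0 < n%:R :> R by rewrite ltr0n.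
have /andP[d0 dn] := dk_itv mu0 n0.
have d1 : dk mu n <= (g - b) / (g + 2).
  by apply: (le_trans dn); have := hN1 n nN1; rewrite mul1r.
have K0 := kapmu_gt0 (n - 2) mu0.
set K := kap (n - 2) * mu ^+ (n - 2) in K0.
have g2 : 0 < g + 2 by lra.
have d1' : dk mu n * (g + 2) <= g - b by rewrite -ler_pdivlMr.
have d_lt1 : dk mu n < 1 by nra.
have w0 : 0 <= widen mu n b.
  have h1 : 0 <= b / (1 - dk mu n) by rewrite divr_ge0// subr_ge0 ltW.
  by rewrite /widen addr_ge0// mulr_ge0// ltW.
have wg : widen mu n b <= g.
  rewrite /widen; have h : b / (1 - dk mu n) <= g - 2 * dk mu n.
    by rewrite ler_pdivrMr ?subr_gt0//; nra.
  lra.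
have wmu : widen mu n b <= mu by apply: le_trans wg (ltW gmu).
have Kw : kap (n - 2) * widen mu n b ^+ (n - 2) <= K.
  by rewrite /K ler_pM2l ?kap_gt0// lerXn2r// nnegrE ltW.
have kw0 : 0 <= kap (n - 2) * widen mu n b ^+ (n - 2).
  by rewrite mulr_ge0 ?(ltW (kap_gt0 _))// exprn_ge0.
have nN : n%:R != 0 :> R by rewrite gt_eqF.
have KN : K != 0 by rewrite gt_eqF.
have K1 : 1 + K != 0 by rewrite gt_eqF//; lra.
have dK : K * dk mu n + dk mu n = n%:R^-1.
  by rewrite /dk -/K; field; rewrite ?nN ?K1.
have sq : Num.sqrt (mu / ck mu n) = Num.sqrt mu * n%:R ^+ 6 / K.
  have -> : mu / ck mu n = mu * (n%:R ^+ 6 / K) ^+ 2.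
    by rewrite /ck -/K; field; rewrite ?nN ?KN.
  rewrite sqrtrM ?(ltW mu0)// sqrtr_sqr ger0_norm ?mulrA//.
  by rewrite divr_ge0 ?(ltW K0)// exprn_ge0// ltW.
have rn : kap (n - 2) * widen mu n b ^+ (n - 2) / K <= (g / mu) ^+ (n - 2).
  rewrite /K invfM mulrACA divff ?gt_eqF ?kap_gt0// mul1r -expr_div_n.
  have h : widen mu n b / mu <= g / mu by rewrite ler_pM2r ?invr_gt0.
  apply: lerXn2r h; rewrite nnegrE; first exact: divr_ge0 w0 (ltW mu0).
  exact: divr_ge0 (ltW g0) (ltW mu0).
have third : kap (n - 2) * widen mu n b ^+ (n - 2) * (Num.sqrt (mu / ck mu n) * Num.sqrt (widen mu n b)) <= (D - 2) / n%:R.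
  rewrite sq (_ : _ * _ = (kap (n - 2) * widen mu n b ^+ (n - 2) / K) * n%:R ^+ 6 * (Num.sqrt mu * Num.sqrt (widen mu n b))); last ring.
  have h1 : n%:R ^+ 6 * (g / mu) ^+ (n - 2) <= C / n%:R * (mu / g) ^+ 2.
    have -> : (g / mu) ^+ (n - 2) = (g / mu) ^+ n * (mu / g) ^+ 2.
      have {2}-> : n = (n - 2 + 2)%N by clear -n4; lia.
      rewrite exprD -mulrA -exprMn (_ : g / mu * (mu / g) = 1) ?expr1n ?mulr1//.
      by field; rewrite !gt_eqF.
    rewrite mulrA ler_wpM2r ?hC// exprn_ge0//; exact: divr_ge0 (ltW mu0) (ltW g0).
  have -> : (D - 2) / n%:R = (C / n%:R * (mu / g) ^+ 2) * Num.sqrt (mu * mu) by rewrite /D; ring.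
  apply: ler_pM.
  - by rewrite mulr_ge0 ?exprn_ge0 ?(ltW N0)// divr_ge0 ?(ltW K0).
  - by rewrite mulr_ge0 ?sqrtr_ge0.
  - apply: le_trans h1; rewrite mulrC ler_wpM2l// exprn_ge0// ltW//.
  - rewrite -sqrtrM ?(ltW mu0)// ler_wsqrtr// ler_wpM2l ?(ltW mu0)//.
have third0 : 0 <= kap (n - 2) * widen mu n b ^+ (n - 2) * (Num.sqrt (mu / ck mu n) * Num.sqrt (widen mu n b)).
  by rewrite mulr_ge0// mulr_ge0 ?sqrtr_ge0.
have snd : kap (n - 2) * widen mu n b ^+ (n - 2) * dk mu n <= K * dk mu n by rewrite ler_pM2r.
have snd0 : 0 <= kap (n - 2) * widen mu n b ^+ (n - 2) * dk mu n by rewrite mulr_ge0// ltW.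
have := hN2 n nN2; rewrite /flat_error mulrDr; move: third; rewrite mulrBl.
have : 0 < n%:R^-1 :> R by rewrite invr_gt0.
have -> : 2 / n%:R = n%:R^-1 + n%:R^-1 :> R by ring.
move=> *; apply/andP; split; lra.
Qed.

Definition window (mu e : R) := e * (2 * mu + 2).

(** The conclusion of [small_on_bad_set] with all parameters frozen at n, as a property of e alone,
    so that one value per n can be selected by choice. *)
Definition admissible_eps (mu : R) n (e : R) := forall q x (b : R), chain q (n - 2) -> 0 <= b <= mu ->
  (leb ([set t | (e^-1 < q 0%N t ^+ 2)%R] `&` `[(x - window mu e)%R, (x + window mu e)%R[) <= (e * b)%:E)%E ->
  (forall s t, x - window mu e <= s -> s <= t -> t <= x + window mu e ->
     `|q (n - 2)%N t - q (n - 2)%N s| <= Num.sqrt (mu / ck mu n) * e ^- (n - 2).+1 * Num.sqrt ((t - s) / e)) ->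
  e * `|q 0%N x| <= flat_error mu n b.

Lemma exists_eps (mu : R) : 0 < mu -> exists eps : nat -> R, forall n, 0 < eps n /\
  ((4 <= n)%N -> eps n <= n%:R^-1 /\ admissible_eps mu n (eps n)).
Proof.
move=> mu0; suff H n : exists e, 0 < e /\ ((4 <= n)%N -> e <= n%:R^-1 /\ admissible_eps mu n e).
  by have [eps h] := choice H; exists eps.
(* Default value 1 below 4, where [n - 2 < 2] and [small_on_bad_set] does not apply. *)
case: (leqP 4 n) => n4; last by exists 1; split.
have n0 : (0 < n)%N by apply: leq_trans n4.
have /andP[d0 dn] := dk_itv mu0 n0.
have A0 : 0 < Num.sqrt (mu / ck mu n) by rewrite sqrtr_gt0 divr_gt0// ck_gt0.
have m2 : (2 <= n - 2)%N by clear -n4; lia.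
have dh : 0 < dk mu n <= 2^-1.
  rewrite d0 (le_trans dn)// lef_pV2 ?posrE ?ltr0n// ler_nat; exact: leq_trans n4.
have [e /andP[e0 ed] he] := small_on_bad_set m2 A0 dh mu0.
exists e; split=> // _; split; first exact: le_trans dn.
by move=> q x b cq hb hB hH; exact: he.
Qed.

End constants.

(** * Increments of a function of small local energy *)

Section lower_bound.
Context {R : realType}.
Implicit Types (f g u v : R -> R) (p : {poly R}) (x y s t r : R) (m n N : nat).
Local Notation leb := (@lebesgue_measure R).
Local Notation I := (@I01 R).

Definition density (eps c : nat -> R) n u t : R :=
  Num.min (weak_derivative 1 u t ^+ 2) (1 / eps n) + c n * eps n ^+ (2 * n - 1) * weak_derivative n u t ^+ 2.

(** Set to 0 on the bad set, not clipped: its square stays below the density, and its difference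
    with f lives on the bad set only. *)
Definition truncgrad (e : R) (f : R -> R) t : R := if f t ^+ 2 <= e^-1 then f t else 0.

Lemma measurable_truncgrad (D : set R) e f : measurable_fun D f -> measurable_fun D (truncgrad e f).
Proof.
move=> mf; pose h x : R := if x ^+ 2 <= e^-1 then x else 0.
apply: (@measurableT_comp _ _ _ _ _ _ h) => //.
apply: measurable_fun_ifT; [|exact: measurable_id|exact: measurable_cst].
by apply: measurable_fun_ler; [exact: measurable_funX|exact: measurable_cst].
Qed.

Lemma suboo_I01 (a b : R) : 0 <= a -> b <= 1 -> `]a, b[%classic `<=` I.
Proof.
move=> a0 b1 t; rewrite /= in_itv /= => /andP[at_ tb]; apply/I01E.
by rewrite (le_lt_trans a0 at_) (lt_le_trans tb b1).
Qed.

Lemma leb_oo (s t : R) : s <= t -> leb `]s, t[%classic = (t - s)%:E.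
Proof.
rewrite le_eqVlt => /predU1P[->|st]; rewrite lebesgue_measure_itv /=.
  by rewrite lte_fin ltxx subrr.
by rewrite lte_fin st -EFinD.
Qed.

Lemma L1_oo f (s t : R) : L1 f -> 0 <= s -> t <= 1 -> leb.-integrable `]s, t[ (EFin \o f).
Proof.
move=> fi s0 t1; apply: integrableS fi; [exact: measurable_I01|exact: measurable_itv|exact: suboo_I01].
Qed.

(** From [|f| <= l / 2 + f ^+ 2 / (2 * l)], integrated and then optimised at [l = X / (t - s)]. *)
Lemma cauchy_schwarz_itv f (s t B : R) : L1 f -> 0 <= s -> s <= t -> t <= 1 ->
  (\int[leb]_(x in `]s, t[) (f x ^+ 2)%:E <= B%:E)%E ->
  `|\int[leb]_(x in `]s, t[) f x| <= Num.sqrt (B * (t - s)).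
Proof.
move=> fi s0 st t1 hB; set X := `|_|.
have mf : measurable_fun `]s, t[ f.
  by apply: measurable_funS (L1_measurable fi); [exact: measurable_I01|exact: suboo_I01].
have Xle (l : R) : 0 < l -> X <= l / 2 * (t - s) + B / (2 * l).
  move=> l0; rewrite -lee_fin /X EFin_normr_Rintegral; [|exact: measurable_itv|exact: L1_oo].
  apply: le_trans (le_abse_integral _ _ _) _; [exact: measurable_itv|exact/measurable_EFinP|].
  apply: (@le_trans _ _ (\int[leb]_(x in `]s, t[) ((l / 2)%:E + ((2 * l)^-1)%:E * (f x ^+ 2)%:E))%E).
    apply: ge0_le_integral; first exact: measurable_itv.
    - by move=> x _; exact: abse_ge0.
    - by apply/measurable_EFinP; apply: measurableT_comp.
    - apply/measurable_EFinP; apply: measurable_funD; first exact: measurable_cst.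
      by apply: measurable_funM; [exact: measurable_cst|exact: measurable_funX].
    - move=> x _; rewrite /= -EFinM -EFinD lee_fin -(ler_pM2r (x := 2 * l)) ?mulr_gt0//.
      have -> : (l / 2 + (2 * l)^-1 * f x ^+ 2) * (2 * l) = l ^+ 2 + f x ^+ 2 by field; rewrite gt_eqF.
      have := sqr_ge0 (`|f x| - l); rewrite -(real_normK (num_real (f x))); nra.
  rewrite ge0_integralD; [|exact: measurable_itv| | | |].
  - rewrite integral_cst; last exact: measurable_itv.
    rewrite [X in (_ * X + _)%E](leb_oo st) -EFinM [leRHS]EFinD leeD2l// ge0_integralZl; [|exact: measurable_itv| | |].
    + by rewrite [B / _]mulrC EFinM lee_pmul2l// lte_fin invr_gt0 mulr_gt0.
    + by apply/measurable_EFinP; exact: measurable_funX.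
    + by move=> x _; rewrite lee_fin sqr_ge0.
    + by rewrite lee_fin invr_ge0 mulr_ge0// ltW.
  - by move=> x _; rewrite lee_fin divr_ge0// ltW.
  - exact: measurable_cst.
  - by move=> x _; rewrite -EFinM lee_fin mulr_ge0 ?sqr_ge0// invr_ge0 mulr_ge0// ltW.
  - apply: measurable_funeM; apply/measurable_EFinP; exact: measurable_funX.
have X0 : 0 <= X by exact: normr_ge0.
have [X00|Xpos] := eqVneq X 0; first by rewrite X00 sqrtr_ge0.
have {}Xpos : 0 < X by rewrite lt_neqAle eq_sym Xpos X0.
have T0 : 0 < t - s.
  rewrite lt_neqAle subr_ge0 st andbT; apply/eqP => T00.
  have B0 : 0 <= B.
    by rewrite -lee_fin; apply: le_trans hB; apply: integral_ge0 => x _; rewrite lee_fin sqr_ge0.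
  have BX : 0 < B + X by rewrite ltr_wpDl.
  (* On a degenerate interval the bound reads [X <= B / (2 * l)], which this l contradicts. *)
  have l0 : 0 < (B + X) / X by exact: divr_gt0.
  have := Xle _ l0; rewrite -T00 mulr0 add0r (ler_pdivlMr _ _ (mulr_gt0 (@ltr0Sn R 1) l0)).
  have -> : X * (2 * ((B + X) / X)) = 2 * (B + X) by field; rewrite gt_eqF.
  clear -Xpos B0; lra.
have := Xle (X / (t - s)) (divr_gt0 Xpos T0).
have -> : X / (t - s) / 2 * (t - s) = X / 2 by field; rewrite gt_eqF.
have -> : B / (2 * (X / (t - s))) = B * (t - s) / X / 2 by field; rewrite !gt_eqF.
move=> h; have h2 : X <= B * (t - s) / X by lra.
have h3 : X ^+ 2 <= B * (t - s) by rewrite expr2 -ler_pdivlMr.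
by rewrite -(ger0_norm X0) -sqrtr_sqr ler_wsqrtr.
Qed.

Section estimate.
Variables (mu e : R) (n : nat) (f w : R -> R).
Hypotheses (mu0 : 0 < mu) (e0 : 0 < e) (n4 : (4 <= n)%N).
Hypotheses (cf : continuous f) (mw : measurable_fun I w).

Let dens t := Num.min (f t ^+ 2) (1 / e) + ck mu n * e ^+ (2 * n - 1) * w t ^+ 2.

Let dens_ge0 t : 0 <= dens t.
Proof.
have K0 : 0 <= ck mu n by rewrite ltW// ck_gt0//; exact: leq_trans n4.
apply: addr_ge0; first by rewrite le_min sqr_ge0 divr_ge0// ltW.
by rewrite mulr_ge0 ?sqr_ge0// mulr_ge0// exprn_ge0// ltW.
Qed.

Let mdens (A : set R) : measurable A -> A `<=` I -> measurable_fun A (EFin \o dens).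
Proof.
move=> mA AI; apply/measurable_EFinP; apply: measurable_funD.
  apply: measurable_minr; last exact: measurable_cst.
  by apply: measurable_funX; apply: measurable_funTS; exact: continuous_measurable_fun.
apply: measurable_funM; first exact: measurable_cst.
by apply: measurable_funX; apply: measurable_funS mw; [exact: measurable_I01|].
Qed.

Lemma measurable_bad : measurable [set t | e^-1 < f t ^+ 2].
Proof.
have mf : measurable_fun setT (fun t => f t ^+ 2).
  by apply: measurable_funX; exact: continuous_measurable_fun.
have := mf measurableT `]e^-1, +oo[%classic (measurable_itv _); rewrite setTI.
by congr (measurable _); apply/seteqP; split => t; rewrite /= in_itv /= andbT.
Qed.

(** Chebyshev's inequality: the density is at least [1 / e] on the bad set. *)
Lemma bad_measure (A : set R) (b : R) : measurable A -> A `<=` I ->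
  (\int[leb]_(t in A) (dens t)%:E <= b%:E)%E -> (leb ([set t | (e^-1 < f t ^+ 2)%R] `&` A) <= (e * b)%:E)%E.
Proof.
move=> mA AI hb; set B := [set t | _]; have mB : measurable B := measurable_bad.
have h : ((e^-1)%:E * leb (B `&` A) <= b%:E)%E.
  apply: le_trans hb; rewrite -integral_cst; last exact: measurableI.
  apply: (@le_trans _ _ (\int[leb]_(t in B `&` A) (dens t)%:E)%E).
    apply: ge0_le_integral; first exact: measurableI.
    - by move=> t _; rewrite lee_fin invr_ge0 ltW.
    - exact: measurable_cst.
    - by apply: mdens; [exact: measurableI|move=> t [_ /AI]].
    - move=> t [Bt _]; rewrite lee_fin /dens div1r min_r; last exact: ltW.
      rewrite lerDl mulr_ge0 ?sqr_ge0// mulr_ge0 ?exprn_ge0 ?(ltW e0)// ltW// ck_gt0//; exact: leq_trans n4.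
  apply: ge0_subset_integral; [exact: measurableI|exact: mA|exact: mdens| |exact: subIsetr].
  by move=> t _; rewrite lee_fin.
move: h; rewrite -(@lee_pmul2l _ e%:E) ?lte_fin// muleA -EFinM divff ?gt_eqF// mul1e EFinM//.
Qed.

Lemma top_square (A : set R) (b : R) : measurable A -> A `<=` I ->
  (\int[leb]_(t in A) (dens t)%:E <= b%:E)%E ->
  (\int[leb]_(t in A) (w t ^+ 2)%:E <= (b / (ck mu n * e ^+ (2 * n - 1)))%:E)%E.
Proof.
move=> mA AI hb; set K := ck mu n * e ^+ (2 * n - 1).
have K0 : 0 < K by rewrite mulr_gt0 ?exprn_gt0// ck_gt0//; exact: leq_trans n4.
have mw2 : measurable_fun A (fun t => (w t ^+ 2)%:E).
  by apply/measurable_EFinP; apply: measurable_funX; apply: measurable_funS mw; [exact: measurable_I01|].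
have h : (K%:E * \int[leb]_(t in A) (w t ^+ 2)%:E <= b%:E)%E.
  apply: le_trans hb; rewrite -ge0_integralZl; [|exact: mA|exact: mw2|by move=> t _; rewrite lee_fin sqr_ge0|by rewrite lee_fin ltW].
  apply: ge0_le_integral; first exact: mA.
  - by move=> t _; rewrite -EFinM lee_fin mulr_ge0 ?sqr_ge0// ltW.
  - exact: measurable_funeM.
  - exact: mdens.
  - move=> t _; rewrite -EFinM lee_fin /dens -/K lerDr le_min sqr_ge0 divr_ge0// ltW//.
rewrite -(@lee_pmul2l _ K%:E) ?lte_fin// -EFinM.
by rewrite (_ : K * (b / K) = b)//; field; rewrite gt_eqF.
Qed.

(** The two integrals differ on the bad set only, where f is at most [M / e] and whose measure is at
    most [e * b]; the powers of e cancel. *)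
Lemma bad_part (s t b M : R) : 0 <= s -> s <= t -> t <= 1 -> 0 <= M ->
  (\int[leb]_(x in `]s, t[) (dens x)%:E <= b%:E)%E ->
  (forall x, s < x < t -> e * `|f x| <= M) ->
  `|\int[leb]_(x in `]s, t[) f x - \int[leb]_(x in `]s, t[) truncgrad e f x| <= b * M.
Proof.
move=> s0 st t1 M0 hb hM.
have AI := suboo_I01 s0 t1; set A : set R := `]s, t[%classic in AI *.
have mA : measurable A by exact: measurable_itv.
set B := [set x | e^-1 < f x ^+ 2]; have mB : measurable B := measurable_bad.
have cfn : {within `[s, t], continuous f} by apply: continuous_subspaceT.
have fi : leb.-integrable A (EFin \o f) by apply: L1_oo => //; exact: L1_continuous.
have tE x : f x - truncgrad e f x = f x * \1_B x.
  rewrite /truncgrad indicE leNgt; have [h|h] := boolP (e^-1 < f x ^+ 2).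
    by rewrite mem_set//= mulr1 subr0.
  by rewrite memNset ?mulr0 ?subrr//; exact/negP.
have gE x : truncgrad e f x = f x - f x * \1_B x by rewrite -tE; ring.
have mi : measurable_fun A (\1_B : R -> R) by apply: measurable_funTS; exact: measurable_indic.
have mf : measurable_fun A f by apply: measurable_funTS; exact: continuous_measurable_fun.
have fBi : leb.-integrable A (EFin \o (fun x => f x * \1_B x)).
  apply: le_integrable fi; [exact: mA|by apply/measurable_EFinP; exact: measurable_funM|].
  move=> x _; rewrite /= lee_fin normrM ler_piMr// ger0_norm ?indicE; by case: (_ \in _).
have gi : leb.-integrable A (EFin \o truncgrad e f).
  have h := integrableB _ fi fBi; apply: eq_integrable (h mA); first exact: mA.
  by move=> x _; rewrite /= gE.
rewrite -(RintegralB _ fi gi); last exact: mA.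
rewrite (_ : Rintegral _ _ _ = \int[leb]_(x in A) (f x * \1_B x)); last by apply: eq_Rintegral => x _; rewrite tE.
rewrite -lee_fin EFin_normr_Rintegral//; apply: le_trans (le_abse_integral _ _ _) _ => //.
  by apply/measurable_EFinP; exact: measurable_funM.
apply: (@le_trans _ _ (\int[leb]_(x in A) ((M / e)%:E * (\1_B x)%:E))%E).
  apply: ge0_le_integral => //.
  - by apply/measurable_EFinP; apply: measurableT_comp => //; exact: measurable_funM.
  - by apply: measurable_funeM; exact/measurable_EFinP.
  - move=> x; rewrite /A /= in_itv /= => xst; rewrite lee_fin normrM [`|\1_B x|]ger0_norm; last by rewrite indicE.
    by rewrite ler_wpM2r ?indicE// ler_pdivlMr// mulrC; exact: hM.
rewrite ge0_integralZl//; last by rewrite lee_fin divr_ge0// ltW.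
  rewrite integral_indic//; apply: (@le_trans _ _ ((M / e)%:E * (e * b)%:E)%E).
    by apply: lee_pmul => //; [rewrite lee_fin divr_ge0// ltW|exact: bad_measure].
  by rewrite -EFinM lee_fin le_eqVlt; apply/orP; left; apply/eqP; field; rewrite gt_eqF.
exact/measurable_EFinP.
Qed.

End estimate.

Lemma ftc_oo f F s t : continuous f -> (forall x, is_derive x (1 : R) F (f x)) ->
  0 <= s -> s <= t -> t <= 1 -> F t - F s = \int[leb]_(x in `]s, t[) f x.
Proof.
move=> cf dF s0 st t1; have [G dG GE] := antiderivative cf.
have dH x : is_derive x (1 : R) (fun x => F x - G x) (0 : R).
  by have := is_deriveB (dF x) (dG x); rewrite subrr.
have := @mvt_bound R _ _ s t 0 dH st; rewrite mul0r /= => h.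
have h2 : `|F t - G t - (F s - G s)| <= 0 by apply: h => x _; rewrite normr0.
move: h2; rewrite normr_le0 subr_eq0 => /eqP h2.
rewrite -(primB (L1_continuous cf) s0 st t1) -!GE; lra.
Qed.

(** While the energy on []a, b[] stays at most [be], increments of u are those of its truncated
    gradient up to [be * flat_error], which tends to 0 for [be < mu]: no jump can form. The margin
    [window mu e] keeps inside []a, b[] the neighbourhoods on which [admissible_eps] is used. *)
Lemma lower_estimate (mu e : R) n u : 0 < mu -> 0 < e -> (4 <= n)%N -> admissible_eps mu n e ->
  sobolevH n u -> exists P : R -> R, [/\ continuous P, {ae leb, forall t, I t -> u t = P t} &
  forall a b be s t : R, 0 <= a -> b <= 1 -> 0 <= be <= mu -> 0 <= flat_error mu n be ->
    (\int[leb]_(x in `]a, b[) (Num.min (weak_derivative 1 u x ^+ 2) (1 / e) +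
       ck mu n * e ^+ (2 * n - 1) * weak_derivative n u x ^+ 2)%:E <= be%:E)%E ->
    a + window mu e < s -> s <= t -> t < b - window mu e ->
    `|P t - P s - \int[leb]_(x in `]s, t[) truncgrad e (weak_derivative 1 u) x| <= be * flat_error mu n be].
Proof.
move=> mu0 e0 n4 adm hu.
have nE : n = n.-1.+1 by clear -n4; lia.
have hu' := hu; rewrite nE in hu'.
have [P [cP Pw P0 P1]] := sobolev_representative hu'; rewrite -nE in Pw.
have {}P1 := P1 ltac:(clear -n4; lia).
have w0 : 0 < window mu e by rewrite mulr_gt0// addr_gt0// mulr_gt0.
have cP0 : continuous (P 0%N) by apply: chain_continuous cP _; clear -n4; lia.
have cf : continuous (P 1%N) by apply: chain_continuous cP _; clear -n4; lia.
have [[_ l1 _] L21] := weak_derivativeP hu (ltac:(clear -n4; lia) : (1 <= n)%N).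
have L2n := (weak_derivativeP hu (leqnn n)).2.
set w := weak_derivative n u in Pw L2n *; set g := weak_derivative 1 u in P1 l1 L21 *.
have mw : measurable_fun I w by case: L2n.
have mg : measurable_fun I g by case: L21.
exists (P 0%N); split=> // a b be s t a0 b1 bb et0 hE as_ st tb.
have abI := suboo_I01 a0 b1.
set dens := fun t => Num.min (P 1%N t ^+ 2) (1 / e) + ck mu n * e ^+ (2 * n - 1) * w t ^+ 2.
have mdens (A : set R) : measurable A -> A `<=` I -> measurable_fun A (EFin \o dens).
  move=> mA AI; apply/measurable_EFinP; apply: measurable_funD.
    apply: measurable_minr; last exact: measurable_cst.
    by apply: measurable_funX; apply: measurable_funTS; exact: continuous_measurable_fun.
  apply: measurable_funM; first exact: measurable_cst.
  by apply: measurable_funX; apply: measurable_funS mw; [exact: measurable_I01|].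
have ck0 : 0 < ck mu n by apply: ck_gt0 => //; clear -n4; lia.
have dens_ge0 x : 0 <= dens x.
  apply: addr_ge0; first by rewrite le_min sqr_ge0 divr_ge0// ltW.
  by rewrite mulr_ge0 ?sqr_ge0// mulr_ge0// ?exprn_ge0// ltW.
have hD : (\int[leb]_(x in `]a, b[) (dens x)%:E <= be%:E)%E.
  apply: le_trans hE; rewrite le_eqVlt; apply/orP; left; apply/eqP.
  apply: ae_eq_integral; first exact: measurable_itv.
  - by apply: mdens => //; exact: measurable_itv.
  - apply/measurable_EFinP; apply: measurable_funD.
      apply: measurable_minr; last exact: measurable_cst.
      by apply: measurable_funX; apply: measurable_funS mg; [exact: measurable_I01|].
    apply: measurable_funM; first exact: measurable_cst.
    by apply: measurable_funX; apply: measurable_funS mw; [exact: measurable_I01|].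
  - by apply: aeS P1 => x h /abI/h h2; rewrite /dens /= h2.
have hDS (A : set R) : measurable A -> A `<=` `]a, b[%classic -> (\int[leb]_(x in A) (dens x)%:E <= be%:E)%E.
  move=> mA Aab; apply: le_trans hD; apply: ge0_subset_integral; [exact: mA|exact: measurable_itv| | |exact: Aab].
    by apply: mdens => //; exact: measurable_itv.
  by move=> x _; rewrite lee_fin.
have s0 : 0 <= s by lra.
have t1 : t <= 1 by lra.
have subst_ : `]s, t[%classic `<=` `]a, b[%classic by apply: subset_itv; rewrite bnd_simp; lra.
rewrite (ftc_oo cf (fun x => cP 0%N ltac:(clear -n4; lia) x) s0 st t1).
rewrite (_ : \int[leb]_(x in `]s, t[) truncgrad e g x = \int[leb]_(x in `]s, t[) truncgrad e (P 1%N) x); last first.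
  rewrite /Rintegral; congr fine; apply: ae_eq_integral; first exact: measurable_itv.
  - apply/measurable_EFinP; apply: measurable_truncgrad.
    by apply: measurable_funS mg; [exact: measurable_I01|exact: subset_trans subst_ abI].
  - by apply/measurable_EFinP; apply: measurable_truncgrad; apply: measurable_funTS; exact: continuous_measurable_fun.
  - by apply: aeS P1 => x h /subst_/abI/h h2; rewrite /truncgrad /= h2.
apply: (@bad_part mu e n (P 1%N) w) => //.
  by apply: hDS => //; exact: measurable_itv.
move=> x /andP[sx xt].
have winab : `[x - window mu e, x + window mu e[%classic `<=` `]a, b[%classic.
  by apply: subset_itv; rewrite bnd_simp; lra.
have win2 : `]x - window mu e, x + window mu e[%classic `<=` `]a, b[%classic.
  by apply: subset_itv; rewrite bnd_simp; lra.
(* Starting at the derivative of [P 0] leaves a chain of length [n - 2]. *)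
apply: (adm (fun j => P j.+1)) => //.
- by apply: chain_shift; apply: chainW cP; clear -n4; lia.
- apply: (@bad_measure mu e n (P 1%N) w) => //.
    exact: subset_trans winab abI.
  by apply: hDS => //; exact: measurable_itv.
- move=> y z h1 h2 h3.
  have -> : (n - 2).+1 = n.-1 by clear -n4; lia.
  have y0 : 0 <= y by lra.
  have z1 : z <= 1 by lra.
  rewrite Pw//.
  have yzab : `]y, z[%classic `<=` `]a, b[%classic by apply: subset_itv; rewrite bnd_simp; lra.
  have := cauchy_schwarz_itv (L2_L1 L2n) y0 h2 z1 (top_square mu0 e0 n4 cf mw (measurable_itv _) (subset_trans yzab abI) (hDS _ (measurable_itv _) yzab)).
  move/le_trans; apply.
  have ep : 0 < e ^+ n.-1 by rewrite exprn_gt0.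
  (* Of the [2 * n - 1] powers of e, one goes with [z - y] and the others leave the square root as
     [e ^- n.-1], the scaling that [admissible_eps] expects. *)
  have -> : be / (ck mu n * e ^+ (2 * n - 1)) * (z - y) = (be / ck mu n) * (e ^- n.-1) ^+ 2 * ((z - y) / e).
    have -> : (2 * n - 1 = n.-1 + n.-1 + 1)%N by clear -n4; lia.
    by rewrite !exprD expr1; field; rewrite !gt_eqF.
  rewrite sqrtrM; last by rewrite mulr_ge0 ?sqr_ge0// divr_ge0 ?(ltW ck0)//; case/andP: bb.
  rewrite sqrtrM; last by rewrite divr_ge0 ?(ltW ck0)//; case/andP: bb.
  rewrite sqrtr_sqr [`|_|]gtr0_norm ?invr_gt0//.
  rewrite ler_wpM2r ?sqrtr_ge0// ler_wpM2r ?invr_ge0 ?(ltW ep)// ler_wsqrtr//.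
  by rewrite ler_pM2r ?invr_gt0//; case/andP: bb.
Qed.

End lower_bound.

(** * Compactness and lower semicontinuity *)

Section densities.
Context {R : realType}.
Implicit Types (f g u v : R -> R) (p : {poly R}) (x y s t r : R) (m n N : nat).
Local Notation leb := (@lebesgue_measure R).
Local Notation I := (@I01 R).

Lemma ultra_cvg (U : set_system nat) (x : nat -> R) (M : R) : UltraFilter U ->
  (\forall j \near U, `|x j| <= M) -> exists l : R, x @ U --> l.
Proof.
move=> UU hM; have UP : ProperFilter (x @ U) by exact: fmap_proper_filter.
have cM := @segment_compact R (- M) M.
have [l [_ hl]] := cM (x @ U) UP ltac:(by apply: filterS hM => j; rewrite /= in_itv /= ler_norml).
exists l => V Vl; have [//|h] := in_ultra_setVsetC (x @^-1` V) UU.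
by have [y [/= h1 h2]] := hl (~` V) V h Vl.
Qed.

Section density.
Variables (nu : set R -> R) (K : R).
Hypothesis nuU : forall A B, measurable A -> measurable B -> A `&` B = set0 -> nu (A `|` B) = nu A + nu B.
(** Quantitative absolute continuity in a form that passes to limits; optimising over l gives the
    bound [2 * sqrt (K * leb A)] valid for densities bounded in [L2]. *)
Hypothesis nuK : forall A (l : R), measurable A -> 0 < l -> `|nu A| <= l * fine (leb (A `&` I)) + K / l.

Let lI (A : set R) : R := fine (leb (A `&` I)).

Let mI : measurable I. Proof. exact: measurable_I01. Qed.

Let lIE (A : set R) : measurable A -> leb (A `&` I) = (lI A)%:E.
Proof.
move=> mA; rewrite /lI fineK// ge0_fin_numE//.
apply: (@le_lt_trans _ _ (leb I)); last by rewrite [X in (X < _)%E](leb_I01 : _ = 1%E) ltry.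
by apply: le_measure; rewrite ?inE//; exact: measurableI.
Qed.

Let K0 : 0 <= K.
Proof.
have := @nuK set0 1 measurable0 ltr01; rewrite set0I measure0 mulr0 add0r divr1.
exact: le_trans.
Qed.

Let nu0 : nu set0 = 0.
Proof.
have := nuU measurable0 measurable0 (set0I set0); rewrite setU0 => /eqP.
by rewrite addrC -subr_eq subrr => /eqP.
Qed.

Let nu_small (A : nat -> set R) : (forall n, measurable (A n)) -> (lI \o A) @ \oo --> 0 ->
  nu \o A @ \oo --> 0.
Proof.
move=> mA cA; apply/cvgrPdist_le => e e0; pose l := 2 * (K + 1) / e.
have K1 : 0 < K + 1 by rewrite ltr_wpDl.
have l0 : 0 < l by rewrite divr_gt0// mulr_gt0.
have e2 : 0 < e / (2 * l) by rewrite divr_gt0// mulr_gt0.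
move/cvgrPdist_le: cA => /(_ _ e2); apply: filterS => n; rewrite /= !sub0r !normrN => h.
apply: le_trans (nuK (mA n) l0) _; have {}h := le_trans (ler_norm _) h.
have -> : e = l * (e / (2 * l)) + (K + 1) / l by rewrite /l; field; rewrite !gt_eqF.
apply: lerD; first by rewrite ler_pM2l.
by rewrite ler_pM2r ?invr_gt0// lerDl.
Qed.

Let nuE (A : set (measurableTypeR R)) : \bar R := (nu A)%:E.

(** For a finitely additive function, countable additivity amounts to continuity along the tails
    [T n] of the union, whose Lebesgue measure in [I01] tends to 0. *)
Let nu_sigma : semi_sigma_additive nuE.
Proof.
move=> F mF tF mUF; pose T n := \bigcup_(i in [set i | (n <= i)%N]) F i.
have mT n : measurable (T n) by apply: bigcup_measurable => k _; exact: mF.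
have T0 : \bigcup_n F n = T 0%N by rewrite /T; congr bigcup; apply/seteqP; split.
have TS n : T n = F n `|` T n.+1.
  apply/seteqP; split=> [x [i /= ni Fx]|x [Fx|[i /= ni Fx]]].
  - move: ni; rewrite leq_eqVlt => /predU1P[->|ni]; first by left.
    by right; exists i.
  - by exists n => /=.
  - by exists i => //=; exact: ltnW.
have dT n : F n `&` T n.+1 = set0.
  rewrite -subset0 => x [Fx [i /= ni Fi]]; have := tF n i Logic.I Logic.I ltac:(by exists x).
  by move=> ni2; rewrite ni2 ltnn in ni.
have lU A B : measurable A -> measurable B -> A `&` B = set0 -> lI (A `|` B) = lI A + lI B.
  move=> mA mB AB; apply: EFin_inj; rewrite EFinD -!lIE//; last exact: measurableU.
  rewrite setIUl measureU//; [exact: measurableI|exact: measurableI|].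
  by rewrite setIACA AB set0I.
have sum (f : set R -> R) : (forall A B, measurable A -> measurable B -> A `&` B = set0 -> f (A `|` B) = f A + f B) ->
    forall n, f (T 0%N) = \sum_(0 <= i < n) f (F i) + f (T n).
  move=> fU; elim=> [|n IH]; first by rewrite big_geq// add0r.
  by rewrite IH (TS n) (fU _ _ (mF n) (mT n.+1) (dT n)) big_nat_recr//= addrA.
have lT : lI \o T @ \oo --> 0.
  have cap0 : \bigcap_n (T n `&` I) = set0.
    rewrite -subset0 => x h; have [[i _ Fi] _] := h 0%N Logic.I.
    have [[i' /= ii' Fi'] _] := h i.+1 Logic.I.
    have := tF i i' Logic.I Logic.I ltac:(by exists x).
    by move=> ii; rewrite ii ltnn in ii'.
  have h := @nonincreasing_cvg_mu _ _ R leb (fun n => T n `&` I).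
  have {}h : leb \o (fun n => T n `&` I) @ \oo --> 0%E.
    rewrite -[X in _ --> X](measure0 leb) -cap0; apply: h.
    - by apply: (@le_lt_trans _ _ (lI (T 0%N))%:E); [rewrite -(lIE (mT 0%N)); exact: lexx|exact: ltry].
    - by move=> n; exact: measurableI.
    - by apply: bigcap_measurableType => n _; exact: measurableI.
    - apply/nonincreasing_seqP => n; apply/subsetPset; apply: setSI.
      by rewrite (TS n); exact: subsetUr.
  exact: (fine_cvg h).
rewrite T0 /nuE (_ : (fun n => _) = EFin \o (fun n => nu (T 0%N) - nu (T n))); last first.
  apply/funext => n; rewrite /= sumEFin; congr EFin; rewrite (sum nu nuU n); ring.
apply: cvg_EFin; first exact: nearW.
rewrite -[X in _ --> X]subr0; apply: cvgB; first exact: cvg_cst.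
exact: nu_small.
Qed.

Lemma charge_density : exists2 g : R -> R, L1 g & forall A, measurable A -> A `<=` I -> nu A = \int[leb]_(x in A) g x.
Proof.
pose nu' : {charge set (measurableTypeR R) -> \bar R} := HB.pack nuE
  (@isCharge.Build _ (measurableTypeR R) R nuE (f_equal EFin nu0) (fun _ _ => isT) nu_sigma).
have dom : nu' `<< leb.
  apply/null_content_dominatesP => A mA A0; rewrite /= /nuE; congr EFin.
  have h : (fun n : nat => nu A) @ \oo --> 0.
    apply: (@nu_small (fun=> A)) => //; rewrite (_ : _ \o _ = fun=> 0); first exact: cvg_cst.
    apply/funext => n; rewrite /= /lI (_ : leb (A `&` I) = 0%E)//.
    by apply/eqP; rewrite eq_le measure_ge0 andbT -A0; apply: le_measure; rewrite ?inE//; exact: measurableI.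
  by apply: (cvg_unique _ (cvg_cst _) h); exact: Rhausdorff.
pose g := fine \o Radon_Nikodym nu' leb.
have gE : EFin \o g = Radon_Nikodym nu' leb.
  by apply/funext => x; rewrite /= fineK// Radon_Nikodym_fin_num.
have gi : leb.-integrable setT (EFin \o g) by rewrite gE; exact: Radon_Nikodym_integrable.
exists g; first by apply: integrableS gi; [exact: measurableT|exact: measurable_I01|exact: subsetT].
move=> A mA AI; have := Radon_Nikodym_integral dom mA; rewrite -gE /= /nuE => h.
by rewrite /Rintegral -h.
Qed.
End density.

End densities.

(** * Weak limits of truncated gradients along an ultrafilter *)

Section weak_limits.
Context {R : realType}.
Implicit Types (f g u v : R -> R) (p : {poly R}) (x y s t r : R) (m n N : nat).
Local Notation leb := (@lebesgue_measure R).
Local Notation I := (@I01 R).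

Section subset_integral.
Variable A : set R.
Hypotheses (mA : measurable A) (AI : A `<=` I).

Lemma L1S f : L1 f -> leb.-integrable A (EFin \o f).
Proof. move=> fi; apply: integrableS fi; [exact: measurable_I01|exact: mA|exact: AI]. Qed.

Lemma RintD f g : L1 f -> L1 g ->
  \int[leb]_(x in A) (f x + g x) = \int[leb]_(x in A) f x + \int[leb]_(x in A) g x.
Proof. by move=> fi gi; rewrite (RintegralD _ (L1S fi) (L1S gi)); last exact: mA. Qed.

Lemma RintB f g : L1 f -> L1 g ->
  \int[leb]_(x in A) (f x - g x) = \int[leb]_(x in A) f x - \int[leb]_(x in A) g x.
Proof. by move=> fi gi; rewrite -(RintegralB _ (L1S fi) (L1S gi)); last exact: mA. Qed.

Lemma RintZ f (c : R) : L1 f -> \int[leb]_(x in A) (c * f x) = c * \int[leb]_(x in A) f x.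
Proof. by move=> fi; rewrite (RintegralZl _ _ (L1S fi)); last exact: mA. Qed.

Lemma Rint_le f g : L1 f -> L1 g -> (forall x, I x -> f x <= g x) ->
  \int[leb]_(x in A) f x <= \int[leb]_(x in A) g x.
Proof. by move=> fi gi fg; apply: (le_Rintegral _ (L1S fi) (L1S gi)); [exact: mA|move=> x /AI/fg]. Qed.

Lemma Rint_norm f : L1 f -> `|\int[leb]_(x in A) f x| <= \int[leb]_(x in A) `|f x|.
Proof. by move=> fi; apply: (le_normr_Rintegral _ (L1S fi)); exact: mA. Qed.

Lemma RintE f : L1 f -> (\int[leb]_(x in A) (f x)%:E)%E = (\int[leb]_(x in A) f x)%:E.
Proof. by move=> fi; rewrite /Rintegral fineK//; apply: integrable_fin_num (L1S fi); exact: mA. Qed.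

End subset_integral.

Lemma L1D f g : L1 f -> L1 g -> L1 (fun x => f x + g x).
Proof. by move=> fi gi; have h := integrableD _ fi gi; exact: (h measurable_I01). Qed.

Lemma L1Z f (c : R) : L1 f -> L1 (fun x => c * f x).
Proof. by move=> fi; have h := integrableZl _ c fi; exact: (h measurable_I01). Qed.

Lemma L1B f g : L1 f -> L1 g -> L1 (fun x => f x - g x).
Proof. by move=> fi gi; have h := integrableB _ fi gi; exact: (h measurable_I01). Qed.

Lemma L1_le f g : measurable_fun I f -> L1 g -> (forall x, I x -> `|f x| <= g x) -> L1 f.
Proof.
move=> mf gi fg; apply: le_integrable gi; [exact: measurable_I01|exact/measurable_EFinP|].
by move=> x /fg h; rewrite /= lee_fin (le_trans h)// ler_norm.
Qed.

Lemma L1_norm f : L1 f -> L1 (fun x => `|f x|).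
Proof.
move=> fi; apply: (le_integrable _ _ _ fi); [exact: measurable_I01| |by move=> x _; rewrite /= normr_id].
by apply/measurable_EFinP; apply: measurableT_comp => //; exact: L1_measurable.
Qed.

Lemma L1_cst (c : R) : L1 (fun _ : R => c).
Proof. by apply: L1_continuous; exact: cst_continuous. Qed.

Lemma L1_sum N (f : nat -> R -> R) : (forall i, L1 (f i)) -> L1 (fun x => \sum_(i < N) f i x).
Proof.
move=> fi; elim: N => [|N IH].
  by rewrite (_ : (fun x => _) = fun=> 0); [exact: L1_cst|apply/funext => x; rewrite big_ord0].
rewrite (_ : (fun x => _) = fun x => \sum_(i < N) f i x + f N x); first exact: L1D.
by apply/funext => x; rewrite big_ord_recr.
Qed.

Lemma L1_indic f (B : set R) : measurable B -> L1 f -> L1 (fun x => f x * \1_B x).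
Proof.
move=> mB fi; apply: (L1_le _ (L1_norm fi)) => [|x _].
  by apply: measurable_funM; [exact: L1_measurable|apply: measurable_funTS; exact: measurable_indic].
by rewrite normrM ler_piMr// indicE ger0_norm; case: (_ \in _).
Qed.

Lemma Rint_indic f (A B : set R) :
  \int[leb]_(x in A) (f x * \1_B x) = \int[leb]_(x in A `&` B) f x.
Proof.
rewrite Rintegral_mkcondr; apply: eq_Rintegral => x _; rewrite patchE indicE.
by case: (x \in B); rewrite ?mulr1 ?mulr0.
Qed.

Lemma Rint_sum (A : set R) N (f : nat -> R -> R) : measurable A -> A `<=` I -> (forall i, L1 (f i)) ->
  \int[leb]_(x in A) (\sum_(i < N) f i x) = \sum_(i < N) \int[leb]_(x in A) f i x.
Proof.
move=> mA AI fi; elim: N => [|N IH].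
  rewrite big_ord0 (_ : (fun x => _) = fun x => 0 * 0); last by apply/funext => x; rewrite big_ord0 mulr0.
  by rewrite (RintZ mA AI)//; [rewrite mul0r|exact: L1_cst].
rewrite big_ord_recr /= -IH -(RintD mA AI)//; last exact: L1_sum.
by apply: eq_Rintegral => x _; rewrite big_ord_recr.
Qed.

Lemma Rint_setU f (A B : set R) : measurable A -> measurable B -> A `<=` I -> B `<=` I ->
  A `&` B = set0 -> L1 f ->
  \int[leb]_(x in A `|` B) f x = \int[leb]_(x in A) f x + \int[leb]_(x in B) f x.
Proof.
move=> mA mB AI BI AB fi; rewrite (Rintegral_setU _ _ (L1S _ _ fi))//.
- exact: measurableU.
- by move=> x [/AI|/BI].
- by apply/disj_set2P.
Qed.

Lemma limn_einf_le_cst (x : nat -> \bar R) (c : \bar R) : (forall n, (x n <= c)%E) -> (limn_einf x <= c)%E.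
Proof.
move=> h; rewrite limn_einf_lim; apply: lime_le; first exact: is_cvg_einfs.
by apply: nearW => n; apply: (le_trans _ (h n)); apply: ereal_inf_lbound; exists n => //=.
Qed.

Lemma cvg_sum_ord (F : set_system nat) {FF : Filter F} N (f : nat -> nat -> R) (l : nat -> R) :
  (forall i, f i @ F --> l i) -> (fun j => \sum_(i < N) f i j) @ F --> \sum_(i < N) l i.
Proof.
move=> h; elim: N => [|N IH].
  by rewrite big_ord0 (_ : (fun j => _) = fun=> 0); [exact: cvg_cst|apply/funext => j; rewrite big_ord0].
rewrite big_ord_recr /= (_ : (fun j => _) = fun j => \sum_(i < N) f i j + f N j); first exact: cvgD.
by apply/funext => j; rewrite big_ord_recr.
Qed.

Section ultralimits.
Import HBSimple HBNNSimple.
Variables (U : set_system nat) (gs ds : nat -> R -> R) (E1 : R).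
Hypotheses (UU : UltraFilter U) (mg : forall j, measurable_fun I (gs j)) (di : forall j, L1 (ds j)).
Hypotheses (gd : forall j t, I t -> gs j t ^+ 2 <= ds j t) (dE : forall j, \int[leb]_(t in I) ds j t <= E1).

Let mI : measurable I. Proof. exact: measurable_I01. Qed.

Let gl (l : R) j t : 0 < l -> I t -> `|gs j t| <= l + l^-1 * ds j t.
Proof.
move=> l0 /(@gd j) h; rewrite -(ler_pM2r l0) mulrDl mulrAC mulVf ?gt_eqF// mul1r.
have := sqr_ge0 (`|gs j t| - l); rewrite -(real_normK (num_real (gs j t))) in h; nra.
Qed.

Let gi j : L1 (gs j).
Proof.
apply: (@L1_le _ (fun t => 1 + 1^-1 * ds j t)) => //; last by move=> x; apply: gl.
by apply: L1D; [exact: L1_cst|exact: L1Z].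
Qed.

Let ds0 j t : I t -> 0 <= ds j t.
Proof. by move=> /(@gd j); apply: le_trans; exact: sqr_ge0. Qed.

Let dA j (A : set R) : measurable A -> A `<=` I -> 0 <= \int[leb]_(x in A) ds j x <= E1.
Proof.
move=> mA AI; apply/andP; split.
  by apply: Rintegral_ge0 => x /AI; exact: ds0.
apply: (le_trans _ (dE j)); rewrite -lee_fin -(RintE mA AI)// -(RintE mI)//.
apply: ge0_subset_integral; [exact: mA|exact: mI| | |exact: AI].
  by apply/measurable_EFinP; exact: L1_measurable.
by move=> x /(@ds0 j) h; rewrite lee_fin.
Qed.

Definition ulim (x : nat -> R) : R := lim (x @ U).

Let ulimP (x : nat -> R) (M : R) : (forall j, `|x j| <= M) -> x @ U --> ulim x.
Proof.
move=> h; have hU : \forall j \near U, `|x j| <= M by exact: nearW.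
by have [l xl] := ultra_cvg UU hU; apply/cvg_ex; exists l.
Qed.

(** Limit of the energies as a function of the set. It is only finitely additive and may concentrate
    at points, which is what detects jumps. *)
Definition energy (A : set R) := ulim (fun j => \int[leb]_(x in A) ds j x).

Lemma energyP (A : set R) : measurable A -> A `<=` I ->
  (fun j => \int[leb]_(x in A) ds j x) @ U --> energy A.
Proof.
by move=> mA AI; apply: (@ulimP _ E1) => j; have /andP[h1 h2] := dA j mA AI; rewrite ger0_norm.
Qed.

Lemma energyU (A B : set R) : measurable A -> measurable B -> A `<=` I -> B `<=` I ->
  A `&` B = set0 -> energy (A `|` B) = energy A + energy B.
Proof.
move=> mA mB AI BI AB; have h := cvgD (energyP mA AI) (energyP mB BI).
have h2 : (fun j => \int[leb]_(x in A `|` B) ds j x) @ U --> energy (A `|` B).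
  by apply: energyP; [exact: measurableU|move=> x [/AI|/BI]].
apply: (cvg_unique _ h2); first exact: Rhausdorff.
rewrite (_ : (fun j => _) = fun j => \int[leb]_(x in A) ds j x + \int[leb]_(x in B) ds j x); first exact: h.
by apply/funext => j; exact: Rint_setU.
Qed.

(** Along an ultrafilter the bounded integrals converge on all measurable sets at once, with no
    extraction of subsequences. The limit is additive and inherits the bound [l * leb A + E1 / l],
    so [charge_density] applies. *)
Lemma weak_limit : exists2 g : R -> R, L1 g & forall A, measurable A -> A `<=` I ->
  (fun j => \int[leb]_(x in A) gs j x) @ U --> \int[leb]_(x in A) g x.
Proof.
have gb (A : set R) j (l : R) : measurable A -> A `<=` I -> 0 < l ->
    `|\int[leb]_(x in A) gs j x| <= l * fine (leb A) + E1 / l.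
  move=> mA AI l0; apply: (le_trans (Rint_norm mA AI (gi j))).
  apply: (@le_trans _ _ (\int[leb]_(x in A) (l * 1 + l^-1 * ds j x))).
    apply: Rint_le => //; first exact: L1_norm.
    - by apply: L1D; [exact: L1_cst|exact: L1Z].
    - by move=> x Ix; rewrite mulr1; exact: gl.
  rewrite (RintD mA AI); [|exact: L1_cst|exact: L1Z].
  rewrite !(RintZ mA AI)//; last exact: L1_cst.
  apply: lerD; first by rewrite ler_pM2l// /Rintegral integral_cst// mul1e.
  by rewrite mulrC ler_pM2r ?invr_gt0//; case/andP: (dA j mA AI).
pose nu (A : set R) := ulim (fun j => \int[leb]_(x in A `&` I) gs j x).
have nuP (A : set R) : measurable A -> (fun j => \int[leb]_(x in A `&` I) gs j x) @ U --> nu A.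
  move=> mA; apply: ulimP => j; apply: (gb _ j 1) => //; exact: measurableI.
have [||g gi' hg] := @charge_density R nu E1; last 1 first.
- exists g => // A mA AI; rewrite -hg//; have := nuP A mA.
  by rewrite (_ : A `&` I = A)//; apply/seteqP; split => [x []//|x Ax]; split => //; exact: AI.
- move=> A B mA mB AB; have mAI : measurable (A `&` I) by exact: measurableI.
  have mBI : measurable (B `&` I) by exact: measurableI.
  have h := cvgD (nuP A mA) (nuP B mB).
  apply: (cvg_unique _ (nuP _ (measurableU _ _ mA mB))); first exact: Rhausdorff.
  rewrite (_ : (fun j => _) = fun j => \int[leb]_(x in A `&` I) gs j x + \int[leb]_(x in B `&` I) gs j x); first exact: h.
  apply/funext => j; rewrite setIUl; apply: Rint_setU => //.
  by rewrite setIACA AB set0I.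
- move=> A l mA l0; have mAI : measurable (A `&` I) by exact: measurableI.
  have h : (fun j => `|\int[leb]_(x in A `&` I) gs j x|) @ U --> `|nu A| by apply: cvg_norm; exact: nuP.
  set c := _ + _; have hc : (fun _ : nat => c) @ U --> c by exact: cvg_cst.
  by apply: (ler_cvg_to h hc); apply: nearW => j; exact: gb.
Qed.

(** For a simple function [ph], [2 * ph * gs - ph ^+ 2 <= gs ^+ 2 <= ds]; the left side passes to
    the limit. The approximants of the positive and negative parts of g give [ph] the sign of g and
    a smaller modulus, so [ph ^+ 2 <= ph * g] and the integral of [ph ^+ 2] is at most the energy.
    Fatou's lemma concludes. *)
Lemma weak_lsc (g : R -> R) (A : set R) : L1 g -> (forall A, measurable A -> A `<=` I ->
  (fun j => \int[leb]_(x in A) gs j x) @ U --> \int[leb]_(x in A) g x) -> measurable A -> A `<=` I ->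
  (\int[leb]_(x in A) (g x ^+ 2)%:E <= (energy A)%:E)%E.
Proof.
move=> gi' hg mA AI.
have ws N (c : nat -> R) (B : nat -> set R) : (forall i, measurable (B i)) ->
   (fun j => \int[leb]_(x in A) ((\sum_(i < N) c i * \1_(B i) x) * gs j x)) @ U -->
   \int[leb]_(x in A) ((\sum_(i < N) c i * \1_(B i) x) * g x).
  move=> mB.
  have E f : L1 f -> \int[leb]_(x in A) ((\sum_(i < N) c i * \1_(B i) x) * f x) =
      \sum_(i < N) c i * \int[leb]_(x in A `&` B i) f x.
    move=> fi; rewrite (_ : (fun x => _) = fun x => \sum_(i < N) c i * (f x * \1_(B i) x)); last first.
      by apply/funext => x; rewrite mulr_suml; apply: eq_bigr => i _; ring.
    rewrite (@Rint_sum A N (fun i x => c i * (f x * \1_(B i) x)) mA AI) => [|i]; last first.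
      by apply: L1Z; exact: L1_indic.
    by apply: eq_bigr => i _; rewrite (RintZ mA AI); [rewrite Rint_indic|exact: L1_indic].
  rewrite E//; under eq_fun do rewrite E//.
  apply: (cvg_sum_ord (F := U) (f := fun i j => c i * \int[leb]_(x in A `&` B i) gs j x)
    (l := fun i => c i * \int[leb]_(x in A `&` B i) g x)) => i.
  apply: cvgM; first exact: cvg_cst.
  by apply: hg; [exact: measurableI|move=> x [/AI]].
pose gp x := (Num.max (g x) 0)%:E; pose gn x := (Num.max (- g x) 0)%:E.
have mg' := L1_measurable gi'.
have mgp : measurable_fun I gp.
  by apply/measurable_EFinP; apply: measurable_maxr => //; exact: measurable_cst.
have mgn : measurable_fun I gn.
  by apply/measurable_EFinP; apply: measurable_maxr; [exact: measurableT_comp|exact: measurable_cst].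
have gp0 x : I x -> (0 <= gp x)%E by move=> _; rewrite lee_fin le_max lexx orbT.
have gn0 x : I x -> (0 <= gn x)%E by move=> _; rewrite lee_fin le_max lexx orbT.
pose p n := nnsfun_approx mI mgp n; pose q n := nnsfun_approx mI mgn n.
have pc x : I x -> (fun n => p n x) @ \oo --> Num.max (g x) 0.
  by move=> Ix; exact: fine_cvg (cvg_nnsfun_approx mI mgp gp0 Ix).
have qc x : I x -> (fun n => q n x) @ \oo --> Num.max (- g x) 0.
  by move=> Ix; exact: fine_cvg (cvg_nnsfun_approx mI mgn gn0 Ix).
have pl n x : I x -> 0 <= p n x <= Num.max (g x) 0.
  move=> Ix; rewrite fun_ge0 /=; have h := pc x Ix; rewrite -(cvg_lim (@Rhausdorff R) h).
  apply: nondecreasing_cvgn_le; last by apply/cvg_ex; eexists; exact: h.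
  by move=> i j ij; have /lefP := nd_nnsfun_approx mI mgp ij; exact.
have ql n x : I x -> 0 <= q n x <= Num.max (- g x) 0.
  move=> Ix; rewrite fun_ge0 /=; have h := qc x Ix; rewrite -(cvg_lim (@Rhausdorff R) h).
  apply: nondecreasing_cvgn_le; last by apply/cvg_ex; eexists; exact: h.
  by move=> i j ij; have /lefP := nd_nnsfun_approx mI mgn ij; exact.
pose ph n x := p n x - q n x.
have pq n x : I x -> ph n x ^+ 2 <= ph n x * g x.
  move=> Ix; have /andP[p0 pg] := pl n x Ix; have /andP[q0 qg] := ql n x Ix; rewrite /ph.
  have [gx|gx] := leP 0 (g x).
    have gN : - g x <= 0 by rewrite oppr_le0.
    rewrite (max_r gN) in qg; rewrite (max_l gx) in pg.
    have -> : q n x = 0 :> R by apply/eqP; rewrite eq_le qg.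
    by rewrite subr0 expr2 ler_wpM2l.
  have gN : 0 <= - g x by rewrite oppr_ge0 ltW.
  rewrite (max_l gN) in qg; rewrite (max_r (ltW gx)) in pg.
  have -> : p n x = 0 :> R by apply/eqP; rewrite eq_le pg.
  by rewrite sub0r sqrrN mulNr -mulrN expr2 ler_wpM2l.
have mp n : measurable_fun I (p n) by apply: measurable_funTS; exact: measurable_funPT.
have mq n : measurable_fun I (q n) by apply: measurable_funTS; exact: measurable_funPT.
have mph n : measurable_fun I (ph n) by exact: measurable_funB.
have bounded_nn (h : {nnsfun R >-> R}) : exists M : R, forall x, `|h x| <= M.
  by have [M [_ hM]] := simple_bounded h; exists (M + 1) => x; apply: hM => //; rewrite ltrDl.
have mulL n f : L1 f -> L1 (fun x => ph n x * f x).
  move=> fi; have [M1 h1] := bounded_nn (p n); have [M2 h2] := bounded_nn (q n).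
  apply: (L1_le _ (L1Z (M1 + M2) (L1_norm fi))) => [|x _].
    by apply: measurable_funM => //; exact: L1_measurable.
  rewrite normrM; apply: ler_wpM2r; first exact: normr_ge0.
  by apply: (le_trans (ler_normB _ _)); exact: lerD.
have ph2L n : L1 (fun x => ph n x ^+ 2).
  rewrite (_ : (fun x => _) = fun x => ph n x * (ph n x * 1)); last by apply/funext => x; rewrite mulr1 expr2.
  exact: (mulL n _ (mulL n _ (L1_cst 1))).
have ordE (h : {nnsfun R >-> R}) : exists N (c : nat -> R) (B : nat -> set R),
    (forall i, measurable (B i)) /\ forall x, h x = \sum_(i < N) c i * \1_(B i) x.
  set s := fset_set (range h).
  exists (size (finmap.enum_fset s)), (fun i => (nth 0 (finmap.enum_fset s) i)), (fun i => h @^-1` [set (nth 0 (finmap.enum_fset s) i)]); split.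
    by move=> i; exact: measurable_funPTI.
  by move=> x; rewrite (fimfunEord h x).
have phw n : (fun j => \int[leb]_(x in A) (ph n x * gs j x)) @ U --> \int[leb]_(x in A) (ph n x * g x).
  have [N1 [c1 [B1 [m1 e1]]]] := ordE (p n); have [N2 [c2 [B2 [m2 e2]]]] := ordE (q n).
  have mulp f : L1 f -> L1 (fun x => p n x * f x).
    move=> fi; have [M1 h1] := bounded_nn (p n).
    apply: (L1_le _ (L1Z M1 (L1_norm fi))) => [|x _]; first by apply: measurable_funM => //; exact: L1_measurable.
    by rewrite normrM ler_wpM2r.
  have mulq f : L1 f -> L1 (fun x => q n x * f x).
    move=> fi; have [M1 h1] := bounded_nn (q n).
    apply: (L1_le _ (L1Z M1 (L1_norm fi))) => [|x _]; first by apply: measurable_funM => //; exact: L1_measurable.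
    by rewrite normrM ler_wpM2r.
  have E f : L1 f -> \int[leb]_(x in A) (ph n x * f x) =
      \int[leb]_(x in A) ((\sum_(i < N1) c1 i * \1_(B1 i) x) * f x) - \int[leb]_(x in A) ((\sum_(i < N2) c2 i * \1_(B2 i) x) * f x).
    move=> fi; under eq_Rintegral do rewrite /ph mulrBl.
    by rewrite (RintB mA AI (mulp _ fi) (mulq _ fi)); congr (_ - _); apply: eq_Rintegral => x _; rewrite ?e1 ?e2.
  rewrite E//; under eq_fun do rewrite E//.
  by apply: cvgB; exact: ws.
have key n : \int[leb]_(x in A) (ph n x ^+ 2) <= energy A.
  have h1 : (fun j => 2 * \int[leb]_(x in A) (ph n x * gs j x) - \int[leb]_(x in A) (ph n x ^+ 2)) @ U -->
      2 * \int[leb]_(x in A) (ph n x * g x) - \int[leb]_(x in A) (ph n x ^+ 2).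
    by apply: cvgB; [apply: cvgM; [exact: cvg_cst|exact: phw]|exact: cvg_cst].
  have h2 := energyP mA AI.
  have h3 : 2 * \int[leb]_(x in A) (ph n x * g x) - \int[leb]_(x in A) (ph n x ^+ 2) <= energy A.
    apply: (ler_cvg_to h1 h2); apply: nearW => j.
    rewrite -(RintZ mA AI)//; last exact: mulL.
    rewrite -(RintB mA AI)//; last by apply: L1Z; exact: mulL.
    apply: Rint_le => //; first by apply: L1B => //; apply: L1Z; exact: mulL.
    move=> x Ix; apply: (le_trans _ (gd j Ix)); have := sqr_ge0 (gs j x - ph n x); nra.
  have h4 : \int[leb]_(x in A) (ph n x ^+ 2) <= \int[leb]_(x in A) (ph n x * g x).
    by apply: Rint_le => //; [exact: mulL|exact: pq].
  lra.
pose F n x := (ph n x ^+ 2)%:E.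
have phc x : I x -> (fun n => ph n x) @ \oo --> g x.
  move=> Ix; have -> : g x = Num.max (g x) 0 - Num.max (- g x) 0.
    by rewrite maxr_absE maxr_absE !subr0 normrN; field.
  by apply: cvgB; [exact: pc|exact: qc].
have -> : (\int[leb]_(x in A) (g x ^+ 2)%:E = \int[leb]_(x in A) limn_einf (F ^~ x))%E.
  apply: eq_integral => x; rewrite inE => /AI Ix; apply/esym.
  have h : F ^~ x @ \oo --> (g x ^+ 2)%:E.
    by apply: cvg_EFin; [exact: nearW|rewrite /F /comp /=; apply: cvgM; exact: phc].
  by rewrite is_cvg_limn_einfE; [exact/cvg_lim|apply/cvg_ex; eexists; exact: h].
apply: (le_trans (fatou leb mA _ _)).
- by move=> n; apply/measurable_EFinP; apply: measurable_funX; apply: measurable_funS (mph n).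
- by move=> n x _; rewrite lee_fin sqr_ge0.
apply: limn_einf_le_cst => n; rewrite (RintE mA AI)// lee_fin; exact: key.
Qed.

End ultralimits.

End weak_limits.

(** * Structure of limits of bounded energy *)

Section limit_structure.
Context {R : realType}.
Implicit Types (f g u v : R -> R) (p : {poly R}) (x y s t r : R) (m n N : nat).
Local Notation leb := (@lebesgue_measure R).
Local Notation I := (@I01 R).

(** The local values of w define a function c at every point, also off the dense set D. It is
    locally constant, so its derivative is 0 and the mean value theorem replaces a connectedness
    argument. *)
Lemma locally_constant (D : set R) w (a b : R) :
  (forall x y, 0 <= x -> x < y -> y <= 1 -> exists2 t, x < t < y & D t) ->
  0 <= a -> b <= 1 -> a < b ->
  (forall t0, a < t0 < b -> exists c d : R, 0 < d /\ forall t, D t -> `|t - t0| < d -> w t = c) ->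
  exists C : R, forall t, D t -> a < t < b -> w t = C.
Proof.
move=> dD a0 b1 ab hw.
have [c hc] : exists c : R -> R, forall t0, a < t0 < b -> exists2 d : R, 0 < d & forall t, D t -> `|t - t0| < d -> w t = c t0.
  have H t0 : exists c, a < t0 < b -> exists2 d : R, 0 < d & forall t, D t -> `|t - t0| < d -> w t = c.
    have [/hw[c [d [d0 h]]]|//] := boolP (a < t0 < b); first by exists c => _; exists d.
    by exists 0.
  by have [c hc] := choice H; exists c.
have cloc t0 : a < t0 < b -> exists2 d : R, 0 < d & forall h, `|h| < d -> c (t0 + h) = c t0.
  move=> t0ab; have [d d0 hd] := hc t0 t0ab; case/andP: (t0ab) => at0 t0b.
  exists (Num.min d (Num.min (t0 - a) (b - t0))).
    by rewrite !lt_min d0 !subr_gt0 at0.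
  move=> h; rewrite !lt_min => /and3P[h1 h2 h3].
  have hab : a < t0 + h < b.
    by move: h2 h3; rewrite !ltr_norml => /andP[? ?] /andP[? ?]; apply/andP; split; lra.
  have [d' d'0 hd'] := hc _ hab; case/andP: (hab) => ah hb.
  pose r := Num.min (Num.min d' (d - `|h|)) (Num.min (t0 + h - a) (b - (t0 + h))).
  have r0 : 0 < r by rewrite !lt_min d'0 !subr_gt0 h1 ah hb.
  have : r <= Num.min (t0 + h - a) (b - (t0 + h)) by rewrite /r ge_min lexx orbT.
  have : r <= Num.min d' (d - `|h|) by rewrite /r ge_min lexx.
  rewrite !le_min => /andP[r1 r2] /andP[r3 r4].
  have [t /andP[t1 t2] Dt] := dD (t0 + h - r) (t0 + h + r) ltac:(lra) ltac:(lra) ltac:(lra).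
  have tr : `|t - (t0 + h)| < r by rewrite ltr_norml; apply/andP; split; lra.
  rewrite -(hd' t Dt (lt_le_trans tr r1)) (hd t Dt)//.
  have -> : t - t0 = (t - (t0 + h)) + h by ring.
  by apply: (le_lt_trans (ler_normD _ _)); lra.
have dc t0 : a < t0 < b -> is_derive t0 (1 : R) c 0.
  move=> /cloc[d d0 hd]; apply/is_deriveP => e e0; exists d => // h /hd ->.
  by rewrite subrr mul0r subr0 normr0 mulr_ge0// ltW.
have cst x y : a < x -> x < y -> y < b -> c x = c y.
  move=> ax xy yb; have [||z _] := @MVT R c (fun=> 0) x y xy.
  - by move=> z; rewrite in_itv /= => /andP[xz zy]; apply: dc; apply/andP; split; lra.
  - apply: derivable_within_continuous => z; rewrite in_itv /= => /andP[xz zy].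
    by have [] := dc z ltac:(apply/andP; split; lra).
  by rewrite mul0r => /eqP; rewrite subr_eq0 => /eqP.
exists (c ((a + b) / 2)) => t Dt tab; have [d d0 /(_ t Dt)] := hc t tab.
rewrite subrr normr0 => /(_ d0) ->; case/andP: tab => at_ tb.
have [h|h|<-//] := ltgtP t ((a + b) / 2).
- by apply: cst => //; lra.
- by apply/esym; apply: cst => //; lra.
Qed.

Lemma seq_gap (s : seq R) (a : R) : exists2 d : R, 0 < d & forall b, b \in s -> b != a -> d <= `|b - a|.
Proof.
elim: s => [|c s [d d0 hd]]; first by exists 1.
have [->|ca] := eqVneq c a.
  by exists d => // b; rewrite inE => /predU1P[->|/hd//]; rewrite eqxx.
exists (Num.min d `|c - a|); first by rewrite lt_min d0 normr_gt0 subr_eq0.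
by move=> b; rewrite inE ge_min => /predU1P[->|/hd h /h ->//]; rewrite lexx orbT.
Qed.

(** Induction on the exceptional points: w has constant values l and r on the two sides of a, and
    subtracting [r - l] times the step at a makes a regular. *)
Lemma step_function (D : set R) :
  (forall x y, 0 <= x -> x < y -> y <= 1 -> exists2 t, x < t < y & D t) -> D `<=` I ->
  forall (s : seq R) w, uniq s -> (forall a, a \in s -> I a /\ ~ D a) ->
  (forall t0, I t0 -> t0 \notin s -> exists c d : R, 0 < d /\ forall t, D t -> `|t - t0| < d -> w t = c) ->
  exists (C : R) (z : R -> R), forall t, D t -> w t = C + \sum_(a <- s) z a * (a < t)%R%:R.
Proof.
move=> dD DI; elim=> [|a s IH] w /= us sI hw.
  have [C hC] := locally_constant dD (lexx 0) (lexx 1) ltr01 (fun t0 h => hw t0 ((I01E _).2 h) isT).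
  by exists C, (fun=> 0) => t Dt; rewrite big_nil addr0 hC//; apply/I01E/DI.
case/andP: us => as_ us; have [Ia Da] := sI a ltac:(by rewrite inE eqxx).
have [d0 d00 hd0] := seq_gap s a; have /I01E/andP[a0 a1] := Ia.
pose d := Num.min d0 (Num.min a (1 - a)).
have dd : 0 < d by rewrite !lt_min d00 a0 subr_gt0.
have : d <= Num.min d0 (Num.min a (1 - a)) by [].
rewrite !le_min => /and3P[dl da d1].
have loc t0 : 0 < `|t0 - a| < d -> exists c e : R, 0 < e /\ forall t, D t -> `|t - t0| < e -> w t = c.
  move=> /andP[h1 h2]; apply: hw.
    apply/I01E; move: h2; rewrite ltr_norml => /andP[? ?]; apply/andP; split; lra.
  have ta : t0 != a by move: h1; rewrite normr_gt0 subr_eq0.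
  rewrite inE negb_or ta /=; apply/negP => /hd0/(_ ta) h.
  by move: (lt_le_trans h2 (le_trans dl h)); rewrite ltxx.
have [l hl] : exists l : R, forall t, D t -> a - d < t < a -> w t = l.
  apply: (locally_constant dD); [lra|lra|lra|].
  move=> t0 /andP[h1 h2]; apply: loc; rewrite normr_gt0 subr_eq0 lt_eqF//=.
  by rewrite ltr_norml; apply/andP; split; lra.
have [r hr] : exists r : R, forall t, D t -> a < t < a + d -> w t = r.
  apply: (locally_constant dD); [lra|lra|lra|].
  move=> t0 /andP[h1 h2]; apply: loc; rewrite normr_gt0 subr_eq0 gt_eqF//=.
  by rewrite ltr_norml; apply/andP; split; lra.
pose w' t := w t - (r - l) * (a < t)%R%:R.
have [||C [z hz]] := IH w' us.
- by move=> b bs; apply: sI; rewrite inE bs orbT.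
- move=> t0 It0 t0s; have [->|t0a] := eqVneq t0 a.
    exists l, d; split=> // t Dt; rewrite /w' ltr_norml => /andP[h1 h2].
    have [ta|ta|ta] := ltgtP a t; last by case: Da; rewrite ta.
      by rewrite (hr t Dt) ?mulr1 ?ta /=; [ring|lra].
    by rewrite (hl t Dt) ?mulr0 ?subr0// ta; lra.
  have [|c [e [e0 he]]] := hw t0 It0; first by rewrite inE negb_or t0a.
  exists (c - (r - l) * (a < t0)%R%:R), (Num.min e `|t0 - a|); split.
    by rewrite lt_min e0 normr_gt0 subr_eq0.
  move=> t Dt; rewrite lt_min => /andP[h1 h2]; rewrite /w' (he t Dt h1); congr (_ - _ * _%:R).
  move: h2; have [ha|ha] := ltP a t0.
    rewrite (gtr0_norm (_ : 0 < t0 - a)) ?subr_gt0// ltr_norml => /andP[h _].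
    by have -> : a < t by lra.
  rewrite (ler0_norm (_ : t0 - a <= 0)) ?subr_le0// ltr_norml => /andP[_ h].
  by have -> : (a < t) = false by apply/negbTE; rewrite -leNgt; lra.
exists C, (fun x => if x == a then r - l else z x) => t Dt.
have := hz t Dt; rewrite /w' => /eqP; rewrite subr_eq => /eqP ->.
rewrite big_cons eqxx -addrA; congr (_ + _); rewrite addrC; congr (_ + _).
by apply: eq_big_seq => b bs; case: eqP => // ba; rewrite -ba bs in as_.
Qed.

Lemma seq_spread (s : seq R) : uniq s -> (forall a, a \in s -> I a) ->
  exists2 r : R, 0 < r & (forall b, b \in s -> r <= b /\ b <= 1 - r) /\ pairwise (fun a b => 2 * r <= `|a - b|) s.
Proof.
elim: s => [|a s IH] /=; first by exists 1.
case/andP=> as_ us sI; have [r r0 [hr ps]] := IH us (fun b bs => sI b ltac:(by rewrite inE bs orbT)).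
have [d d0 hd] := seq_gap s a; have /I01E/andP[a0 a1] := sI a ltac:(by rewrite inE eqxx).
pose r' := Num.min (Num.min r (d / 2)) (Num.min a (1 - a)).
have r'0 : 0 < r' by rewrite !lt_min r0 divr_gt0//= a0 subr_gt0.
have : r' <= Num.min (Num.min r (d / 2)) (Num.min a (1 - a)) by [].
rewrite !le_min => /andP[/andP[h1 h2] /andP[h3 h4]].
exists r' => //; split=> [b|].
  by rewrite inE => /predU1P[->|/hr[? ?]]; split; lra.
apply/andP; split; last by apply: sub_pairwise ps => x y; apply: le_trans; lra.
apply/allP => b bs; rewrite distrC; apply: (le_trans _ (hd b bs _)); first lra.
by apply: contraNneq as_ => <-.
Qed.

Lemma midpoint_between x y : 0 <= x -> x < y -> 0 <= (x + y) / 2 < y /\ x < (x + y) / 2.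
Proof. by move=> x0 xy; split; [apply/andP; split|]; lra. Qed.

(** The compactness argument in terms of gradients [gs], densities [ds] and values [Ps] only. Where
    the limit energy near a point is below mu, the estimate on increments passes to the limit and
    [u - prim g] is constant near that point. Elsewhere at least mu is concentrated, which both
    counts the jumps and pays for them. *)
Lemma liminf_core (mu E : R) (u : R -> R) (gs ds Ps : nat -> R -> R) : 0 < mu ->
  (forall j, measurable_fun I (gs j)) -> (forall j, L1 (ds j)) ->
  (forall j t, I t -> gs j t ^+ 2 <= ds j t) -> (forall j, \int[leb]_(t in I) ds j t <= E) ->
  {ae leb, forall t, I t -> (fun j => Ps j t) @ \oo --> u t} ->
  (forall a b be d e : R, 0 <= a -> b <= 1 -> 0 <= be < mu -> 0 < d -> 0 < e ->
    \forall j \near \oo, \int[leb]_(x in `]a, b[) ds j x <= be ->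
      forall s t, a + d <= s -> s <= t -> t <= b - d ->
      `|Ps j t - Ps j s - \int[leb]_(x in `]s, t[) gs j x| <= e) ->
  exists (C : R) g (s : seq R) (z : R -> R),
  [/\ L2 g, uniq s, (forall a, a \in s -> I a),
     {ae leb, forall t, I t -> u t = C + prim g t + \sum_(a <- s) z a * (a < t)%R%:R} &
     (\int[leb]_(t in I) (g t ^+ 2)%:E + (mu * (size s)%:R)%:E <= E%:E)%E].
Proof.
move=> mu0 mg di gd dE PU est; have mI : measurable I by exact: measurable_I01.
have [U [UU UN]] : exists U, UltraFilter U /\ (\oo : set_system nat) `<=` U by apply: ultraFilterLemma.
have [g gi hg] := weak_limit UU mg di gd dE.
have lsc (A : set R) : measurable A -> A `<=` I -> (\int[leb]_(x in A) (g x ^+ 2)%:E <= (energy U ds A)%:E)%E.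
  by move=> mA AI; exact: (weak_lsc UU mg di gd dE).
have eP (A : set R) : measurable A -> A `<=` I -> (fun j => \int[leb]_(x in A) ds j x) @ U --> energy U ds A.
  by move=> mA AI; exact: (energyP UU di gd dE).
have eU (A B : set R) : measurable A -> measurable B -> A `<=` I -> B `<=` I ->
    A `&` B = set0 -> energy U ds (A `|` B) = energy U ds A + energy U ds B.
  exact: (energyU UU di gd dE).
set m := energy U ds in lsc eP eU.
have L2g : L2 g by split; [exact: L1_measurable|apply: le_lt_trans (lsc I mI _) (ltry _)].
have g2i : L1 (fun x => g x ^+ 2).
  apply/integrableP; split; first by apply/measurable_EFinP; apply: measurable_funX; exact: L1_measurable.
  apply: le_lt_trans L2g.2; rewrite le_eqVlt; apply/orP; left; apply/eqP.
  by apply: eq_integral => x _; rewrite /= ger0_norm// sqr_ge0.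
have lscR (A : set R) : measurable A -> A `<=` I -> \int[leb]_(x in A) (g x ^+ 2) <= m A.
  by move=> mA AI; rewrite -lee_fin -(RintE mA AI g2i); exact: lsc.
have mI_E : m I <= E.
  have h1 := eP I mI (@subset_refl _ I).
  have h2 : (fun _ : nat => E) @ U --> E by exact: cvg_cst.
  by apply: (ler_cvg_to h1 h2); apply: nearW.
have m_ge0 A : measurable A -> A `<=` I -> 0 <= m A.
  by move=> mA AI; apply: (le_trans _ (lscR A mA AI)); apply: Rintegral_ge0 => x _; exact: sqr_ge0.
have mle (A B : set R) : measurable A -> measurable B -> A `<=` B -> B `<=` I -> m A <= m B.
  move=> mA mB AB BI; have mBA : measurable (B `\` A) by exact: measurableD.
  have BAI : B `\` A `<=` I by move=> x [/BI].
  have -> : B = A `|` (B `\` A) by rewrite setDUK.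
  rewrite eU//; [by rewrite lerDl m_ge0|exact: subset_trans BI|by rewrite setDIK].
pose bad a := I a /\ forall d : R, 0 < d -> mu <= m (`]a - d, a + d[%classic `&` I).
(* A small interval cut out around one bad point keeps energy at least mu, while its share of the
   integral of [g ^+ 2] is at most an arbitrary e. The rest of the set is handled by induction, the
   other points being far enough away. *)
have bad_sum (r : R) : 0 < r -> forall (s : seq R) (A : set R), measurable A -> A `<=` I ->
   (forall b, b \in s -> bad b /\ `]b - r, b + r[%classic `<=` A) ->
   pairwise (fun a b => 2 * r <= `|a - b|) s ->
   mu * (size s)%:R + \int[leb]_(x in A) (g x ^+ 2) <= m A.
  move=> r0; elim=> [|a s IH] A mA AI hs /=; first by rewrite mulr0 add0r lscR.
  case/andP => /allP as_ ps; apply/ler_addgt0Pr => e e0.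
  have [[Ia bada] aA] := hs a ltac:(by rewrite inE eqxx).
  have /I01E/andP[a0 a1] := Ia.
  have e2 : 0 < e / 2 by rewrite divr_gt0.
  have cpr : continuous (prim (fun x => g x ^+ 2)) := prim_continuous g2i.
  have /cvgrPdist_le/(_ _ e2)/nbhs_ballP[d0 /= d00 hd0] := cpr a.
  pose d := Num.min (d0 / 2) (Num.min r (Num.min a (1 - a))).
  have d_gt0 : 0 < d by rewrite !lt_min divr_gt0// r0 a0 subr_gt0.
  have : d <= Num.min (d0 / 2) (Num.min r (Num.min a (1 - a))) by [].
  rewrite !le_min => /and4P[dd0 dr da d1]; clearbody d.
  pose B : set R := `]a - d, a + d[%classic.
  have mB : measurable B by exact: measurable_itv.
  have BA : B `<=` A by apply: subset_trans aA; apply: subset_itv; rewrite bnd_simp; lra.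
  have BI : B `<=` I by exact: subset_trans AI.
  have mAB : measurable (A `\` B) by exact: measurableD.
  have ABI : A `\` B `<=` I by move=> x [/AI].
  have AE : A = B `|` (A `\` B) by rewrite setDUK.
  have mBmu : mu <= m B.
    by have := bada d d_gt0; rewrite -/B (setIidl BI).
  have IHs : mu * (size s)%:R + \int[leb]_(x in A `\` B) (g x ^+ 2) <= m (A `\` B).
    apply: (IH _ mAB ABI _ ps) => b bs; have [bb bA] := hs b ltac:(by rewrite inE bs orbT); split=> //.
    move=> y yb; split; first exact: bA.
    move=> ya; have := as_ b bs; move: yb ya; rewrite /B /= !in_itv /= => /andP[y1 y2] /andP[y3 y4].
    apply/negP; rewrite -ltNge ltr_norml; move: y1 y2 y3 y4 dr; clear => *.
    by apply/andP; split; lra.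
  have gB : \int[leb]_(x in B) (g x ^+ 2) <= e.
    rewrite -(primB g2i); [|by move: da; clear; lra|by move: d_gt0; clear; lra|by move: d1; clear; lra].
    have h1 := hd0 (a + d) ltac:(by rewrite /ball /= opprD addNKr normrN gtr0_norm//; move: dd0 d00; clear; lra).
    have h2 := hd0 (a - d) ltac:(by rewrite /ball /= opprB addrC subrK gtr0_norm//; move: dd0 d00; clear; lra).
    by move: h1 h2; rewrite !ler_norml; clear => /andP[? ?] /andP[? ?]; lra.
  have -> : \int[leb]_(x in A) (g x ^+ 2) = \int[leb]_(x in B) (g x ^+ 2) + \int[leb]_(x in A `\` B) (g x ^+ 2).
    by rewrite {1}AE Rint_setU//; rewrite setDIK.
  have -> : m A = m B + m (A `\` B) by rewrite {1}AE eU//; rewrite setDIK.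
  by rewrite -natr1; move: mBmu IHs gB; clear; lra.
have bad_count (s : seq R) : uniq s -> (forall a, a \in s -> bad a) -> mu * (size s)%:R + \int[leb]_(x in I) (g x ^+ 2) <= E.
  move=> us sb; have [r r0 [hr ps]] := seq_spread us (fun a as_ => (sb a as_).1).
  apply: le_trans mI_E; apply: (bad_sum r) => // b bs; split; first exact: sb.
  by have [? ?] := hr b bs; apply: suboo_I01; lra.
have [s [us sb smax]] : exists s : seq R, [/\ uniq s, forall a, a \in s -> bad a & forall a, bad a -> a \in s].
  (* Each bad point costs mu, so lists of bad points have bounded length, and one of maximal length
     contains them all. *)
  pose Q n := `[< exists s : seq R, [/\ uniq s, forall a, a \in s -> bad a & size s = n] >].
  have Q0 : exists n, Q n by exists 0%N; apply/asboolP; exists [::].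
  have QM n : Q n -> (n <= Num.truncn (E / mu))%N.
    move=> /asboolP[s [us sb <-]]; rewrite truncn_ge_nat; last first.
      by rewrite divr_ge0// ?(ltW mu0)//; apply: le_trans mI_E; exact: m_ge0.
    rewrite ler_pdivlMr// mulrC; apply: (le_trans _ (bad_count s us sb)).
    by rewrite lerDl; apply: Rintegral_ge0 => x _; exact: sqr_ge0.
  case: (ex_maxnP Q0 QM) => n /asboolP[s [us sb sn]] nmax; exists s; split=> // a ba.
  apply: contraT => as_; have /nmax : Q n.+1.
    apply/asboolP; exists (a :: s); split; [by rewrite /= as_ us| |by rewrite /= sn].
    by move=> b; rewrite inE => /predU1P[->|/sb].
  by rewrite ltnn.
(* Points of convergence that are not bad: a set of full measure, hence dense. *)
pose D : set R := [set t | [/\ I t, (fun j => Ps j t) @ \oo --> u t & t \notin s]].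
have DI : D `<=` I by move=> t [].
have Dae : {ae leb, forall t, I t -> D t}.
  have : {ae leb, forall t, t \notin s}.
    exists [set` s]; split.
    - have : countable [set` s] by apply: finite_set_countable; exact: finite_seq.
      by apply: countable_measurable.
    - by apply: countable_lebesgue_measure0; exact/finite_set_countable/finite_seq.
    - by move=> t /= /negP; rewrite negbK.
  by move=> h; apply: aeS (aeI h PU) => t [ts Pt] It; split=> //; exact: Pt.
have Ddense x y : 0 <= x -> x < y -> y <= 1 -> exists2 t, x < t < y & D t.
  move=> x0 xy y1; apply: contrapT => nD.
  have [N [mN N0 hN]] := Dae.
  have sub : `]x, y[%classic `<=` N.
    move=> t txy; apply: hN => /= h; apply: nD; exists t; first by move: txy; rewrite /= in_itv.
    by apply: h; exact: (suboo_I01 x0 y1).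
  have : (leb `]x, y[%classic <= leb N)%E by apply: le_measure; rewrite ?inE//; exact: measurable_itv.
  by rewrite [X in (X <= _)%E](leb_oo (ltW xy)) N0 lee_fin; lra.
pose w t := u t - prim g t.
have wloc t0 : I t0 -> t0 \notin s -> exists c d : R, 0 < d /\ forall t, D t -> `|t - t0| < d -> w t = c.
  move=> It0 t0s; have : ~ bad t0 by move=> /smax; apply/negP.
  move=> /not_andP[//|] /existsNP[d /not_implyP[d0 /negP]]; rewrite -ltNge => mlt.
  have /I01E/andP[t00 t01] := It0.
  pose d' := Num.min d (Num.min t0 (1 - t0)).
  have d'0 : 0 < d' by rewrite !lt_min d0 t00 subr_gt0.
  have : d' <= Num.min d (Num.min t0 (1 - t0)) by [].
  rewrite !le_min => /and3P[dd dt0 dt1]; clearbody d'.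
  pose a := t0 - d'; pose b := t0 + d'.
  have a0 : 0 <= a by rewrite /a; lra.
  have b1 : b <= 1 by rewrite /b; lra.
  have mab : measurable (`]a, b[%classic : set R) by exact: measurable_itv.
  have abI := suboo_I01 a0 b1.
  have mablt : m `]a, b[%classic < mu.
    apply: le_lt_trans mlt; apply: mle; [exact: mab|by apply: measurableI| |by move=> x []].
    by move=> x xab; split; [apply: subset_itv xab; rewrite bnd_simp /a /b; lra|exact: abI].
  have m0 := m_ge0 _ mab abI.
  (* Strictly between the limit energy and mu: the energies on []a, b[] are at most [be] on a set of
     the ultrafilter, and the estimate on increments is available. *)
  pose be := (m `]a, b[%classic + mu) / 2.
  have [be0 mbe] : 0 <= be < mu /\ m `]a, b[%classic < be.
    by apply: midpoint_between.
  have ebe : \forall j \near U, \int[leb]_(x in `]a, b[) ds j x <= be by exact: (cvgr_le _ (eP _ mab abI) _ mbe).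
  pose d2 := d' / 2; have d20 : 0 < d2 by rewrite divr_gt0.
  have pair x y : D x -> D y -> x <= y -> t0 - d2 < x -> y < t0 + d2 -> w x = w y.
    move=> [Ix Px _] [Iy Py _] xy x1 y1.
    have x0 : 0 <= x by move/I01E: Ix => /andP[/ltW].
    have y1' : y <= 1 by move/I01E: Iy => /andP[_ /ltW].
    have mxy : measurable (`]x, y[%classic : set R) by exact: measurable_itv.
    have key : `|u y - u x - \int[leb]_(z in `]x, y[) g z| <= 0.
      apply/ler_addgt0Pr => e e0; rewrite add0r.
      have h1 : (fun j => `|Ps j y - Ps j x - \int[leb]_(z in `]x, y[) gs j z|) @ U -->
          `|u y - u x - \int[leb]_(z in `]x, y[) g z|.
        apply: cvg_norm; apply: cvgB; last exact: hg mxy (suboo_I01 x0 y1').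
        by apply: cvgB; [exact: cvg_trans (cvg_app _ UN) Py|exact: cvg_trans (cvg_app _ UN) Px].
      have h2 : (fun _ : nat => e) @ U --> e by exact: cvg_cst.
      apply: (ler_cvg_to h1 h2).
      have hU := UN _ (est _ _ _ _ _ a0 b1 be0 d20 e0).
      have PU' : ProperFilter U by exact: ultra_proper.
      have hI := @filterI _ U PU' _ _ ebe hU; apply: (@filterS _ U PU' _ _ _ hI) => j [hj hest].
      by apply: hest => //; move: x1 y1; rewrite /a /b /d2; clear; lra.
    move: key; rewrite normr_le0 subr_eq0 -(primB gi x0 xy y1') /w => /eqP; clear; lra.
  have [c Dc /andP[c1 c2]] : exists2 c, D c & t0 - d2 < c < t0 + d2.
    have [q1 q2 q3] : [/\ 0 <= t0 - d2, t0 - d2 < t0 + d2 & t0 + d2 <= 1].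
      by move: dt0 dt1 d'0; rewrite /d2; clear => *; split; lra.
    by have [c ? ?] := Ddense _ _ q1 q2 q3; exists c.
  exists (w c), d2; split=> // t Dt; rewrite ltr_norml => /andP[h1 h2].
  have [tc|/ltW ct] := leP t c; first by apply: pair => //; move: h1 h2 c1 c2; clear; lra.
  by apply/esym; apply: pair => //; move: h1 h2 c1 c2; clear; lra.
have [C [z hz]] := step_function Ddense DI us (fun a as_ => conj (sb a as_).1 (fun Da : D a => let: And3 _ _ h := Da in negP h as_)) wloc.
exists C, g, s, z; split=> //.
- by move=> a /sb[].
- apply: aeS Dae => t h /h Dt; have := hz t Dt; rewrite /w; lra.
- rewrite (RintE mI (@subset_refl _ I) g2i) -EFinD lee_fin addrC; exact: bad_count.
Qed.

End limit_structure.

(** * From the lower limit of the functionals to the structure of the limit *)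

Section sublevels.
Context {R : realType}.
Implicit Types (f g u v : R -> R) (p : {poly R}) (x y s t r : R) (m n N : nat).
Local Notation leb := (@lebesgue_measure R).
Local Notation I := (@I01 R).

Lemma limn_einf_lt_freq (x : nat -> \bar R) (c : \bar R) N : (limn_einf x < c)%E ->
  exists2 k, (N <= k)%N & (x k < c)%E.
Proof.
rewrite limn_einf_lim => h.
have : (einfs x N < c)%E.
  apply: le_lt_trans h; rewrite (cvg_lim (@ereal_hausdorff R) (@cvg_einfs_sup R x)).
  by apply: ereal_sup_ubound; exists N.
by move=> /ereal_inf_lt[_ [k Nk <-] xk]; exists k.
Qed.

(** Borel-Cantelli: the exceptional sets have summable measures, so almost every t lies in finitely
    many of them. *)
Lemma ae_subsequence u (w : nat -> R -> R) : L0 u -> (forall j, L0 (w j)) ->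
  (forall j, (leb (I `&` [set t | (2^-1 ^+ j <= `|w j t - u t|)%R]) <= (2^-1 ^+ j)%:E)%E) ->
  {ae leb, forall t, I t -> (fun j => w j t) @ \oo --> u t}.
Proof.
move=> mu_ mw hA; have mI : measurable I by exact: measurable_I01.
set A := fun j => I `&` [set t | 2^-1 ^+ j <= `|w j t - u t|].
have mA j : measurable (A j).
  have mf : measurable_fun I (fun t => `|w j t - u t|).
    by apply: measurableT_comp => //; apply: measurable_funB; [exact: mw|exact: mu_].
  have := mf mI `[2^-1 ^+ j, +oo[%classic (measurable_itv _).
  by congr (measurable _); apply/seteqP; split => t [It h]; split=> //; move: h; rewrite /= in_itv /= andbT.
have A0 : leb (lim_sup_set A) = 0%E.
  apply: lim_sup_set_cvg0 => //.
  apply: (@le_lt_trans _ _ (\sum_(0 <= j <oo) (2^-1 ^+ j)%:E)%E).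
    by apply: lee_nneseries => // j _; exact: hA.
  have h : (fun n => (\sum_(0 <= j < n) (2^-1 ^+ j)%:E)%E) @ \oo --> (1 / (1 - 2^-1) : R)%:E.
    apply: cvg_EFin; first by apply: nearW => n; rewrite sumEFin.
    have := @cvg_geometric_series R 1 2^-1 ltac:(by rewrite gtr0_norm ?invr_gt0// invf_lt1// ltr1n).
    rewrite (_ : fine \o _ = series (geometric 1 2^-1))//.
    apply/funext => n; rewrite /= sumEFin /= /series /=.
    by apply: eq_bigr => i _; rewrite /geometric /= mul1r.
  by rewrite (cvg_lim (@ereal_hausdorff R) h) ltry.
exists (lim_sup_set A); split=> //.
  by apply: bigcap_measurableType => // n _; apply: bigcup_measurable => k _; exact: mA.
move=> t; apply: contra_notP => nA It; move: nA.
rewrite /lim_sup_set => /existsNP[N /not_implyP[_ hN]].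
have cv : (fun j => 2^-1 ^+ j : R) @ \oo --> (0 : R).
  by apply: cvg_expr; rewrite gtr0_norm ?invr_gt0// invf_lt1// ltr1n.
apply/cvgrPdist_le => e e0; move/cvgrPdist_le: cv => /(_ e e0)[M _ hM].
exists (maxn N M) => // j; rewrite /= geq_max => /andP[Nj Mj].
have := hM j Mj; rewrite /= sub0r normrN => h; rewrite distrC; apply: (le_trans _ (le_trans (ler_norm _) h)).
by rewrite leNgt; apply/negP => /ltW h2; apply: hN; exists j.
Qed.

(** Verifies the assumptions of [liminf_core] along a subsequence. The inequality with E is strict
    so that infinitely many terms have energy below E. *)
Lemma liminf_structure (mu : R) (eps : nat -> R) u (v : nat -> R -> R) (E : R) : 0 < mu ->
  (forall n, 0 < eps n /\ ((4 <= n)%N -> eps n <= n%:R^-1 /\ admissible_eps mu n (eps n))) ->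
  L0 u -> (forall k, L0 (v k)) -> cvg_in_measure v u ->
  (limn_einf (fun k => Phi eps (ck mu) k (v k)) < E%:E)%E ->
  exists (C : R) g (s : seq R) (z : R -> R),
  [/\ L2 g, uniq s, (forall a, a \in s -> I a),
     {ae leb, forall t, I t -> u t = C + prim g t + \sum_(a <- s) z a * (a < t)%R%:R} &
     (\int[leb]_(t in I) (g t ^+ 2)%:E + (mu * (size s)%:R)%:E <= E%:E)%E].
Proof.
move=> mu0 epsP Lu Lv vu Elt; have mI : measurable I by exact: measurable_I01.
(* One index serves all purposes: energy below E, the range [4 <= k] of the estimates, and summable
   exceptional sets. *)
have sel j : exists k, [/\ (j <= k)%N, (4 <= k)%N, (Phi eps (ck mu) k (v k) < E%:E)%E &
    (leb (I `&` [set t | (2^-1 ^+ j <= `|v k t - u t|)%R]) <= (2^-1 ^+ j)%:E)%E].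
  have p0 : 0 < 2^-1 ^+ j :> R by rewrite exprn_gt0// invr_gt0.
  have /fine_cvgP[hf] := vu (2^-1 ^+ j) p0.
  move=> /cvgrPdist_le/(_ _ p0) hc; have [M _ hM] := filterI hf hc.
  have [k] := limn_einf_lt_freq (maxn 4 (maxn j M)) Elt; rewrite !geq_max => /and3P[k4 kj kM] hk.
  exists k; split=> //; have [h1 h2] := hM k kM.
  rewrite -(fineK h1) lee_fin; move: h2; rewrite /= sub0r normrN; apply: le_trans; exact: ler_norm.
have [k kP] := choice sel.
have sob j : sobolevH (k j) (v (k j)) /\ (\int[leb]_(t in I) (density eps (ck mu) (k j) (v (k j)) t)%:E < E%:E)%E.
  by have [_ _ + _] := kP j; rewrite /Phi; case: asboolP.
have est j : exists P : R -> R, continuous P /\ {ae leb, forall t, I t -> v (k j) t = P t} /\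
  forall a b be s t : R, 0 <= a -> b <= 1 -> 0 <= be <= mu -> 0 <= flat_error mu (k j) be ->
    (\int[leb]_(x in `]a, b[) (density eps (ck mu) (k j) (v (k j)) x)%:E <= be%:E)%E ->
    a + window mu (eps (k j)) < s -> s <= t -> t < b - window mu (eps (k j)) ->
    `|P t - P s - \int[leb]_(x in `]s, t[) truncgrad (eps (k j)) (weak_derivative 1 (v (k j))) x| <= be * flat_error mu (k j) be.
  have [_ k4 _ _] := kP j; have [e0 /(_ k4)[_ adm]] := epsP (k j).
  by have [P [h1 h2 h3]] := lower_estimate mu0 e0 k4 adm (sob j).1; exists P.
have [Ps PsP] := choice est.
have kpos j : (0 < k j)%N by have [_ k4 _ _] := kP j; exact: leq_trans k4.
have mwd j i : (i <= k j)%N -> measurable_fun I (weak_derivative i (v (k j))).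
  by move=> ij; have [_ []] := weak_derivativeP (sob j).1 ij.
have ck0 j : 0 < ck mu (k j) * eps (k j) ^+ (2 * k j - 1).
  by rewrite mulr_gt0 ?ck_gt0// exprn_gt0//; have [] := epsP (k j).
have d0 j t : 0 <= density eps (ck mu) (k j) (v (k j)) t.
  rewrite /density addr_ge0//; last by rewrite mulr_ge0 ?sqr_ge0// ltW.
  by rewrite le_min sqr_ge0 divr_ge0// ltW//; have [] := epsP (k j).
have di j : L1 (density eps (ck mu) (k j) (v (k j))).
  apply/integrableP; split.
    apply/measurable_EFinP; apply: measurable_funD.
      by apply: measurable_minr; [apply: measurable_funX; exact: mwd|exact: measurable_cst].
    by apply: measurable_funM; [exact: measurable_cst|apply: measurable_funX; exact: mwd].
  apply: le_lt_trans (lt_trans (sob j).2 (ltry _)); rewrite le_eqVlt; apply/orP; left; apply/eqP.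
  by apply: eq_integral => t _; rewrite /= ger0_norm.
apply: (@liminf_core R mu E u (fun j => truncgrad (eps (k j)) (weak_derivative 1 (v (k j))))
  (fun j => density eps (ck mu) (k j) (v (k j))) Ps) => //.
- by move=> j; apply: measurable_truncgrad; exact: mwd.
- move=> j t It; rewrite /density /truncgrad div1r.
  have h : 0 <= ck mu (k j) * eps (k j) ^+ (2 * k j - 1) * weak_derivative (k j) (v (k j)) t ^+ 2.
    by rewrite mulr_ge0 ?sqr_ge0// ltW.
  case: ifPn => [hle|_]; first by rewrite min_l// lerDl.
  by rewrite expr0n /=; have := d0 j t; rewrite /density div1r.
- move=> j; rewrite -lee_fin -(RintE mI (@subset_refl _ I) (di j)); exact: ltW (sob j).2.
- have h1 : {ae leb, forall t, forall j, I t -> v (k j) t = Ps j t}.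
    by apply/ae_foralln => j; have [_ []] := PsP j.
  have h2 : {ae leb, forall t, I t -> (fun j => v (k j) t) @ \oo --> u t}.
    by apply: ae_subsequence => // j; have [] := kP j.
  apply: aeS (aeI h1 h2) => t [e h] It; have := h It.
  by rewrite (_ : (fun j => v (k j) t) = fun j => Ps j t)//; apply/funext => j; exact: e.
- move=> a b be d e a0 b1 /andP[be0 bemu] dd e0.
  (* The error on increments is [be * flat_error]; the added 1 covers [be = 0]. *)
  have e'0 : 0 < e / (be + 1) by rewrite divr_gt0// ltr_wpDl.
  have [N1 hN1] := flat_error_small mu0 (introT andP (conj be0 bemu)) e'0.
  have d2 : 0 < d / 2 by rewrite divr_gt0.
  (* Makes the window at most [d / 2], so that the strict inequalities of the local estimate follow
     from [a + d <= s] and [t <= b - d]. *)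
  have [N2 hN2] := inv_nat_small (2 * mu + 2) d2.
  exists (maxn N1 N2) => // j; rewrite /= geq_max => /andP[jN1 jN2] hE s t h1 h2 h3.
  have [jk k4 _ _] := kP j; have [_ [_ hP]] := PsP j.
  have /andP[f0 fe] := hN1 (k j) (leq_trans jN1 jk).
  have [ep /(_ k4)[epn _]] := epsP (k j).
  have wd : window mu (eps (k j)) <= d / 2.
    apply: (le_trans _ (hN2 (k j) (leq_trans jN2 jk))); rewrite /window mulrC ler_wpM2l//.
    by rewrite addr_ge0// mulr_ge0// ltW.
  apply: (le_trans (hP a b be s t a0 b1 _ f0 _ _ h2 _)).
  + by rewrite be0 ltW.
  + by have -> := RintE (measurable_itv `]a, b[) (suboo_I01 a0 b1) (di j).
  + by apply: lt_le_trans h1; rewrite ltrD2l; lra.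
  + by apply: (le_lt_trans h3); rewrite ltrD2l ltrN2; lra.
  + apply: (@le_trans _ _ (be * (e / (be + 1)))); first by rewrite ler_wpM2l.
    by rewrite mulrCA ger_pMr// ler_pdivrMr ?ltr_wpDl// mul1r lerDl.
Qed.

End sublevels.

(** * Primitives plus step functions *)

Section charges_and_limits.
Context {R : realType}.
Implicit Types (f g u v : R -> R) (p : {poly R}) (x y s t r : R) (m n N : nat).
Local Notation leb := (@lebesgue_measure R).
Local Notation I := (@I01 R).

(** Valid for arbitrary sets because [leb] is an outer measure; the sets that define approximate
    limits need not be measurable. *)
Lemma leb_subset (A B : set R) : A `<=` B -> (leb A <= leb B)%E.
Proof. by move=> AB; rewrite /lebesgue_measure /lebesgue_stieltjes_measure /measure_extension; exact: le_outer_measure. Qed.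

Lemma leb_subadd (A B : set R) : (leb (A `|` B) <= leb A + leb B)%E.
Proof. by rewrite /lebesgue_measure /lebesgue_stieltjes_measure /measure_extension; exact: outer_measureU2. Qed.

(** Integration by parts against the distribution function of m, again by Fubini's theorem on the
    set [x <= y], with m in place of a density. *)
Lemma test_integral_measure (m : {finite_measure set (measurableTypeR R) -> \bar R}) phi : @test_function R phi ->
  \int[m]_(t in I) phi t = - \int[leb]_(y in I) (derive1 phi y * fine (m (I `&` `]-oo, y]))).
Proof.
move=> tphi; have sp := test_smooth tphi.
have mI : measurable I by exact: measurable_I01.
have c0 : continuous phi := @smooth_continuous R _ 0 sp.
have c1 : continuous (derive1 phi) := @smooth_continuous R _ 1 sp.
have [M M0 hM] := test_bounded c1.
have mpsi : measurable_fun setT (derive1 phi \_ I).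
  by apply/(measurable_restrictT _ _).1 => //; apply: measurable_funTS; exact: continuous_measurable_fun.
pose ind (z : R * R) : R := \1_[set z : R * R | z.1 <= z.2] z.
have mind : measurable_fun setT ind.
  apply: measurable_indic.
  have := @measurable_fun_ler _ (R * R)%type R setT fst snd (@measurable_fst _ _ _ _) (@measurable_snd _ _ _ _).
  by move=> /(_ measurableT [set true] Logic.I); rewrite setTI; congr measurable; apply/seteqP; split.
pose F (z : R * R) : R := \1_I z.1 * (ind z * (derive1 phi \_ I) z.2).
have mF : measurable_fun setT F.
  apply: measurable_funM; first by apply: measurableT_comp => //; exact: measurable_indic.
  by apply: measurable_funM => //; exact: measurableT_comp.
have mIoo : (m I < +oo)%E by rewrite -ge0_fin_numE// fin_num_measure.
have iF : (m \x leb)%E.-integrable setT (EFin \o F).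
  apply/integrable12ltyP; first exact/measurable_EFinP.
  apply: (@le_lt_trans _ _ (\int[m]_x (M%:E * (\1_I x)%:E))%E).
    apply: ge0_le_integral => //=.
    - by move=> x _; apply: integral_ge0.
    - apply: (@measurable_fun_fubini_tonelli_F _ _ _ _ R leb (fun z => `|(F z)%:E|%E)) => //=.
      by apply/measurable_EFinP; exact: measurableT_comp.
    - by apply: measurable_funeM; apply/measurable_EFinP; exact: measurable_indic.
    - move=> x _; apply: (@le_trans _ _ (\int[leb]_y (\1_I x * M * \1_I y)%:E)%E).
        apply: ge0_le_integral => //=.
        + apply/measurable_EFinP; apply: measurableT_comp => //.
          exact: (measurableT_comp mF (pair1_measurable x)).
        + by apply/measurable_EFinP; apply: measurable_funM => //; exact: measurable_indic.
        + move=> y _; rewrite lee_fin /F /= normrM -mulrA (ger0_norm (_ : 0 <= \1_I x)); last by rewrite indicE.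
          rewrite ler_wpM2l//.
          rewrite normrM patchE indicE.
          case: ifPn => yI; last by rewrite normr0 !mulr0.
          rewrite mulr1 -[leRHS]mul1r ler_pM//.
            by rewrite /ind indicE; case: (_ \in _); rewrite ?normr1 ?normr0.
          by apply: hM; move: yI; rewrite inE => /I01E/andP[? ?]; rewrite !ltW.
      under eq_integral do rewrite EFinM.
      rewrite ge0_integralZl//; last 2 first.
        by apply/measurable_EFinP; exact: measurable_indic.
        by rewrite lee_fin mulr_ge0// ?indicE// ltW.
      by rewrite integral_indic// setIT [X in (_ * X <= _)%E](leb_I01 : _ = 1%E) mule1 EFinM muleC.
  rewrite ge0_integralZl//; last 2 first.
    by apply/measurable_EFinP; exact: measurable_indic.
    by rewrite lee_fin ltW.
  by rewrite integral_indic// setIT; apply: lte_mul_pinfty => //; rewrite lee_fin ltW.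
have fub : (\int[m]_x \int[leb]_y (F (x, y))%:E = \int[leb]_y \int[m]_x (F (x, y))%:E)%E := Fubini iF.
have E1 : (\int[m]_x \int[leb]_y (F (x, y))%:E = \int[m]_(x in I) (- phi x)%:E)%E.
  rewrite [RHS]integral_mkcond; apply: eq_integral => x _; rewrite patchE.
  case: ifPn => xI; last first.
    under eq_integral do rewrite /F /= indicE (negbTE xI) mul0r.
    by rewrite integral0.
  have x0 : 0 <= x by move: xI; rewrite inE => /I01E/andP[/ltW].
  have mIx : measurable (I `&` `[x, +oo[ : set R).
    by apply: measurableI; [exact: measurable_I01|exact: measurable_itv].
  have gi : leb.-integrable (I `&` `[x, +oo[) (EFin \o derive1 phi).
    have L : leb.-integrable I (EFin \o derive1 phi) := L1_continuous c1.
    apply: integrableS L; [exact: measurable_I01|exact: mIx|exact: subIsetl].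
  transitivity (\int[leb]_(y in I `&` `[x, +oo[) (derive1 phi y)%:E)%E.
    rewrite [RHS]integral_mkcond; apply: eq_integral => y _; rewrite /F /= !patchE indicE xI in_setI.
    rewrite /ind indicE mem_itvcy mem_le_pair.
    by case: (y \in I); case: (x <= y) => /=; rewrite ?mul1r ?mul0r ?mulr0.
  have := integral_derive_tail tphi x0; rewrite /Rintegral => h.
  by rewrite -[LHS]fineK ?h//; apply: integrable_fin_num gi; exact: mIx.
have E2 : (\int[leb]_y \int[m]_x (F (x, y))%:E = \int[leb]_(y in I) (derive1 phi y * fine (m (I `&` `]-oo, y])))%:E)%E.
  rewrite [RHS]integral_mkcond; apply: eq_integral => y _; rewrite patchE.
  case: ifPn => yI; last first.
    under eq_integral do rewrite /F /= !patchE (negbTE yI) !mulr0.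
    by rewrite integral0.
  have mIy : measurable (I `&` `]-oo, y] : set R).
    by apply: measurableI; [exact: measurable_I01|exact: measurable_itv].
  transitivity (\int[m]_x ((derive1 phi y)%:E * (\1_(I `&` `]-oo, y]) x)%:E))%E.
    apply: eq_integral => x _; rewrite /F /= !patchE yI -EFinM; congr EFin.
    rewrite /ind !indicE in_setI mem_itvNyc mem_le_pair.
    by case: (x \in I); case: (x <= y) => /=; rewrite ?mul1r ?mul0r ?mulr1 ?mulr0.
  rewrite integralZl//.
    by rewrite integral_indic// setIT EFinM fineK// fin_num_measure.
  by apply: integrable_indic => //; rewrite -ge0_fin_numE// fin_num_measure.
have pi : m.-integrable I (EFin \o phi).
  have [M2 M20 hM2] := test_bounded c0.
  apply: measurable_bounded_integrable; [exact: mI|exact: mIoo| |].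
    by apply: measurable_funTS; exact: continuous_measurable_fun.
  exists M2; split; first exact: num_real.
  by move=> y y1 t It /=; apply: (le_trans (hM2 t _)); [move/I01E: It => /andP[? ?]; rewrite !ltW|exact: ltW].
have E1' : (\int[m]_(x in I) (- phi x)%:E = - \int[m]_(x in I) (phi x)%:E)%E.
  rewrite -integralN; last by apply: integrable_add_def pi; exact: mI.
  by apply: eq_integral => x _; rewrite EFinN.
by rewrite /Rintegral -E2 -fub E1 E1' fineN opprK.
Qed.

(** The distribution functions of the two Jordan parts are monotone, hence measurable, and subtract
    to that of nu. The right side no longer mentions P and N. *)
Lemma charge_test (nu : {charge set (measurableTypeR R) -> \bar R}) (P N : set (measurableTypeR R))
  (nuPN : hahn_decomposition nu P N) phi : @test_function R phi ->
  \int[jordan_pos nuPN]_(t in I) phi t - \int[jordan_neg nuPN]_(t in I) phi t =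
  - \int[leb]_(y in I) (derive1 phi y * fine (nu (I `&` `]-oo, y]))).
Proof.
move=> tphi; rewrite !test_integral_measure// -opprD; congr (- _).
have mI : measurable I by exact: measurable_I01.
have mIy y : measurable (I `&` `]-oo, y] : set R) by apply: measurableI => //; exact: measurable_itv.
have c1 : continuous (derive1 phi) := @smooth_continuous R _ 1 (test_smooth tphi).
have L (m : {finite_measure set (measurableTypeR R) -> \bar R}) : L1 (fun y => derive1 phi y * fine (m (I `&` `]-oo, y]))).
  have mono : {homo (fun y => fine (m (I `&` `]-oo, y]))) : x y / x <= y}.
    move=> x y xy; apply: fine_le; [apply: fin_num_measure; exact: mIy|apply: fin_num_measure; exact: mIy|].
    apply: le_measure; rewrite ?inE; [exact: mIy|exact: mIy|].
    by apply: setIS; apply: subset_itvl; rewrite bnd_simp.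
  apply: (L1_le _ (L1Z (fine (m I)) (L1_norm (L1_continuous c1)))).
    apply: measurable_funM; first by apply: measurable_funTS; exact: continuous_measurable_fun.
    by apply: nondecreasing_measurable => //; exact: in2W.
  move=> y _; rewrite normrM mulrC ler_wpM2r// ger0_norm ?fine_ge0//.
  apply: fine_le; [apply: fin_num_measure; exact: mIy|apply: fin_num_measure; exact: mI|].
  by apply: le_measure; rewrite ?inE; [exact: mIy|exact: mI|exact: subIsetl].
rewrite -(RintB mI (@subset_refl _ I) (L _) (L _)); apply: eq_Rintegral => y _; rewrite -mulrBr; congr (_ * _).
have := jordan_decomp nuPN (mIy y); rewrite /cadd /cscale /= => ->.
have mh := mIy y.
by rewrite cscaleN1 fineD ?fineN ?fin_numN//; apply: fin_num_measure.
Qed.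

Lemma finite_atom_charge g (s : seq R) (z : R -> R) : L1 g ->
  exists nu : {charge set (measurableTypeR R) -> \bar R}, forall B : set R, measurable B ->
    nu B = (\int[leb]_(x in B `&` I) g x + \sum_(a <- s) z a * \1_B a)%:E.
Proof.
move=> gi; have mI : measurable I by exact: measurable_I01.
have gT := integrable_patch gi.
elim: s => [|a s [nu hnu]].
  exists (induced_charge gT : {charge set (measurableTypeR R) -> \bar R}) => B mB.
  rewrite big_nil addr0 /= /induced_charge Rintegral_mkcondr /Rintegral fineK//.
  by apply: integrable_fin_num => //; apply: integrableS gT => //; exact: measurableT.
exists (cadd (cscale (z a) (charge_of_finite_measure (@dirac _ (measurableTypeR R) a R : {finite_measure set (measurableTypeR R) -> \bar R}))) nu
  : {charge set (measurableTypeR R) -> \bar R}) => B mB.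
rewrite -[LHS]/((z a)%:E * @dirac _ (measurableTypeR R) a R B + nu B)%E hnu// diracE big_cons.
by rewrite indicE -EFinM -EFinD; congr EFin; ring.
Qed.

(** With d half of the gap, the two exceptional sets cover []t - r, t + r[]; but for small r each
    has measure at most [r / 2]. *)
Lemma approx_limit_unique f t l l' : is_approx_limit f t l -> is_approx_limit f t l' -> l = l'.
Proof.
move=> fl fl'; apply/eqP; rewrite -subr_eq0; apply: contraT => ll'.
pose d := `|l - l'| / 2; have d0 : 0 < d by rewrite divr_gt0// normr_gt0.
have q0 : 0 < 4^-1 :> R by rewrite invr_gt0.
have near_small k : is_approx_limit f t k -> \forall r \near 0^'+, 0 < r ->
    (leb (`](t - r)%R, (t + r)%R[%classic `&` [set s | (d <= `|f s - k|)%R]) <= (r / 2)%:E)%E.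
  move=> /(_ d d0)/fine_cvgP[hf]; move=> /cvgrPdist_le/(_ _ q0) hc.
  apply: filterS2 hf hc => r /= hf hc r0; move: hf hc; set X := leb _.
  have : (X <= (2 * r)%:E)%E.
    apply: (le_trans (leb_subset (@subIsetl _ _ _))).
    by rewrite [X in (X <= _)%E](leb_oo _) ?lee_fin; lra.
  have : (0 <= X)%E by exact: measure_ge0.
  case: X => //= x _ _ _; rewrite sub0r normrN => /(le_trans (ler_norm _)).
  by rewrite -ler_pdivlMr ?invr_gt0 ?mulr_gt0// invrK lee_fin; lra.
have r0 : \forall r \near 0^'+, (0 : R) < r by exact: nbhs_right_gt.
have [r [[h1 h2] rp]] := filter_ex (filterI (filterI (near_small l fl) (near_small l' fl')) r0).
have sub : `]t - r, t + r[%classic `<=` (`]t - r, t + r[%classic `&` [set s | (d <= `|f s - l|)%R]) `|`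
    (`]t - r, t + r[%classic `&` [set s | (d <= `|f s - l'|)%R]).
  move=> s rs; have [h|h] := leP d `|f s - l|; [by left|right; split=> //=].
  rewrite leNgt; apply/negP => h'; have : `|l - l'| <= `|f s - l| + `|f s - l'|.
    by have -> : l - l' = (f s - l') - (f s - l); [ring|rewrite [leRHS]addrC; exact: ler_normB].
  by rewrite /d in h h'; lra.
have := le_trans (leb_subset sub) (le_trans (leb_subadd _ _) (leeD (h1 rp) (h2 rp))).
rewrite [X in (X <= _)%E](leb_oo _) ?lee_fin; [|lra].
by lra.
Qed.

(** Close to t the exceptional set is contained in a null set together with t itself, so its measure
    is eventually 0. *)
Lemma approx_limit_cvg f v t l : I t -> {ae leb, forall s, I s -> v s = f s} ->
  v s @[s --> t^'] --> l -> is_approx_limit f t l.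
Proof.
move=> /I01E/andP[t0 t1] [Z [mZ Z0 hZ]] /cvgrPdist_lt vl d d0; have := vl d d0.
rewrite /dnbhs /within /= => /nbhs_ballP[e /= e0 he].
apply: cvg_near_cst.
have m0 : 0 < Num.min e (Num.min t (1 - t)) by rewrite !lt_min e0 t0 subr_gt0.
exists (Num.min e (Num.min t (1 - t))) => //= r hr r0.
have {}hr : `|0 - r| < Num.min e (Num.min t (1 - t)) := hr.
move: hr; rewrite sub0r normrN gtr0_norm// !lt_min => /and3P[h1 h2 h3].
set A := _ `&` _; have A0 : leb A = 0%E.
  apply/eqP; rewrite eq_le measure_ge0 andbT.
  apply: (@le_trans _ _ (leb (Z `|` [set t]))).
    apply: leb_subset => s [/=]; rewrite in_itv /= => /andP[s1 s2] ds.
    have [->|st] := eqVneq s t; first by right.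
    left; apply: hZ => /= hs; have Is : I s by apply/I01E; apply/andP; split; lra.
    have := he s; rewrite /ball /= distrC => /(_ _ st) hb.
    have : `|l - v s| < d by apply: hb; rewrite ltr_norml; apply/andP; split; lra.
    by rewrite (hs Is) distrC ltNge ds.
  by apply: (le_trans (leb_subadd _ _)); rewrite Z0 add0e lebesgue_measure_set1.
by rewrite [X in (X * _)%E](A0 : _ = 0%E) mul0e.
Qed.

(** Two null sets cannot cover []t, t + r[], so some point arbitrarily close to t sees both
    representatives equal to f. *)
Lemma right_limit_unique f t l l' : 0 <= t < 1 -> is_right_limit f t l -> is_right_limit f t l' -> l = l'.
Proof.
move=> /andP[t0 t1] [v [Z [mZ Z0 hZ]] vl] [v' [Z' [mZ' Z0' hZ']] vl'].
apply/eqP; rewrite -subr_eq0; apply: contraT => ll'.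
have d0 : 0 < `|l - l'| / 2 by rewrite divr_gt0// normr_gt0.
move/cvgrPdist_lt: vl => /(_ _ d0); move/cvgrPdist_lt: vl' => /(_ _ d0).
rewrite /at_right /within /= => /nbhs_ballP[e' /= e0' he'] /nbhs_ballP[e /= e0 he].
pose r := Num.min (Num.min e e') (1 - t).
have r0 : 0 < r by rewrite !lt_min e0 e0' subr_gt0.
have : r <= Num.min (Num.min e e') (1 - t) by [].
rewrite !le_min => /andP[/andP[re re'] r1].
have : exists2 s, t < s < t + r & ~ (Z `|` Z') s.
  apply: contrapT => nh; have sub : `]t, t + r[%classic `<=` Z `|` Z'.
    by move=> s; rewrite /= in_itv /= => hs; apply: contrapT => ns; apply: nh; exists s.
  have := le_trans (leb_subset sub) (leb_subadd _ _).
  have tr : t <= t + r by rewrite lerDl ltW.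
  by rewrite [X in (X <= _)%E](leb_oo tr) Z0 Z0' adde0 lee_fin; lra.
move=> [s /andP[ts sr] /not_orP[nZ nZ']].
have Is : I s by apply/I01E; apply/andP; split; lra.
have vs : v s = f s by apply: contrapT => h; apply: nZ; apply: hZ => /(_ Is).
have vs' : v' s = f s by apply: contrapT => h; apply: nZ'; apply: hZ' => /(_ Is).
have bs e1 : r <= e1 -> ball t e1 s by move=> h; rewrite /ball /= distrC gtr0_norm; lra.
have := he s (bs _ re) ts; have := he' s (bs _ re') ts; rewrite vs vs'.
move=> h1 h2.
have : `|l - l'| <= `|l - f s| + `|l' - f s| by rewrite (le_trans _ (ler_normB _ _))// opprB addrA subrK.
by lra.
Qed.

Lemma left_limit_unique f t l l' : 0 < t <= 1 -> is_left_limit f t l -> is_left_limit f t l' -> l = l'.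
Proof.
move=> /andP[t0 t1] [v [Z [mZ Z0 hZ]] vl] [v' [Z' [mZ' Z0' hZ']] vl'].
apply/eqP; rewrite -subr_eq0; apply: contraT => ll'.
have d0 : 0 < `|l - l'| / 2 by rewrite divr_gt0// normr_gt0.
move/cvgrPdist_lt: vl => /(_ _ d0); move/cvgrPdist_lt: vl' => /(_ _ d0).
rewrite /at_left /within /= => /nbhs_ballP[e' /= e0' he'] /nbhs_ballP[e /= e0 he].
pose r := Num.min (Num.min e e') t.
have r0 : 0 < r by rewrite !lt_min e0 e0'.
have : r <= Num.min (Num.min e e') t by [].
rewrite !le_min => /andP[/andP[re re'] r1].
have : exists2 s, t - r < s < t & ~ (Z `|` Z') s.
  apply: contrapT => nh; have sub : `]t - r, t[%classic `<=` Z `|` Z'.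
    by move=> s; rewrite /= in_itv /= => hs; apply: contrapT => ns; apply: nh; exists s.
  have := le_trans (leb_subset sub) (leb_subadd _ _).
  have tr : t - r <= t by rewrite gerBl ltW.
  by rewrite [X in (X <= _)%E](leb_oo tr) Z0 Z0' adde0 lee_fin; lra.
move=> [s /andP[ts sr] /not_orP[nZ nZ']].
have Is : I s by apply/I01E; apply/andP; split; lra.
have vs : v s = f s by apply: contrapT => h; apply: nZ; apply: hZ => /(_ Is).
have vs' : v' s = f s by apply: contrapT => h; apply: nZ'; apply: hZ' => /(_ Is).
have bs e1 : r <= e1 -> ball t e1 s by move=> h; rewrite /ball /= gtr0_norm; lra.
have := he s (bs _ re) sr; have := he' s (bs _ re') sr; rewrite vs vs'.
move=> h1 h2.
have : `|l - l'| <= `|l - f s| + `|l' - f s| by rewrite (le_trans _ (ler_normB _ _))// opprB addrA subrK.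
by lra.
Qed.

Lemma signed_sum_seq (A : set R) (s : seq R) f : uniq s -> A = [set` s] -> signed_sum A f = (\sum_(a <- s) f a)%:E.
Proof.
move=> us ->; have fs : finite_set [set` s] by exact: finite_seq.
rewrite /signed_sum !esum_fset//; try (by move=> i _; rewrite funepos_ge0 || rewrite funeneg_ge0).
rewrite -!fsbig_seq//.
rewrite (eq_bigr (fun a => (Num.max (f a) 0)%:E)); last by move=> a _; rewrite funeposE /= EFin_max.
rewrite [X in (_ - X)%E](eq_bigr (fun a => (Num.max (- f a) 0)%:E)); last by move=> a _; rewrite funenegE /= EFin_max.
rewrite !sumEFin -EFinB -sumrB; congr EFin; apply: eq_bigr => a _.
by rewrite maxr_absE maxr_absE !subr0 normrN; field.
Qed.

Lemma summable_seq (s : seq R) f : uniq s -> summable [set` s] (EFin \o f).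
Proof.
move=> us; rewrite /summable esum_fset; [|exact: finite_seq|by move=> *; exact: abse_ge0].
rewrite -(fsbig_seq _ _ us) (eq_bigr (fun a => (`|f a|)%:E)); last by [].
by rewrite sumEFin ltry.
Qed.

End charges_and_limits.

(** * Functions of the form constant plus primitive plus step function *)

Section step_functions.
Context {R : realType}.
Implicit Types (f g u v : R -> R) (p : {poly R}) (x y s t r : R) (m n N : nat).
Local Notation leb := (@lebesgue_measure R).
Local Notation I := (@I01 R).

Lemma counting_seq (s : seq R) : uniq s -> counting [set` s] = (size s)%:R%:E :> \bar R.
Proof.
move=> us; rewrite /counting asboolT; last exact: finite_seq.
congr (_%:R%:E); rewrite -sum1_size -[RHS]sum1_size.
have := fsbig_seq addn (fun=> 1%N) us; rewrite fsbig_finite; last exact: finite_seq.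
by move=> ->.
Qed.

Lemma primE g y : prim g y = \int[leb]_(x in `]-oo, y] `&` I) g x.
Proof. by rewrite /prim /Prim Rintegral_mkcondr. Qed.

Lemma test_integral_derive phi : @test_function R phi -> \int[leb]_(t in I) derive1 phi t = 0.
Proof.
move=> tphi; have := integral_derive_tail tphi (lexx 0).
rewrite (_ : I `&` `[0, +oo[ = I); last first.
  by apply/setIidPl => t /I01E/andP[t0 _]; rewrite /= in_itv /= ltW.
by move=> ->; case: tphi => _ [a [b [a0 b1 h]]]; rewrite h ?oppr0// /= in_itv /= leNgt a0.
Qed.

Lemma Rint_ae f g : measurable_fun I f -> measurable_fun I g -> {ae leb, forall t, I t -> f t = g t} ->
  \int[leb]_(t in I) f t = \int[leb]_(t in I) g t.
Proof.
move=> mf mg fg; rewrite /Rintegral; congr fine; apply: ae_eq_integral.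
- exact: measurable_I01.
- exact/measurable_EFinP.
- exact/measurable_EFinP.
- by apply: aeS fg => t h /h /= ->.
Qed.

(** [stepsum] is left continuous, so its values are its left limits; [stepsum_right] gives the right
    limits and is the distribution function of the atoms. They differ only on s. *)
Definition stepsum (s : seq R) (z : R -> R) (t : R) : R := \sum_(a <- s) z a * (a < t)%R%:R.
Definition stepsum_right (s : seq R) (z : R -> R) (t : R) : R := \sum_(a <- s) z a * (a <= t)%R%:R.

Lemma stepsum_near (s : seq R) (z : R -> R) (t : R) : exists2 d : R, 0 < d &
  (forall y, t < y < t + d -> stepsum s z y = stepsum_right s z t) /\
  (forall y, t - d < y <= t -> stepsum s z y = stepsum s z t).
Proof.
have [d d0 hd] := seq_gap s t; exists d => //; split=> y /andP[y1 y2].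
  apply: eq_big_seq => a as_; congr (_ * _%:R); congr nat_of_bool.
  have [->|at_] := eqVneq a t; first by rewrite y1 lexx.
  have := hd a as_ at_; have [h|h] := leP a t.
    by move=> _; rewrite (le_lt_trans h y1).
  rewrite gtr0_norm ?subr_gt0// => h2; apply/negbTE; rewrite -leNgt; lra.
apply: eq_big_seq => a as_; congr (_ * _%:R); congr nat_of_bool.
have [->|at_] := eqVneq a t; first by rewrite ltxx ltNge y2.
have := hd a as_ at_; have [h|h] := ltP a t.
  by rewrite ltr0_norm ?subr_lt0// => h2; lra.
by move=> _; apply/negbTE; rewrite -leNgt; lra.
Qed.

Lemma stepsum_right_notin (s : seq R) z t : t \notin s -> stepsum_right s z t = stepsum s z t.
Proof.
move=> ts; apply: eq_big_seq => a as_; rewrite le_eqVlt; case: eqVneq => // at_.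
by rewrite -at_ as_ in ts.
Qed.

Lemma stepsum_jump (s : seq R) z t : uniq s -> stepsum_right s z t - stepsum s z t = if t \in s then z t else 0.
Proof.
move=> us; rewrite -sumrB (eq_bigr (fun a => if a == t then z t else 0)); last first.
  move=> a _; rewrite le_eqVlt; case: eqVneq => [->|_] /=; first by rewrite ltxx /=; ring.
  by rewrite subrr.
case: ifPn => ts; last by rewrite big1_seq// => a /andP[_ as_]; case: eqP => // at_; rewrite -at_ as_ in ts.
by rewrite (bigD1_seq t)//= eqxx big1 ?addr0// => a /negbTE ->.
Qed.

Lemma stepsum_measurable (D : set R) (s : seq R) z : measurable_fun D (stepsum s z).
Proof.
apply: measurable_funTS; rewrite /stepsum; elim: s => [|a s IH].
  by under eq_fun do rewrite big_nil; exact: measurable_cst.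
under eq_fun do rewrite big_cons; apply: measurable_funD => //.
rewrite (_ : (fun x => _) = fun x => z a * \1_(`]a, +oo[%classic) x).
  by apply: measurable_funM; [exact: measurable_cst|exact: measurable_indic].
by apply/funext => x; rewrite indicE; congr (_ * _%:R); congr nat_of_bool; apply/idP/idP; rewrite inE /= in_itv /= andbT.
Qed.

Lemma stepsum_right_measurable (D : set R) (s : seq R) z : measurable_fun D (stepsum_right s z).
Proof.
apply: measurable_funTS; rewrite /stepsum_right; elim: s => [|a s IH].
  by under eq_fun do rewrite big_nil; exact: measurable_cst.
under eq_fun do rewrite big_cons; apply: measurable_funD => //.
rewrite (_ : (fun x => _) = fun x => z a * \1_(`[a, +oo[%classic) x).
  by apply: measurable_funM; [exact: measurable_cst|exact: measurable_indic].
by apply/funext => x; rewrite indicE; congr (_ * _%:R); congr nat_of_bool; apply/idP/idP; rewrite inE /= in_itv /= andbT.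
Qed.

Lemma stepsum_L1 (s : seq R) z : L1 (stepsum s z).
Proof.
apply: (L1_le (@stepsum_measurable I s z) (L1_cst (\sum_(a <- s) `|z a|))) => t _.
apply: (le_trans (ler_norm_sum _ _ _)); apply: ler_sum => a _.
by rewrite normrM ler_piMr// ger0_norm//; case: (a < t)%R; rewrite ?ler01.
Qed.

Lemma ae_notin (s : seq R) : {ae leb, forall t, t \notin s}.
Proof.
have cs : countable [set` s] by apply: finite_set_countable; exact: finite_seq.
exists [set` s]; split.
- by apply: countable_measurable.
- exact: countable_lebesgue_measure0.
- by move=> t /= /negP; rewrite negbK.
Qed.

Section structure.
Variables (u g : R -> R) (C : R) (s : seq R) (z : R -> R).
Hypotheses (mu_ : measurable_fun I u) (g2 : L2 g) (us : uniq s) (sI : forall a, a \in s -> I a).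
Hypothesis uE : {ae leb, forall t, I t -> u t = C + prim g t + stepsum s z t}.

(** A left continuous representative of u with right limits on [I01], from which the one-sided
    limits of the class are read. *)
Let U t := C + prim g t + stepsum s z t.
Let gi : L1 g. Proof. exact: L2_L1. Qed.
Let mI : measurable I. Proof. exact: measurable_I01. Qed.
Let Uu : {ae leb, forall t, I t -> U t = u t}.
Proof. by apply: aeS uE => t h /h ->. Qed.
Let cprim : continuous (prim g). Proof. exact: prim_continuous. Qed.

Let UL1 : L1 U.
Proof. by apply: L1D; [apply: L1D; [exact: L1_cst|exact: L1_continuous]|exact: stepsum_L1]. Qed.

Let uL1 : L1 u.
Proof.
apply/integrableP; split; first exact/measurable_EFinP.
have /integrableP[mU] := UL1; apply: le_lt_trans; rewrite le_eqVlt; apply/orP; left; apply/eqP.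
apply: ae_eq_integral => //.
- by apply: measurableT_comp => //; exact/measurable_EFinP.
- by apply: measurableT_comp.
- by apply: aeS Uu => t h /h /= ->.
Qed.

Lemma structure_right_limit t : I t -> is_right_limit u t (C + prim g t + stepsum_right s z t).
Proof.
move=> It; exists U => //; have [d d0 [hr _]] := stepsum_near s z t.
apply: cvgD; first by apply: cvgD; [exact: cvg_cst|apply: cvg_at_right_filter; exact: cprim].
apply: cvg_near_cst; exists d => //= y; rewrite /ball /= => hy ty; apply: hr.
by rewrite ty /=; move: hy; rewrite distrC gtr0_norm ?subr_gt0//; lra.
Qed.

Lemma structure_left_limit t : I t -> is_left_limit u t (U t).
Proof.
move=> It; exists U => //; have [d d0 [_ hl]] := stepsum_near s z t.
apply: cvgD; first by apply: cvgD; [exact: cvg_cst|apply: cvg_at_left_filter; exact: cprim].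
apply: cvg_near_cst; exists d => //= y; rewrite /ball /= => hy ty; apply: hl.
by rewrite (ltW ty) andbT; move: hy; rewrite gtr0_norm ?subr_gt0//; lra.
Qed.

Let Ir t : I t -> 0 <= t < 1. Proof. by move=> /I01E/andP[? ?]; rewrite ltW. Qed.
Let Il t : I t -> 0 < t <= 1. Proof. by move=> /I01E/andP[? ?]; rewrite ltW// andbT. Qed.

Lemma structure_jump t : I t -> jump u t = if t \in s then z t else 0.
Proof.
move=> It; rewrite -(stepsum_jump _ _ us) /jump.
have -> : right_limit u t = C + prim g t + stepsum_right s z t.
  rewrite /right_limit; case: xgetP => [y _ yP|/(_ _ (structure_right_limit It))//].
  exact: right_limit_unique (Ir It) yP (structure_right_limit It).
have -> : left_limit u t = U t.
  rewrite /left_limit; case: xgetP => [y _ yP|/(_ _ (structure_left_limit It))//].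
  exact: left_limit_unique (Il It) yP (structure_left_limit It).
by rewrite /U; ring.
Qed.

Lemma structure_jump_set : (forall a, a \in s -> z a != 0) -> jump_set u = [set` s].
Proof.
move=> z0; apply/seteqP; split=> [t [It [l [l' [hl hr ll']]]]|t /= ts].
  rewrite /=; apply: contraT => ts; move: ll'.
  rewrite (left_limit_unique (Il It) hl (structure_left_limit It)).
  rewrite (right_limit_unique (Ir It) hr (structure_right_limit It)).
  by rewrite stepsum_right_notin// eqxx.
have It := sI ts; split=> //; exists (U t), (C + prim g t + stepsum_right s z t).
split; [exact: structure_left_limit|exact: structure_right_limit|].
rewrite /U -subr_eq0 (_ : _ - _ = - (stepsum_right s z t - stepsum s z t)); last ring.
by rewrite stepsum_jump// ts oppr_eq0 z0.
Qed.

(** Off s and wherever [prim g] has derivative g, U is differentiable in the ordinary sense, so g is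
    an approximate gradient of u. Uniqueness of approximate limits identifies it with the chosen
    one. *)
Lemma structure_approx_gradient : measurable_fun I (approx_gradient u) /\
  {ae leb, forall t, I t -> approx_gradient u t = g t}.
Proof.
have hg : {ae leb, forall t, I t -> approx_differentiable_at u t (g t)}.
  apply: aeS (aeI (ae_notin s) (prim_ae_derive gi)) => t [ts hd] It; have {}hd := hd It.
  have [d d0 [hr hl]] := stepsum_near s z t; rewrite (stepsum_right_notin _ ts) in hr.
  have hst y : `|y - t| < d -> stepsum s z y = stepsum s z t.
    rewrite ltr_norml => /andP[y1 y2]; have [yt|ty] := leP y t; first by apply: hl; rewrite yt andbT; lra.
    by apply: hr; rewrite ty; lra.
  exists (U t).
    apply: (approx_limit_cvg It Uu); apply: cvg_within_filter; apply: cvgD.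
      by apply: cvgD; [exact: cvg_cst|exact: cprim].
    by apply: cvg_near_cst; exists d => //= y; rewrite /ball /= distrC; exact: hst.
  apply: (@approx_limit_cvg R _ (fun y => (U y - U t) / (y - t)) t (g t) It).
    by apply: aeS Uu => y h /h ->.
  apply/cvgrPdist_le => e e0; have [d1 d10 hd1] := (is_deriveP _ _ _).1 hd e e0.
  exists (Num.min d d1); first by rewrite /= lt_min d0.
  move=> y; rewrite /ball /= lt_min => /andP[y1 y2] yt.
  have yt0 : y - t != 0 by rewrite subr_eq0.
  rewrite distrC in y1; rewrite distrC in y2.
  have := hd1 (y - t) y2; rewrite (addrC t) subrK => h.
  rewrite -(ler_pM2r (x := `|y - t|)) ?normr_gt0// -normrM mulrBl divfK// distrC.
  by apply: le_trans h; rewrite /U (hst y y1) le_eqVlt; apply/orP; left; apply/eqP; congr `|_|; ring.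
rewrite /approx_gradient; case: xgetP => [h _ [mh hh]|/(_ g) nh]; last first.
  by exfalso; apply: nh; split=> //; exact: L1_measurable.
split=> //; apply: aeS (aeI hh hg) => t [h1 h2] It.
have [y1 a1 b1] := h1 It; have [y2 a2 b2] := h2 It.
by rewrite (approx_limit_unique a1 a2) in b1; exact: approx_limit_unique b1 b2.
Qed.

Let agi : L1 (approx_gradient u).
Proof.
have [ma hae] := structure_approx_gradient.
apply/integrableP; split; first exact/measurable_EFinP.
have /integrableP[mg] := gi; apply: le_lt_trans; rewrite le_eqVlt; apply/orP; left; apply/eqP.
apply: ae_eq_integral => //.
- by apply: measurableT_comp => //; exact/measurable_EFinP.
- by apply: measurableT_comp.
- by apply: aeS hae => t h /h /= ->.
Qed.

Let ag_sq : (\int[leb]_(t in I) (approx_gradient u t ^+ 2)%:E = \int[leb]_(t in I) (g t ^+ 2)%:E)%E.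
Proof.
have [ma hae] := structure_approx_gradient.
apply: ae_eq_integral => //.
- by apply/measurable_EFinP; exact: measurable_funX.
- by apply/measurable_EFinP; apply: measurable_funX; exact: L1_measurable.
- by apply: aeS hae => t h /h /= ->.
Qed.

(** The distribution function of nu is [prim g + stepsum_right s z], which equals [U - C] off s; the
    constant C disappears because derivatives of test functions have integral 0. *)
Let atom_test (nu : {charge set (measurableTypeR R) -> \bar R}) :
  (forall B : set R, measurable B -> B `<=` I -> nu B = (\int[leb]_(x in B) g x + \sum_(a <- s) z a * \1_B a)%:E) ->
  is_distributional_derivative u nu.
Proof.
move=> nuE P N nuPN phi tphi; rewrite (charge_test nuPN tphi) opprK.
have c1 : continuous (derive1 phi) := @smooth_continuous R _ 1 (test_smooth tphi).
have mc1 : measurable_fun I (derive1 phi) by apply: measurable_funTS; exact: continuous_measurable_fun.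
transitivity (\int[leb]_(t in I) ((U t - C) * derive1 phi t)).
  transitivity (\int[leb]_(t in I) (U t * derive1 phi t)).
    apply: Rint_ae; [exact: measurable_funM|by apply: measurable_funM => //; exact: L1_measurable|].
    by apply: aeS Uu => t h /h ->.
  under [in RHS]eq_Rintegral do rewrite mulrBl.
  rewrite (RintB mI (@subset_refl _ I)); [|exact: integrable_mul_continuous|by apply: L1Z; exact: L1_continuous].
  rewrite (RintZ mI (@subset_refl _ I)); last exact: L1_continuous.
  by rewrite test_integral_derive// mulr0 subr0.
have E y : fine (nu (I `&` `]-oo, y])) = prim g y + stepsum_right s z y.
  rewrite nuE; [|by apply: measurableI => //; exact: measurable_itv|exact: subIsetl].
  rewrite /= primE setIC; congr (_ + _); apply: eq_big_seq => a as_; congr (_ * _).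
  by rewrite indicE in_setI (mem_set (sI as_)) andbT mem_itvNyc.
under [in RHS]eq_Rintegral do rewrite E mulrC.
apply: Rint_ae.
- by apply: measurable_funM => //; apply: measurable_funB; [exact: L1_measurable|exact: measurable_cst].
- apply: measurable_funM => //.
  apply: measurable_funD; last exact: stepsum_right_measurable.
  by apply: measurable_funTS; exact: continuous_measurable_fun.
- by apply: aeS (ae_notin s) => t ts _; rewrite stepsum_right_notin// /U; congr (_ * _); ring.
Qed.

Let inset_filter (B : set R) : jump_set u = [set` s] -> jump_set u `&` B = [set` [seq a <- s | `[< B a >]]].
Proof.
move=> ->; apply/seteqP; split => [t [/= ts Bt]|t /=]; rewrite /= mem_filter.
  by rewrite ts andbT; apply/asboolP.
by move=> /andP[/asboolP Bt ts].
Qed.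

(** Nonzero coefficients make the jump set exactly s. The charge with density g and atoms z is the
    witness of membership in [SBV2]. *)
Lemma structure_MumfordShah (mu : R) : (forall a, a \in s -> z a != 0) ->
  MumfordShah mu u = (\int[leb]_(t in I) (g t ^+ 2)%:E + (mu * (size s)%:R)%:E)%E.
Proof.
move=> z0; have js := structure_jump_set z0; have [ma hae] := structure_approx_gradient.
have [nu hnu] := finite_atom_charge s z gi.
have hnu' (B : set R) : measurable B -> B `<=` I -> nu B = (\int[leb]_(x in B) g x + \sum_(a <- s) z a * \1_B a)%:E.
  by move=> mB BI; rewrite hnu// (setIidl BI).
have dnu := atom_test hnu'.
have sbv : SBV2 u.
  split.
  - by split=> //; exists nu.
  - by split=> //; rewrite ag_sq; case: g2.
  - by rewrite js; exact: summable_seq.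
  - exists nu => // B mB BI; rewrite hnu'//.
    rewrite (signed_sum_seq _ (filter_uniq _ us) (inset_filter _ js)) (RintE mB BI agi) EFinD; congr (_ + _)%E.
      congr EFin; rewrite /Rintegral; congr fine; apply: ae_eq_integral => //.
      + by apply/measurable_EFinP; apply: measurable_funS (L1_measurable gi).
      + by apply/measurable_EFinP; apply: measurable_funS ma.
      + by apply: aeS hae => t h /BI/h /= ->.
    congr EFin; rewrite big_filter [RHS]big_mkcond; apply: eq_big_seq => a as_.
    rewrite (structure_jump (sI as_)) as_ indicE; case: asboolP => Ba.
      by rewrite mem_set// mulr1.
    by rewrite memNset// mulr0.
rewrite /MumfordShah asboolT// ag_sq; congr (_ + _)%E; by rewrite js counting_seq// EFinM.
Qed.

End structure.

(** Compactness may produce points with coefficient 0, which are not jumps; filtering them out only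
    lowers the value. *)
Lemma MumfordShah_le (mu C : R) u g (s : seq R) z : 0 <= mu -> measurable_fun I u -> L2 g -> uniq s ->
  (forall a, a \in s -> I a) -> {ae leb, forall t, I t -> u t = C + prim g t + stepsum s z t} ->
  (MumfordShah mu u <= \int[leb]_(t in I) (g t ^+ 2)%:E + (mu * (size s)%:R)%:E)%E.
Proof.
move=> mu0 mu_ g2 us sI uE; pose s' := [seq a <- s | z a != 0].
rewrite (@structure_MumfordShah u g C s' z) //.
- by rewrite leeD2l// lee_fin ler_wpM2l// ler_nat size_filter count_size.
- exact: filter_uniq.
- by move=> a; rewrite mem_filter => /andP[_ /sI].
- apply: aeS uE => t h /h ->; congr (_ + _); rewrite /stepsum big_filter [RHS]big_mkcond.
  by apply: eq_bigr => a _; case: eqVneq => //= ->; rewrite mul0r.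
- by move=> a; rewrite mem_filter => /andP[].
Qed.

(** Converse of the previous description: the candidate W has the same distributional derivative as
    u, because the distribution function of nu equals W off s, so u and W differ by a constant. *)
Lemma SBV2_finite_structure u : measurable_fun I u -> SBV2 u -> finite_set (jump_set u) ->
  exists (C : R) (s : seq R), [/\ uniq s, jump_set u = [set` s], (forall a, a \in s -> I a) &
    {ae leb, forall t, I t -> u t = C + prim (approx_gradient u) t + stepsum s (jump u) t}].
Proof.
move=> mu_ [[uL1 _] ag2 _ [nu dnu nuE]] fj; have mI : measurable I by exact: measurable_I01.
have agi := L2_L1 ag2; set g := approx_gradient u in ag2 agi nuE *.
pose s : seq R := finmap.enum_fset (fset_set (jump_set u)).
have us : uniq s by exact: finmap.fset_uniq.
have js : jump_set u = [set` s].
  by apply/seteqP; split => t /=; rewrite /s in_fset_set// inE.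
have sI a : a \in s -> I a by move=> as_; have : jump_set u a by [rewrite js]; case.
pose W y := prim g y + stepsum s (jump u) y.
have WL1 : L1 W by apply: L1D; [apply: L1_continuous; exact: prim_continuous|exact: stepsum_L1].
have dW y : fine (nu (I `&` `]-oo, y])) = prim g y + stepsum_right s (jump u) y.
  have mIy : measurable (I `&` `]-oo, y] : set R) by apply: measurableI => //; exact: measurable_itv.
  have IyI : I `&` `]-oo, y] `<=` I by exact: subIsetl.
  rewrite nuE// (RintE mIy IyI agi) /=.
  have E : jump_set u `&` (I `&` `]-oo, y]) = [set` [seq a <- s | a <= y]].
    rewrite js; apply/seteqP; split=> [t [/= ts [_]]|t /=]; rewrite /= mem_filter.
      by rewrite in_itv /= => ->.
    by move=> /andP[ty ts]; split=> //; split; [exact: sI|rewrite in_itv].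
  rewrite (signed_sum_seq _ (filter_uniq _ us) E) /= primE setIC; congr (_ + _).
  rewrite /stepsum_right big_filter big_mkcond; apply: eq_bigr => a _.
  by case: (a <= y); rewrite ?mulr1 ?mulr0.
have [P [N nuPN]] := Hahn_decomposition nu.
have uWL1 : L1 (fun t => u t - W t) by exact: L1B.
have [C hC] : exists C : R, {ae leb, forall t, I t -> u t - W t = C}.
  apply: du_bois_reymond; first exact: L1_locint.
  move=> phi tphi; have c1 : continuous (derive1 phi) := @smooth_continuous R _ 1 (test_smooth tphi).
  under eq_Rintegral do rewrite mulrBl.
  rewrite (RintB mI (@subset_refl _ I)); [|exact: integrable_mul_continuous|exact: integrable_mul_continuous].
  apply/eqP; rewrite subr_eq0; apply/eqP.
  rewrite (dnu P N nuPN phi tphi) (charge_test nuPN tphi) opprK.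
  have mc1 : measurable_fun I (derive1 phi) by apply: measurable_funTS; exact: continuous_measurable_fun.
  under eq_Rintegral do rewrite dW mulrC.
  apply: Rint_ae.
  - apply: measurable_funM => //; apply: measurable_funD; last exact: stepsum_right_measurable.
    by apply: measurable_funTS; apply: continuous_measurable_fun; exact: prim_continuous.
  - by apply: measurable_funM => //; exact: L1_measurable.
  - by apply: aeS (ae_notin s) => t ts _; rewrite stepsum_right_notin.
exists C, s; split=> //; apply: aeS hC => t h /h <-; rewrite /W; ring.
Qed.

End step_functions.

(** * Bernstein polynomials *)

Section bernstein_polynomials.
Context {R : realType}.
Implicit Types (f g u v : R -> R) (p : {poly R}) (x y s t r : R) (m n N : nat).
Local Notation leb := (@lebesgue_measure R).
Local Notation I := (@I01 R).

Definition bern m i : {poly R} := ('X^i * (1 - 'X) ^+ (m - i)) *+ 'C(m, i).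
Definition bernstein m (f : nat -> R) : {poly R} := \sum_(i < m.+1) f i *: bern m i.

Lemma bern_small m : bern m m.+1 = 0.
Proof. by rewrite /bern bin_small// mulr0n. Qed.

Lemma deriv_1X n : ((1 - 'X : {poly R}) ^+ n)^`() = - ((1 - 'X) ^+ n.-1 *+ n).
Proof. by rewrite deriv_exp derivB derivX -polyC1 derivC sub0r mulN1r mulNrn. Qed.

Lemma deriv_bern0 m : (bern m.+1 0)^`() = - (bern m 0 *+ m.+1).
Proof. by rewrite /bern !bin0 !subn0 !expr0 !mul1r !mulr1n deriv_1X. Qed.

Lemma deriv_bernS m i : (bern m.+1 i.+1)^`() = (bern m i - bern m i.+1) *+ m.+1.
Proof.
have e1 : (i.+1 * 'C(m.+1, i.+1) = 'C(m, i) * m.+1)%N by rewrite -mul_bin_diag mulnC.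
have e2 : ((m - i) * 'C(m.+1, i.+1) = 'C(m, i.+1) * m.+1)%N by rewrite -[(m - i)%N]subSS -mul_bin_down mulnC.
rewrite /bern subSS derivMn derivM derivXn deriv_1X mulrN mulrnAl mulrnAr mulrnBl -!mulrnA e1 e2.
by rewrite mulrnBl -!mulrnA -subnS.
Qed.

Lemma deriv_bernstein m (f : nat -> R) : (bernstein m.+1 f)^`() = m.+1%:R *: \sum_(i < m.+1) (f i.+1 - f i) *: bern m i.
Proof.
rewrite /bernstein raddf_sum big_ord_recl /= derivZ deriv_bern0.
under eq_bigr => i _ do rewrite derivZ /bump leq0n add1n deriv_bernS -scaler_nat scalerA mulrC -scalerA scalerBr.
rewrite -scaler_sumr sumrB.
have -> : \sum_(i < m.+1) f i.+1 *: bern m i.+1 = \sum_(i < m.+1) f i *: bern m i - f 0%N *: bern m 0.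
  have <- : \sum_(i < m.+2) f i *: bern m i = \sum_(i < m.+1) f i *: bern m i.
    by rewrite big_ord_recr /= bern_small scaler0 addr0.
  rewrite [in RHS]big_ord_recl /= [RHS]addrC addKr; apply: eq_bigr => i _.
  by rewrite /bump leq0n add1n.
rewrite scalerN -scaler_nat scalerA [f 0%N * _]mulrC -scalerA -scalerN -scalerDr; congr (_ *: _).
under [in RHS]eq_bigr do rewrite scalerBl.
by rewrite sumrB; ring.
Qed.

Lemma sum_bern m : \sum_(i < m.+1) bern m i = 1.
Proof.
have := exprDn_comm m (commr1 ((1 - 'X) : {poly R})) => _.
have := exprDn (1 - 'X : {poly R}) 'X m; rewrite subrK expr1n => ->.
by apply: eq_bigr => i _; rewrite /bern mulrC.
Qed.

Lemma bernE m i x : (bern m i).[x] = x ^+ i * (1 - x) ^+ (m - i) *+ 'C(m, i).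
Proof.
rewrite /bern hornerMn hornerM !horner_exp hornerX; congr (_ * _ ^+ _ *+ _).
by rewrite !hornerE.
Qed.

Lemma bern_ge0 m i x : 0 <= x <= 1 -> 0 <= (bern m i).[x].
Proof.
move=> /andP[x0 x1]; rewrite bernE mulrn_wge0// mulr_ge0// exprn_ge0//.
by rewrite subr_ge0.
Qed.

Lemma sum_bernx m x : \sum_(i < m.+1) (bern m i).[x] = 1.
Proof. by rewrite -horner_sum sum_bern hornerE. Qed.

Lemma bernsteinE m (f : nat -> R) x : (bernstein m f).[x] = \sum_(i < m.+1) f i * (bern m i).[x].
Proof. by rewrite /bernstein horner_sum; apply: eq_bigr => i _; rewrite hornerZ. Qed.

Lemma bernstein0 m (f : nat -> R) : (bernstein m f).[0] = f 0%N.
Proof.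
rewrite bernsteinE big_ord_recl big1 ?addr0 => [|i _].
  by rewrite bernE expr0 mul1r subr0 expr1n bin0 mulr1.
by rewrite bernE lift0 expr0n /= mul0r mul0rn mulr0.
Qed.

Lemma bernstein1 m (f : nat -> R) : (bernstein m f).[1] = f m.
Proof.
rewrite bernsteinE big_ord_recr big1 /= => [|i _].
  by rewrite add0r bernE subnn expr0 mulr1 binn mulr1n expr1n mulr1.
by rewrite bernE subrr expr0n subn_eq0 leqNgt ltn_ord /= mulr0 mul0rn mulr0.
Qed.

Lemma size_bernstein m (f : nat -> R) : (size (bernstein m f) <= m.+1)%N.
Proof.
apply: (leq_trans (size_sum _ _ _)); apply/bigmax_leqP => i _.
apply: (leq_trans (size_scale_leq _ _)); rewrite /bern -scaler_nat.
apply: (leq_trans (size_scale_leq _ _)).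
apply: (leq_trans (size_polyMleq _ _)); rewrite size_polyXn.
have h : (size ((1 - 'X : {poly R}) ^+ (m - i)) <= (m - i).+1)%N.
  apply: (leq_trans (size_poly_exp_leq _ _)).
  have : (size (1 - 'X : {poly R})%R <= 2)%N by rewrite -opprB size_polyN -polyC1 size_XsubC.
  by case: (size _) => [|[|[|]]] //= _; rewrite ?mul0n ?mul1n.
by move: h (ltn_ord i); move: (size _) => a; clear; lia.
Qed.

Lemma poly_derive_is p t : is_derive t (1 : R) (fun x => p.[x]) p^`().[t].
Proof. exact: (@chain_poly R p 1 0%N isT t). Qed.

Lemma poly_eq_deriv p q x : p^`() = q^`() -> p.[0] = q.[0] -> 0 <= x -> p.[x] = q.[x].
Proof.
move=> pq pq0 x0.
have d t : is_derive t (1 : R) (fun y => p.[y] - q.[y]) (0 : R).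
  by have := is_deriveB (poly_derive_is p t) (poly_derive_is q t); rewrite pq subrr.
have := mvt_bound d x0 (M := 0); rewrite mul0r /= => h.
have : `|p.[x] - q.[x] - (p.[0] - q.[0])| <= 0 by apply: h => t _; rewrite normr0.
by rewrite normr_le0 pq0 subrr subr0 subr_eq0 => /eqP.
Qed.

(** The moments are found by comparing derivatives and values at 0, which avoids binomial sums; each
    moment reduces to a lower one. *)
Lemma bernstein_id m x : 0 <= x -> \sum_(i < m.+2) (i%:R / m.+1%:R) * (bern m.+1 i).[x] = x.
Proof.
move=> x0; have N0 : m.+1%:R != 0 :> R by rewrite pnatr_eq0.
rewrite -(bernsteinE m.+1 (fun i => i%:R / m.+1%:R)) -[RHS](hornerX x).
apply: poly_eq_deriv => //; last by rewrite bernstein0 hornerX mul0r.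
rewrite deriv_bernstein derivX (eq_bigr (fun i : 'I_m.+1 => m.+1%:R^-1 *: bern m i)) => [|i _].
  by rewrite -scaler_sumr sum_bern scalerA mulfV// scale1r.
by congr (_ *: _); rewrite -natr1; field.
Qed.

Lemma bernstein_mean m x : 0 <= x -> \sum_(i < m.+1) i%:R * (bern m i).[x] = m%:R * x.
Proof.
case: m => [|m] x0; first by rewrite big_ord1 /= !mul0r.
have N0 : m.+1%:R != 0 :> R by rewrite pnatr_eq0.
rewrite -[in RHS](bernstein_id m x0) mulr_sumr; apply: eq_bigr => i _; by field.
Qed.

Lemma bernstein_sq m x : 0 <= x -> \sum_(i < m.+2) (i%:R / m.+1%:R) ^+ 2 * (bern m.+1 i).[x] = (m%:R * x ^+ 2 + x) / m.+1%:R.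
Proof.
move=> x0; have N0 : m.+1%:R != 0 :> R by rewrite pnatr_eq0.
rewrite -(bernsteinE m.+1 (fun i => (i%:R / m.+1%:R) ^+ 2)).
set B := bernstein _ _.
pose q : {poly R} := m.+1%:R^-1 *: (m%:R *: 'X^2 + 'X).
have qE y : q.[y] = (m%:R * y ^+ 2 + y) / m.+1%:R by rewrite /q !hornerE; field.
have dB y : 0 <= y -> (B^`()).[y] = (2 * (m%:R * y) + 1) / m.+1%:R.
  move=> y0; have -> : 2 * (m%:R * y) + 1 = \sum_(i < m.+1) (2 * i%:R + 1) * (bern m i).[y].
    rewrite -(bernstein_mean m y0) mulr_sumr -[X in _ + X](sum_bernx m y) -big_split /=.
    by apply: eq_bigr => i _; ring.
  rewrite deriv_bernstein hornerZ horner_sum mulr_sumr mulr_suml; apply: eq_bigr => i _.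
  by rewrite hornerZ -[i.+1%:R]natr1; field.
have dq y : (q^`()).[y] = (2 * (m%:R * y) + 1) / m.+1%:R.
  rewrite /q derivZ derivD derivZ derivXn derivX /= hornerZ hornerD hornerZ hornerMn expr1 hornerX.
  by rewrite hornerC -mulr_natl; field.
have d t : is_derive t (1 : R) (fun y => B.[y] - q.[y]) ((B^`()).[t] - (q^`()).[t]).
  exact: is_deriveB (poly_derive_is _ t) (poly_derive_is _ t).
have := mvt_bound d x0 (M := 0); rewrite mul0r /= => h.
have {}h : `|B.[x] - q.[x] - (B.[0] - q.[0])| <= 0.
  by apply: h => t /andP[t0 _]; rewrite dB// dq subrr normr0.
move: h; rewrite normr_le0 /B bernstein0 -/B !qE !mul0r expr0n /= mulr0 addr0 mul0r !subr0.
by rewrite subr_eq0 => /eqP.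
Qed.

Lemma bernstein_variance m x : 0 <= x <= 1 ->
  \sum_(i < m.+2) (i%:R / m.+1%:R - x) ^+ 2 * (bern m.+1 i).[x] <= m.+1%:R^-1.
Proof.
move=> /andP[x0 x1]; have N0 : m.+1%:R != 0 :> R by rewrite pnatr_eq0.
rewrite (eq_bigr (fun i : 'I_m.+2 => (i%:R / m.+1%:R) ^+ 2 * (bern m.+1 i).[x] -
  2 * x * (i%:R / m.+1%:R * (bern m.+1 i).[x]) + x ^+ 2 * (bern m.+1 i).[x])) => [|i _]; last by ring.
rewrite big_split sumrB /= -!mulr_sumr bernstein_id// bernstein_sq// sum_bernx.
have -> : (m%:R * x ^+ 2 + x) / m.+1%:R - 2 * x * x + x ^+ 2 * 1 = (x * (1 - x)) / m.+1%:R.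
  by rewrite -natr1; field; rewrite natr1.
by rewrite ler_pdivrMr ?ltr0n// mulVf//; nra.
Qed.

(** The weights are nonnegative with sum 1, and the variance of d about its mean is nonnegative. *)
Lemma bernstein_jensen m (d : nat -> R) x : 0 <= x <= 1 ->
  (\sum_(i < m.+1) d i * (bern m i).[x]) ^+ 2 <= \sum_(i < m.+1) d i ^+ 2 * (bern m i).[x].
Proof.
move=> x01; set D := \sum_(i < _) _.
have : 0 <= \sum_(i < m.+1) (d i - D) ^+ 2 * (bern m i).[x].
  by apply: sumr_ge0 => i _; rewrite mulr_ge0 ?sqr_ge0// bern_ge0.
rewrite (eq_bigr (fun i : 'I_m.+1 => d i ^+ 2 * (bern m i).[x] -
  2 * D * (d i * (bern m i).[x]) + D ^+ 2 * (bern m i).[x])) => [|i _]; last by ring.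
by rewrite big_split sumrB /= -!mulr_sumr sum_bernx -/D; lra.
Qed.

(** A basis polynomial is, up to the factor [m + 1], the derivative of the Bernstein polynomial of
    the step sequence at j, which goes from 0 to 1. *)
Lemma bern_integral m j : (j <= m)%N -> \int[leb]_(x in I) (bern m j).[x] = m.+1%:R^-1.
Proof.
move=> jm; have N0 : m.+1%:R != 0 :> R by rewrite pnatr_eq0.
pose F : {poly R} := m.+1%:R^-1 *: bernstein m.+1 (fun i => (j < i)%N%:R).
have dF t : is_derive t (1 : R) (fun x => F.[x]) (bern m j).[t].
  have -> : bern m j = F^`(); last exact: poly_derive_is.
  rewrite /F derivZ deriv_bernstein scalerA mulVf// scale1r (bigD1 (inord j))//= inordK// ltnS leqnn ltnn subr0 scale1r.
  rewrite big1 ?addr0// => i; rewrite -val_eqE /= inordK// => ij.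
  by rewrite ltnS leq_eqVlt eq_sym (negbTE ij) /= subrr scale0r.
have cb : continuous (fun x => (bern m j).[x]) by exact: (is_derive_continuous (poly_derive_is (bern m j))).
have := ftc_oo cb dF (lexx 0) ler01 (lexx 1); rewrite -/(I01) => <-; rewrite /F !hornerZ bernstein0 bernstein1 ltnS jm ltn0.
by rewrite mulr0 subr0 mulr1.
Qed.

Section bernstein_H1.
Variables (C : R) (g : R -> R).
Hypothesis g2 : L2 g.
Let h x := C + prim g x.
Let mI : measurable I. Proof. exact: measurable_I01. Qed.
Let gi : L1 g. Proof. exact: L2_L1. Qed.
Let g2i : L1 (fun x => g x ^+ 2).
Proof.
apply/integrableP; split; first by apply/measurable_EFinP; apply: measurable_funX; exact: L1_measurable.
apply: le_lt_trans g2.2; rewrite le_eqVlt; apply/orP; left; apply/eqP.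
by apply: eq_integral => x _; rewrite /= ger0_norm// sqr_ge0.
Qed.
Let E := \int[leb]_(x in I) (g x ^+ 2).

Let h_sq s t : 0 <= s -> s <= t -> t <= 1 ->
  (h t - h s) ^+ 2 <= (t - s) * (prim (fun x => g x ^+ 2) t - prim (fun x => g x ^+ 2) s).
Proof.
move=> s0 st t1; rewrite (primB g2i)// /h (_ : _ - _ = prim g t - prim g s); last ring.
rewrite (primB gi)//; set B := \int[leb]_(x in _) (_ ^+ 2).
have st_I := suboo_I01 s0 t1.
have B0 : 0 <= B by apply: Rintegral_ge0 => x _; exact: sqr_ge0.
have := @cauchy_schwarz_itv R g s t B gi s0 st t1; rewrite (RintE (measurable_itv _) st_I g2i) => /(_ (lexx _)) hc.
rewrite -real_normK ?num_real//; apply: (@le_trans _ _ (Num.sqrt (B * (t - s)) ^+ 2)).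
  by rewrite lerXn2r ?nnegrE ?sqrtr_ge0.
by rewrite sqr_sqrtr ?mulr_ge0 ?subr_ge0// mulrC.
Qed.

Let prim_E x y : 0 <= x -> x <= y -> y <= 1 -> 0 <= prim (fun x => g x ^+ 2) y - prim (fun x => g x ^+ 2) x <= E.
Proof.
move=> x0 xy y1; have mono a b : 0 <= a -> a <= b -> b <= 1 -> 0 <= prim (fun x => g x ^+ 2) b - prim (fun x => g x ^+ 2) a.
  by move=> a0 ab b1; rewrite (primB g2i)//; apply: Rintegral_ge0 => z _; exact: sqr_ge0.
have -> : E = prim (fun x => g x ^+ 2) 1 - prim (fun x => g x ^+ 2) 0 by rewrite (primB g2i).
have h1 := mono 0 x (lexx 0) x0 (le_trans xy y1); have h2 := mono x y x0 xy y1.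
have h3 := mono y 1 (le_trans x0 xy) y1 (lexx 1); apply/andP; split=> //; lra.
Qed.

(** Degree at most [m + 1]; the recovery sequence takes [m = k - 2] to stay below degree k. *)
Definition bern_approx m : {poly R} := bernstein m.+1 (fun i => h (i%:R / m.+1%:R)).

(** Jensen's inequality bounds the square of the averaged slopes by the average of their squares.
    Each weight has integral [1 / (m + 1)], and Cauchy-Schwarz on each mesh interval makes the sum
    telescope to E. *)
Lemma bern_approx_energy m : \int[leb]_(x in I) ((bern_approx m)^`().[x] ^+ 2) <= E.
Proof.
have N0 : 0 < m.+1%:R :> R by rewrite ltr0n.
pose d i := h (i.+1%:R / m.+1%:R) - h (i%:R / m.+1%:R).
have cp p : L1 (fun x => p.[x]) by apply: L1_continuous; exact: (is_derive_continuous (poly_derive_is p)).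
apply: (@le_trans _ _ (\int[leb]_(x in I) (\sum_(i < m.+1) (m.+1%:R ^+ 2 * d i ^+ 2) * (bern m i).[x]))).
  apply: Rint_le => //.
  - have -> : (fun x => (bern_approx m)^`().[x] ^+ 2) = fun x => ((bern_approx m)^`() ^+ 2).[x].
      by apply/funext => x; rewrite horner_exp.
    exact: cp.
  - by apply: (@L1_sum R m.+1 (fun i x => m.+1%:R ^+ 2 * d i ^+ 2 * (bern m i).[x])) => i; exact: L1Z.
  - move=> x /I01E/andP[x0 x1].
    have -> : (bern_approx m)^`().[x] = m.+1%:R * \sum_(i < m.+1) d i * (bern m i).[x].
      by rewrite deriv_bernstein hornerZ horner_sum; congr (_ * _); apply: eq_bigr => i _; rewrite hornerZ.
    have -> : \sum_(i < m.+1) m.+1%:R ^+ 2 * d i ^+ 2 * (bern m i).[x] = m.+1%:R ^+ 2 * \sum_(i < m.+1) d i ^+ 2 * (bern m i).[x].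
      by rewrite mulr_sumr; apply: eq_bigr => i _; rewrite mulrA.
    by rewrite exprMn ler_pM2l ?exprn_gt0//; apply: (@bernstein_jensen m d); rewrite !ltW.
rewrite (@Rint_sum R I m.+1 (fun i x => m.+1%:R ^+ 2 * d i ^+ 2 * (bern m i).[x]) mI (@subset_refl _ I)); last by move=> i; exact: L1Z.
pose G i := prim (fun x => g x ^+ 2) (i%:R / m.+1%:R).
apply: (@le_trans _ _ (\sum_(i < m.+1) (G i.+1 - G i))).
  apply: ler_sum => i _; have Li : L1 (fun x => (bern m i).[x]) := cp _.
  rewrite (RintZ mI (@subset_refl _ I) _ Li) bern_integral; last by rewrite -ltnS.
  have im : i.+1%:R / m.+1%:R <= 1 :> R by rewrite ler_pdivrMr// mul1r ler_nat.
  have il : i%:R / m.+1%:R <= i.+1%:R / m.+1%:R :> R by rewrite ler_pM2r ?invr_gt0// ler_nat.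
  have i0 : 0 <= i%:R / m.+1%:R :> R by exact: divr_ge0.
  have hd : d i ^+ 2 <= m.+1%:R^-1 * (G i.+1 - G i).
    have /le_trans := h_sq i0 il im; apply; rewrite -/(G i) -/(G i.+1) le_eqVlt; apply/orP; left; apply/eqP.
    by rewrite -mulrBl -[i.+1%:R]natr1 addrAC subrr add0r mul1r.
  have -> : m.+1%:R ^+ 2 * d i ^+ 2 / m.+1%:R = m.+1%:R * d i ^+ 2 by field; rewrite gt_eqF.
  by rewrite -ler_pdivlMl.
have -> : \sum_(i < m.+1) (G i.+1 - G i) = G m.+1 - G 0%N.
  by rewrite -(big_mkord xpredT (fun i => G i.+1 - G i)) telescope_sumr.
rewrite /G mul0r divff ?gt_eqF//.
by have /andP[] := prim_E (lexx 0) ler01 (lexx 1).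
Qed.

(** The modulus of continuity is put in the form [e / 2 + K * (y - x) ^+ 2], whose Bernstein average
    is controlled by the variance. *)
Lemma bern_approx_cvg e : 0 < e -> exists M, forall m, (M <= m)%N -> forall x, 0 <= x <= 1 ->
  `|(bern_approx m).[x] - h x| <= e.
Proof.
move=> e0; have E0 : 0 <= E by apply: Rintegral_ge0 => x _; exact: sqr_ge0.
(* From using [y <= e / 4 + y ^+ 2 / e] twice: once for the increment of h, once for the bound
   [r * E / e] of its square over e. *)
pose K := E ^+ 2 / e ^+ 3.
have K0 : 0 <= K by rewrite divr_ge0 ?exprn_ge0// ltW.
have amgm y : y <= e / 4 + y ^+ 2 / e.
  rewrite -subr_ge0 (_ : _ - _ = (y - e / 2) ^+ 2 / e); last by field; rewrite gt_eqF.
  by rewrite divr_ge0 ?sqr_ge0// ltW.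
have mod x y : 0 <= x <= 1 -> 0 <= y <= 1 -> `|h y - h x| <= e / 2 + K * (y - x) ^+ 2.
  wlog xy : x y / x <= y.
    move=> H hx hy; have [|/ltW] := leP x y; first by move=> xy; exact: H.
    by move=> yx; rewrite distrC (_ : (y - x) ^+ 2 = (x - y) ^+ 2); [exact: H|ring].
  move=> /andP[x0 x1] /andP[y0 y1]; set r := y - x.
  have hr : (h y - h x) ^+ 2 <= r * E.
    apply: (le_trans (h_sq x0 xy y1)); rewrite ler_wpM2l ?subr_ge0//.
    by have /andP[] := prim_E x0 xy y1.
  apply: (le_trans (amgm _)); rewrite real_normK ?num_real//.
  have h1 : (h y - h x) ^+ 2 / e <= r * E / e by rewrite ler_pM2r ?invr_gt0.
  have h2 := amgm (r * E / e).
  have -> : K * r ^+ 2 = (r * E / e) ^+ 2 / e by rewrite /K; field; rewrite gt_eqF.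
  by lra.
have [M hM] := @inv_nat_small R (2 * K) e e0.
exists M => m Mm x x01; rewrite /bern_approx bernsteinE.
have -> : h x = \sum_(i < m.+2) h x * (bern m.+1 i).[x] by rewrite -mulr_sumr sum_bernx mulr1.
rewrite -sumrB; apply: (le_trans (ler_norm_sum _ _ _)).
apply: (@le_trans _ _ (\sum_(i < m.+2) (e / 2 * (bern m.+1 i).[x] + K * ((i%:R / m.+1%:R - x) ^+ 2 * (bern m.+1 i).[x])))).
  apply: ler_sum => i _; rewrite -mulrBl normrM (ger0_norm (bern_ge0 _ _ x01)) mulrA -mulrDl.
  rewrite ler_wpM2r ?bern_ge0//; apply: mod => //.
  by rewrite divr_ge0//= ler_pdivrMr ?ltr0n// mul1r ler_nat -ltnS.
rewrite big_split /= -!mulr_sumr sum_bernx mulr1.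
have h1 := bernstein_variance m x01; have := hM m.+1 (leqW Mm).
move=> h2; have : K * (\sum_(i < m.+2) (i%:R / m.+1%:R - x) ^+ 2 * (bern m.+1 i).[x]) <= e / 2.
  apply: (@le_trans _ _ (K * m.+1%:R^-1)); first by rewrite ler_wpM2l.
  by rewrite ler_pdivlMr// mulrC mulrA.
by lra.
Qed.

End bernstein_H1.

End bernstein_polynomials.

(** * The transition profile *)

Section transition_profile.
Context {R : realType}.
Implicit Types (f g u v : R -> R) (p : {poly R}) (x y s t r : R) (m n N : nat).
Local Notation leb := (@lebesgue_measure R).
Local Notation I := (@I01 R).

Definition cut f x : R := if 0 < x < 1 then f x else 0.

(** At the ends both the value and the slope vanish, so gluing with 0 remains differentiable
    there. *)
Lemma cut_derive (f f' : R -> R) : (forall t, is_derive t (1 : R) f (f' t)) ->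
  f 0 = 0 -> f 1 = 0 -> f' 0 = 0 -> f' 1 = 0 -> forall t, is_derive t (1 : R) (cut f) (cut f' t).
Proof.
move=> df f0 f1 g0 g1 t; apply/is_deriveP => e e0.
have [t0|t0] := ltP t 0.
  exists (- t); first by rewrite oppr_gt0.
  move=> h; rewrite ltr_norml opprK => /andP[h1 h2]; rewrite /cut !(ltNge 0) (ltW t0) /=.
  have -> : t + h <= 0 by lra.
  by rewrite /= mul0r !subr0 normr0 mulr_ge0// ltW.
have [t1|t1] := ltP 1 t.
  exists (t - 1); first by rewrite subr_gt0.
  move=> h; rewrite ltr_norml => /andP[h1 h2]; rewrite /cut !(ltNge _ 1) (ltW t1) andbF /=.
  have -> : 1 <= t + h by lra.
  by rewrite andbF mul0r !subr0 normr0 mulr_ge0// ltW.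
have [d d0 hd] := (is_deriveP _ _ _).1 (df t) e e0.
have cutb x : cut f' x = 0 \/ cut f' x = f' x by rewrite /cut; case: ifP; [right|left].
have ct : cut f t = f t.
  rewrite /cut; case: ifPn => //; rewrite negb_and -!leNgt => /orP[h|h].
    by have -> : t = 0 by lra.
  by have -> : t = 1 by lra.
have ct' : cut f' t = f' t.
  rewrite /cut; case: ifPn => //; rewrite negb_and -!leNgt => /orP[h|h].
    by have -> : t = 0 by lra.
  by have -> : t = 1 by lra.
rewrite ct ct'; have [tin|] := boolP (0 < t < 1).
  case/andP: (tin) => t0' t1'; exists (Num.min d (Num.min t (1 - t))).
    by rewrite !lt_min d0 t0' subr_gt0.
  move=> h; rewrite !lt_min => /and3P[hd' h1 h2].
  have -> : cut f (t + h) = f (t + h).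
    rewrite /cut ifT//; move: h1 h2; rewrite !ltr_norml => /andP[? ?] /andP[? ?]; apply/andP; split; lra.
  exact: hd.
rewrite negb_and -!leNgt => tb.
have [ft ft'] : f t = 0 /\ f' t = 0.
  by case/orP: tb => h; [have -> : t = 0 by lra|have -> : t = 1 by lra].
exists d => // h hh; have := hd h hh; rewrite ft ft' mul0r !subr0 /cut.
by case: ifP => // _ _; rewrite normr0 mulr_ge0// ltW.
Qed.

Lemma cut_continuous f : continuous f -> f 0 = 0 -> f 1 = 0 -> continuous (cut f).
Proof.
move=> cf f0 f1; have -> : cut f = f \o (fun x => Num.max 0 (Num.min x 1)).
  apply/funext => x; rewrite /cut /=; have [x0|x0] := leP x 0.
    by rewrite /= (min_l (le_trans x0 ler01)) max_l ?f0.
  have [x1|x1] := leP 1 x; first by rewrite ?ltNge ?x1 /= ?(min_r x1) ?max_r ?f1.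
  by rewrite /= ?(min_l (ltW x1)) (max_r (ltW x0)).
move=> x; apply: continuous_comp; last exact: cf.
by apply: continuous_max; [exact: cst_continuous|apply: continuous_min; [exact: cvg_id|exact: cst_continuous]].
Qed.

Definition hat k : {poly R} := ('X * (1 - 'X)) ^+ k.

Lemma derivn_root k (c : R) q j : (j < k)%N -> ((('X - c%:P) ^+ k * q)^`(j)).[c] = 0.
Proof.
move=> jk; have : forall i, (i <= j)%N -> exists q', (('X - c%:P) ^+ k * q)^`(i) = ('X - c%:P) ^+ (k - i) * q'.
  elim=> [_|i IH ij]; first by exists q; rewrite derivn0 subn0.
  have [q' hq'] := IH (ltnW ij); exists (q' *+ (k - i) + ('X - c%:P) * q'^`()).
  rewrite derivnS hq' derivM deriv_exp derivXsubC mul1r mulrDr.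
  have -> : (k - i = (k - i.+1).+1)%N by lia.
  rewrite /= mulrnAl mulrnAr; congr (_ + _); rewrite exprSr mulrA//.
move=> /(_ j (leqnn j))[q' ->]; rewrite hornerM horner_exp !hornerE subrr expr0n.
by rewrite subn_eq0 leqNgt jk mul0r.
Qed.

Lemma hat_derivn0 k j : (j < k)%N -> ((hat k)^`(j)).[0] = 0.
Proof. by move=> jk; rewrite /hat exprMn -['X](subr0) -polyC0; exact: derivn_root. Qed.

Lemma hat_derivn1 k j : (j < k)%N -> ((hat k)^`(j)).[1] = 0.
Proof.
move=> jk; have -> : hat k = ('X - 1%:P) ^+ k * (- 'X) ^+ k; last exact: derivn_root.
by rewrite -exprMn /hat; congr (_ ^+ _); rewrite polyC1; ring.
Qed.

Lemma derivn_monic (q : {poly R}) n : q \is monic -> size q = n.+1 -> q^`(n) = (n`!)%:R%:P.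
Proof.
move=> /monicP lq sq; apply/polyP => i; rewrite coef_derivn coefC; case: i => [|i] /=.
  by rewrite addn0 ffactnn; move: lq; rewrite /lead_coef sq /= => ->.
by rewrite nth_default ?mul0rn// sq addnS ltnS leq_addr.
Qed.

Lemma hat_derivn_top k : (hat k)^`(k + k) = ((-1) ^+ k * ((k + k)`!)%:R)%:P.
Proof.
have E : hat k = (-1) ^+ k *: ('X ^+ k * ('X - 1%:P) ^+ k).
  rewrite -exprMn /hat -[RHS]mul_polyC polyC_exp -exprMn polyCN polyC1; congr (_ ^+ _); ring.
rewrite E derivnZ (@derivn_monic _ (k + k)).
- by rewrite -mul_polyC -polyCM.
- by rewrite rpredM ?monic_exp ?monicX ?monicXsubC.
- rewrite size_Mmonic ?monic_exp ?monicXsubC//; last by rewrite -size_poly_gt0 size_polyXn.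
  by rewrite size_polyXn size_exp_XsubC addnS.
Qed.

(** The Beta integral with both parameters [k + 1]. *)
Definition hat_mass k : R := \int[leb]_(x in I) (hat k).[x].

Lemma poly_continuous p : continuous (fun x => p.[x]).
Proof. exact: (is_derive_continuous (poly_derive_is p)). Qed.

(** Integrating by parts k times moves all derivatives onto one factor: the other becomes [hat k]
    again and the derivative of order [2 * k] is constant. F collects the boundary terms, which
    vanish since [hat k] has zeros of order k at 0 and 1. *)
Lemma hat_norm k : \int[leb]_(x in I) ((hat k)^`(k).[x] ^+ 2) = ((k + k)`!)%:R * hat_mass k.
Proof.
have mI : measurable I by exact: measurable_I01.
set p := hat k.
pose F n : {poly R} := \sum_(i < n) (-1) ^+ i *: (p^`(k + i) * p^`(k.-1 - i)).
have dF n : (n <= k)%N -> (F n)^`() = p^`(k) ^+ 2 - (-1) ^+ n *: (p^`(k + n) * p^`(k - n)).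
  elim: n => [_|n IH nk].
    by rewrite /F big_ord0 -polyC0 derivC addn0 subn0 expr0 scale1r expr2 subrr.
  rewrite /F big_ord_recr /= -/(F n) derivD IH ?(ltnW nk)// derivZ derivM -!derivnS.
  have -> : ((k.-1 - n).+1 = k - n)%N by lia.
  have -> : (k.-1 - n = k - n.+1)%N by lia.
  by rewrite addnS [(-1) ^+ n.+1]exprS mulN1r scaleNr opprK scalerDr; ring.
have cp q : L1 (fun x => q.[x]) by apply: L1_continuous; exact: poly_continuous.
have F0 : \int[leb]_(x in I) (F k)^`().[x] = 0.
  have := ftc_oo (@poly_continuous (F k)^`()) (poly_derive_is (F k)) (lexx 0) ler01 (lexx 1) => <-.
  have Fz c : (forall j, (j < k)%N -> (p^`(j)).[c] = 0) -> (F k).[c] = 0.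
    move=> h; rewrite horner_sum big1// => i _; rewrite hornerZ hornerM [X in _ * (_ * X)]h ?mulr0//.
    by have := ltn_ord i; lia.
  by rewrite !Fz ?subrr// => j jk; [exact: hat_derivn0|exact: hat_derivn1].
have E x : (F k)^`().[x] = p^`(k).[x] ^+ 2 - ((k + k)`!)%:R * p.[x].
  rewrite dF// subnn derivn0 hat_derivn_top mul_polyC scalerA mulrA -exprMn mulrNN mulr1 expr1n mul1r.
  by rewrite hornerD hornerN hornerZ horner_exp.
move: F0; under eq_Rintegral do rewrite E.
have L2p : L1 (fun x => p^`(k).[x] ^+ 2).
  by rewrite (_ : (fun x => _) = fun x => (p^`(k) ^+ 2).[x])//; apply/funext => x; rewrite horner_exp.
rewrite (RintB mI (@subset_refl _ I) L2p (L1Z _ (cp p))) (RintZ mI (@subset_refl _ I) _ (cp p)).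
by move=> /eqP; rewrite subr_eq0 => /eqP.
Qed.

Lemma hatE k x : (hat k).[x] = (x * (1 - x)) ^+ k.
Proof. by rewrite /hat horner_exp; congr (_ ^+ _); rewrite !hornerE. Qed.

Lemma bernoulli_le n x : 0 <= x <= 1 -> 1 - n%:R * x <= (1 - x) ^+ n.
Proof.
move=> /andP[x0 x1]; elim: n => [|n IH]; first by rewrite mul0r subr0 expr0.
have h : 0 <= 1 - x by lra.
rewrite exprSr; apply: (@le_trans _ _ ((1 - n%:R * x) * (1 - x))); last by rewrite ler_wpM2r.
have n0 : 0 <= n%:R :> R by [].
by rewrite -natr1; nra.
Qed.

(** Only the interval of half-width [1 / (4 * k)] about the midpoint is kept; there Bernoulli's
    inequality gives [(4 * x * (1 - x)) ^ k >= 1 / 2]. *)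
Lemma hat_mass_ge k : (0 < k)%N -> (4 ^+ k * (4 * k%:R))^-1 <= hat_mass k.
Proof.
move=> k0; have K0 : 1 <= k%:R :> R by rewrite ler1n.
have Kp : 0 < k%:R :> R by rewrite ltr0n.
pose d : R := (4 * k%:R)^-1; have d0 : 0 < d by rewrite invr_gt0 mulr_gt0.
have d4 : d <= 4^-1 by rewrite lef_pV2 ?posrE ?mulr_gt0// ler_peMr.
have mI : measurable I by exact: measurable_I01.
pose J : set R := `]2^-1 - d, 2^-1 + d[%classic.
have mJ : measurable J by exact: measurable_itv.
have hi : L1 (fun x => (hat k).[x]) by apply: L1_continuous; exact: poly_continuous.
have h0 x : I x -> 0 <= (hat k).[x].
  by move=> /I01E/andP[x0 x1]; rewrite hatE exprn_ge0//; apply: mulr_ge0; [exact: ltW|rewrite subr_ge0; exact: ltW].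
apply: (@le_trans _ _ (\int[leb]_(x in I) (4 ^- k / 2 * \1_J x))).
  have iL : L1 (\1_J : R -> R).
    have := L1_indic mJ (L1_cst 1); rewrite (_ : (fun x => _) = \1_J)//.
    by apply/funext => x; rewrite mul1r.
  rewrite (RintZ mI (@subset_refl _ I) _ iL).
  have -> : \int[leb]_(x in I) (\1_J x) = 2 * d.
    have := Rint_indic (fun=> 1) I J; under eq_Rintegral do rewrite mul1r.
    move=> ->; have -> : I `&` J = J by apply/setIidPr; apply: suboo_I01; lra.
    rewrite /Rintegral integral_cst//= mul1e [X in fine X](leb_oo _) /=; [by ring|lra].
  by rewrite invfM -/d; have := exprn_gt0 k (_ : 0 < 4 :> R) => h; rewrite le_eqVlt; apply/orP; left; apply/eqP; field; rewrite expf_neq0.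
apply: Rint_le => //.
  apply: L1Z; have := L1_indic mJ (L1_cst 1); rewrite (_ : (fun x => _) = \1_J)//.
  by apply/funext => x; rewrite mul1r.
move=> x Ix; rewrite indicE; case: (boolP (x \in J)) => [|_]; last by rewrite mulr0 h0.
rewrite inE /J /= in_itv /= => /andP[x1 x2]; rewrite mulr1 hatE.
have -> : x * (1 - x) = 4^-1 * (1 - 4 * (x - 2^-1) ^+ 2) by field.
rewrite exprMn exprVn ler_pM2l ?invr_gt0 ?exprn_gt0//.
have y2 : (x - 2^-1) ^+ 2 <= d ^+ 2 by nra.
have dk : d * k%:R = 4^-1 by rewrite /d; field; rewrite gt_eqF.
apply: (le_trans _ (bernoulli_le k _)); last by apply/andP; split; [rewrite mulr_ge0// sqr_ge0|nra].
have : k%:R * (x - 2^-1) ^+ 2 <= k%:R * d ^+ 2 by rewrite ler_pM2l.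
have -> : k%:R * d ^+ 2 = d / 4 by rewrite expr2 mulrCA mulrA dk; ring.
by lra.
Qed.

Lemma hat_mass_gt0 k : (0 < k)%N -> 0 < hat_mass k.
Proof. by move=> k0; apply: lt_le_trans (hat_mass_ge k0); rewrite invr_gt0 !mulr_gt0 ?exprn_gt0// ltr0n. Qed.

Lemma central_factorial k : ((k + k)`! <= 4 ^ k * k`! ^ 2)%N.
Proof.
have h : ('C(k + k, k) <= 4 ^ k)%N.
  have -> : (4 ^ k = 2 ^ (k + k))%N by rewrite addnn -mul2n expnM.
  rewrite -[X in (_ <= X ^ _)%N]/(1 + 1)%N expnDn (bigD1 (inord k))//= inordK ?ltnS ?leq_addr//.
  by rewrite !exp1n !muln1 leq_addr.
by rewrite -(@bin_fact (k + k) k) ?leq_addr// addnK mulnA -mulnA mulnn leq_mul2r h orbT.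
Qed.

(** Order 0 climbs from 0 to 1 on the unit interval and is constant outside; the higher orders are
    cut to 0 outside. The top order k is a derivative of order [k - 1] of [hat k], which still
    vanishes at the ends, so it is continuous. *)
Definition profile k j : R -> R :=
  if j is j'.+1 then fun x => cut (fun y => ((hat k)^`(j')).[y]) x / hat_mass k
  else fun x => prim (fun y => (hat k).[y]) x / hat_mass k.

Lemma profile_chain k : chain (profile k) k.
Proof.
case: k => // k [_|j jk] t.
  have hL : L1 (fun y => (hat k.+1).[y]) by apply: L1_continuous; exact: poly_continuous.
  have E : (fun y => (hat k.+1).[y]) \_ I = cut (fun y => (hat k.+1).[y]).
    apply/funext => x; rewrite patchE /cut; case: ifPn => [|]; rewrite ?inE.
      by move=> /I01E ->.
    by move=> /negP h; case: ifPn => // x01; case: h; rewrite inE; apply/I01E.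
  have h0 : (hat k.+1).[0] = 0 := @hat_derivn0 k.+1 0 isT.
  have h1 : (hat k.+1).[1] = 0 := @hat_derivn1 k.+1 0 isT.
  have cc : continuous (cut (fun y => (hat k.+1).[y])) by apply: cut_continuous => //; exact: poly_continuous.
  have := Prim_is_derive (integrable_patch hL) (_ : {for t, continuous ((fun y => (hat k.+1).[y]) \_ I)}).
  rewrite [X in {for t, continuous X}]E => /(_ (cc t)) h; have h2 := is_deriveZ (hat_mass k.+1)^-1 h.
  rewrite (_ : profile k.+1 0 = (hat_mass k.+1)^-1 \*: Prim ((fun y => (hat k.+1).[y]) \_ I)); last first.
    by apply/funext => x; rewrite /= /prim /GRing.scale /= mulrC.
  rewrite (_ : profile k.+1 1 t = (hat_mass k.+1)^-1 *: ((fun y => (hat k.+1).[y]) \_ I) t)//.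
  by rewrite E /GRing.scale /= mulrC.
rewrite /=; have h := @cut_derive (fun y => ((hat k.+1)^`(j)).[y]) (fun y => ((hat k.+1)^`(j.+1)).[y]).
have {}h := h _ (hat_derivn0 (ltnW jk)) (hat_derivn1 (ltnW jk)) (hat_derivn0 jk) (hat_derivn1 jk) t.
have {}h := is_deriveZ (hat_mass k.+1)^-1 (h _).
rewrite (_ : (fun x => _) = (hat_mass k.+1)^-1 *: cut (fun y => ((hat k.+1)^`(j)).[y])); last first.
  by apply/funext => x; rewrite /GRing.scale /= mulrC.
rewrite mulrC; apply: h => y; rewrite derivnS; exact: poly_derive_is.
Qed.

Lemma profile_top_continuous k : (0 < k)%N -> continuous (profile k k).
Proof.
case: k => // k _ x; apply: cvgM; last exact: cvg_cst.
by apply: cut_continuous; [exact: poly_continuous|exact: hat_derivn0|exact: hat_derivn1].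
Qed.

Lemma profile_out k j x : ~~ (0 < x < 1) -> profile k j.+1 x = 0.
Proof. by move=> /negbTE h; rewrite /= /cut h mul0r. Qed.

Lemma profile_le0 k x : x <= 0 -> profile k 0 x = 0.
Proof.
move=> x0; rewrite /= primE (_ : _ `&` _ = set0) ?Rintegral_set0 ?mul0r//.
rewrite -subset0 => y [/=]; rewrite in_itv /= => yx /I01E/andP[y0 _]; lra.
Qed.

Lemma profile_ge1 k x : (0 < k)%N -> 1 <= x -> profile k 0 x = 1.
Proof.
move=> k0 x1; rewrite /= primE (_ : _ `&` _ = I) ?divff ?gt_eqF ?hat_mass_gt0//.
by apply/setIidPr => y /I01E/andP[_ y1]; rewrite /= in_itv /=; lra.
Qed.

Lemma profile_itv k x : (0 < k)%N -> 0 <= profile k 0 x <= 1.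
Proof.
move=> k0; have [x0|x0] := leP x 0; first by rewrite profile_le0// lexx ler01.
have [x1|x1] := leP 1 x; first by rewrite profile_ge1// ler01 lexx.
have hL : L1 (fun y => (hat k).[y]) by apply: L1_continuous; exact: poly_continuous.
have pos y : I y -> 0 <= (hat k).[y].
  by move=> /I01E/andP[y0 y1]; rewrite hatE exprn_ge0//; apply: mulr_ge0; [exact: ltW|rewrite subr_ge0; exact: ltW].
have N0 := hat_mass_gt0 k0; rewrite /= ler_pdivlMr// ler_pdivrMr// mul0r mul1r.
have p0 : prim (fun y => (hat k).[y]) 0 = 0.
  by have /eqP := @profile_le0 k 0 (lexx 0); rewrite /= mulf_eq0 invr_eq0 (gt_eqF N0) orbF => /eqP.
have p1 : prim (fun y => (hat k).[y]) 1 = hat_mass k.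
  by have := @profile_ge1 k 1 k0 (lexx 1); rewrite /= => /divr1_eq.
have h1 := primB hL (lexx 0) (ltW x0) (ltW x1); have h2 := primB hL (ltW x0) (ltW x1) (lexx 1).
have i1 : 0 <= \int[leb]_(y in `]0, x[) (hat k).[y].
  by apply: Rintegral_ge0 => y hy; apply: pos; exact: (suboo_I01 (lexx 0) (ltW x1)).
have i2 : 0 <= \int[leb]_(y in `]x, 1[) (hat k).[y].
  by apply: Rintegral_ge0 => y hy; apply: pos; exact: (suboo_I01 (ltW x0) (lexx 1)).
rewrite p0 subr0 in h1; rewrite p1 in h2.
by rewrite h1 i1 /= -h1 -subr_ge0 h2.
Qed.

(** Cauchy-Schwarz from the zero at 0 bounds the square of the derivative of order [k - 1] of
    [hat k] by [(2 * k)! * hat_mass k]. Division by the squared mass leaves [(2 * k)! / hat_mass k],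
    and each of the two factors contributes one [4 ^ k]. *)
Lemma profile_top_sq k x : (0 < k)%N -> profile k k x ^+ 2 <= 4 * k%:R * 16 ^+ k * k`!%:R ^+ 2.
Proof.
case: k => // k k0; have N0 := hat_mass_gt0 k0; set N := hat_mass k.+1 in N0.
have [x01|h] := boolP (0 < x < 1); last by rewrite profile_out// expr0n /= !mulr_ge0// exprn_ge0.
case/andP: (x01) => x0 x1; rewrite /= /cut x01 -/N.
set f := fun y => ((hat k.+1)^`(k.+1)).[y].
have cf : continuous f by exact: poly_continuous.
have h0 : ((hat k.+1)^`(k)).[0] = 0 by exact: hat_derivn0.
have df t : is_derive t (1 : R) (fun y => ((hat k.+1)^`(k)).[y]) (f t).
  by rewrite /f derivnS; exact: poly_derive_is.
have e1 := ftc_oo cf df (lexx 0) (ltW x0) (ltW x1); rewrite h0 subr0 in e1.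
have f2L : L1 (fun y => f y ^+ 2).
  by apply: L1_continuous => y; apply: cvgM; exact: cf.
set B := ((k.+1 + k.+1)`!)%:R * N.
have B0 : 0 <= B by rewrite mulr_ge0// ltW.
have sub := suboo_I01 (lexx 0) (ltW x1).
have hB : (\int[leb]_(y in `]0%R, x[) (f y ^+ 2)%:E <= B%:E)%E.
  rewrite -[B]hat_norm -(RintE measurable_I01 (@subset_refl _ I) f2L).
  apply: ge0_subset_integral; [exact: measurable_itv|exact: measurable_I01| | |exact: sub].
    by apply/measurable_EFinP; exact: L1_measurable.
  by move=> y _; rewrite lee_fin sqr_ge0.
have := cauchy_schwarz_itv (L1_continuous cf) (lexx 0) (ltW x0) (ltW x1) hB; rewrite -e1 subr0 => hc.
have hs : ((hat k.+1)^`(k)).[x] ^+ 2 <= B.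
  rewrite -real_normK ?num_real//; apply: (@le_trans _ _ (Num.sqrt (B * x) ^+ 2)).
    by rewrite lerXn2r ?nnegrE ?sqrtr_ge0.
  have Bx : 0 <= B * x by rewrite mulr_ge0// ltW.
  by rewrite (sqr_sqrtr Bx) ler_piMr// ltW.
rewrite exprMn exprVn ler_pdivrMr ?exprn_gt0//; apply: (le_trans hs).
rewrite /B [N ^+ 2]expr2 [leRHS]mulrA (ler_pM2r N0).
have hf : ((k.+1 + k.+1)`!)%:R <= 4 ^+ k.+1 * k.+1`!%:R ^+ 2 :> R.
  by rewrite -!natrX -natrM ler_nat central_factorial.
apply: (le_trans hf); have hN := hat_mass_ge k0; rewrite -/N in hN.
have q0 : 0 < 4 ^+ k.+1 * (4 * k.+1%:R) :> R by rewrite !mulr_gt0 ?exprn_gt0.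
have : 1 <= 4 ^+ k.+1 * (4 * k.+1%:R) * N by move: hN; rewrite -(ler_pM2l q0) (mulfV (lt0r_neq0 q0)).
move=> h1; have -> : 16 ^+ k.+1 = 4 ^+ k.+1 * 4 ^+ k.+1 :> R by rewrite -exprMn; congr (_ ^+ _); ring.
have F0 : 0 <= 4 ^+ k.+1 * k.+1`!%:R ^+ 2 :> R by rewrite mulr_ge0 ?exprn_ge0.
have := ler_wpM2l F0 h1; rewrite mulr1 => /le_trans; apply; rewrite le_eqVlt; apply/orP; left; apply/eqP; ring.
Qed.

End transition_profile.

(** * Recovery sequences *)

Section recovery_sequences.
Context {R : realType}.
Implicit Types (f g u v : R -> R) (p : {poly R}) (x y s t r : R) (m n N : nat).
Local Notation leb := (@lebesgue_measure R).
Local Notation I := (@I01 R).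

Lemma prim0 g : prim g 0 = 0.
Proof.
rewrite primE (_ : _ `&` _ = set0) ?Rintegral_set0//.
rewrite -subset0 => y [/=]; rewrite in_itv /= => yx /I01E/andP[y0 _]; lra.
Qed.

Lemma L2_continuous f : continuous f -> L2 f.
Proof.
move=> cf; split; first by apply: measurable_funTS; exact: continuous_measurable_fun.
have c2 : continuous (fun t => f t ^+ 2) by move=> t; apply: cvgM; exact: cf.
have /integrableP[_] := L1_continuous c2; apply: le_lt_trans; rewrite le_eqVlt; apply/orP; left; apply/eqP.
by apply: eq_integral => x _; rewrite /= ger0_norm// sqr_ge0.
Qed.

Section chain_sobolev.
Variables (k : nat) (q : nat -> R -> R).
Hypotheses (cq : chain q k) (ck_ : continuous (q k)).
Let mI : measurable I. Proof. exact: measurable_I01. Qed.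

Let cont j : (j <= k)%N -> continuous (q j).
Proof. by rewrite leq_eqVlt => /predU1P[->//|jk]; exact: chain_continuous cq jk. Qed.

Let ibp j phi : (j < k)%N -> @test_function R phi ->
  \int[leb]_(t in I) (q j t * derive1 phi t) = - \int[leb]_(t in I) (q j.+1 t * phi t).
Proof.
move=> jk tphi; have c1 : continuous (derive1 phi) := @smooth_continuous R _ 1 (test_smooth tphi).
have fi : L1 (q j.+1) := L1_continuous (cont jk).
rewrite -(integration_by_parts_prim fi tphi).
have E t : t \in I -> q j t * derive1 phi t = prim (q j.+1) t * derive1 phi t + q j 0 * derive1 phi t.
  rewrite inE => /I01E/andP[t0 t1]; rewrite -mulrDl; congr (_ * _).
  have h1 := ftc_oo (cont jk) (cq jk) (lexx 0) (ltW t0) (ltW t1).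
  have h2 := primB fi (lexx 0) (ltW t0) (ltW t1); rewrite prim0 subr0 in h2.
  by rewrite h2 -h1 subrK.
rewrite (eq_Rintegral leb E) (RintD mI (@subset_refl _ I)).
- by rewrite (RintZ mI (@subset_refl _ I) _ (L1_continuous c1)) test_integral_derive// mulr0 addr0.
- by apply: integrable_mul_continuous => //; apply: L1_continuous; exact: prim_continuous.
- by apply: L1Z; exact: L1_continuous.
Qed.

Lemma chain_weak_derivative j : (j <= k)%N -> is_weak_derivative j (q 0%N) (q j).
Proof.
move=> jk; split; [apply: L1_locint; apply: L1_continuous; exact: cont|apply: L1_locint; apply: L1_continuous; exact: cont|].
elim: j jk => [_ phi _|j IH jk phi tphi]; first by rewrite expr0 mul1r.
by rewrite derive1Sn (IH (ltnW jk) _ (test_derive 1 tphi)) ibp// exprS mulN1r mulrN mulNr.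
Qed.

Lemma chain_sobolevH : sobolevH k (q 0%N).
Proof. by move=> j jk; exists (q j); [exact: chain_weak_derivative|apply: L2_continuous; exact: cont]. Qed.

Lemma chain_Phi (eps c : nat -> R) : (0 < k)%N -> Phi eps c k (q 0%N) =
  (\int[leb]_(t in I) (Num.min (q 1%N t ^+ 2) (1 / eps k) + c k * eps k ^+ (2 * k - 1) * q k t ^+ 2)%:E)%E.
Proof.
move=> k0; rewrite /Phi asboolT; last exact: chain_sobolevH.
have wd j : (j <= k)%N -> measurable_fun I (weak_derivative j (q 0%N)) /\
    {ae leb, forall t, I t -> weak_derivative j (q 0%N) t = q j t}.
  move=> jk; have [h [mw _]] := weak_derivativeP chain_sobolevH jk; split=> //.
  exact: weak_derivative_unique h (chain_weak_derivative jk).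
have [m1 a1] := wd 1%N k0; have [mk ak] := wd k (leqnn k).
have mcont j : (j <= k)%N -> measurable_fun I (q j).
  by move=> jk; apply: measurable_funTS; apply: continuous_measurable_fun; exact: cont.
have mden (a b : R -> R) : measurable_fun I a -> measurable_fun I b -> measurable_fun I (fun t =>
    (Num.min (a t ^+ 2) (1 / eps k) + c k * eps k ^+ (2 * k - 1) * b t ^+ 2)%:E).
  move=> ma mb; apply/measurable_EFinP; apply: measurable_funD.
    by apply: measurable_minr; [exact: measurable_funX|exact: measurable_cst].
  by apply: measurable_funM; [exact: measurable_cst|exact: measurable_funX].
apply: ae_eq_integral; [exact: mI|exact: mden|by apply: mden; exact: mcont|].
by apply: aeS (aeI a1 ak) => t [h1 h2] It; rewrite /= h1// h2.
Qed.

End chain_sobolev.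

Lemma chainD q (q' : nat -> R -> R) m : chain q m -> chain q' m -> chain (fun j t => q j t + q' j t) m.
Proof. by move=> h h' j jm t; exact: is_deriveD (h j jm t) (h' j jm t). Qed.

Lemma chainZ (c : R) q m : chain q m -> chain (fun j t => c * q j t) m.
Proof. by move=> h j jm t; exact: (is_deriveZ c (h j jm t)). Qed.

Lemma chain_seq_sum (s : seq R) (Q : R -> nat -> R -> R) m : (forall a, chain (Q a) m) ->
  chain (fun j t => \sum_(a <- s) Q a j t) m.
Proof.
move=> h; elim: s => [|a s IH].
  rewrite (_ : (fun j t => _) = fun _ _ => 0); first by move=> j _ t; exact: is_derive_cst.
  by apply/funext => j; apply/funext => t; rewrite big_nil.
rewrite (_ : (fun j t => _) = fun j t => Q a j t + \sum_(b <- s) Q b j t); first exact: chainD.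
by apply/funext => j; apply/funext => t; rewrite big_cons.
Qed.

(** The two bounds meet here: the powers of 16 cancel up to a constant and the factorials up to
    [n! / (n - 4)!], of degree 4 in n. Its square and the factor n give the exponent 9, below the 12
    in [ck]. *)
Lemma kap_hat n : (4 <= n)%N -> kap (n - 2) ^+ 2 * (4 * n%:R * 16 ^+ n * n`!%:R ^+ 2) <= 16 ^+ 5 * n%:R ^+ 9 :> R.
Proof.
move=> n4; have [k ->] : exists k, n = (k + 4)%N by exists (n - 4)%N; lia.
rewrite /kap (_ : (k + 4 - 2 - 2 = k)%N); last lia.
have F0 : k`!%:R != 0 :> R by rewrite pnatr_eq0 -lt0n fact_gt0.
have P0 : 4 ^+ k != 0 :> R by rewrite expf_neq0.
have fE : (k + 4)`!%:R = (k%:R + 4) * (k%:R + 3) * (k%:R + 2) * (k%:R + 1) * k`!%:R :> R.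
  rewrite (_ : (k + 4)`! = (k + 4) * ((k + 3) * ((k + 2) * ((k + 1) * k`!))))%N.
    by rewrite !natrM !natrD; ring.
  by rewrite !addnS addn0 !factS.
have -> : (16 : R) ^+ (k + 4) = 4 ^+ k * 4 ^+ k * 16 ^+ 4 by rewrite exprD -exprMn; congr (_ ^+ _ * _); ring.
have -> : (2 * 4 ^- k / k`!%:R) ^+ 2 * (4 * (k + 4)%:R * (4 ^+ k * 4 ^+ k * 16 ^+ 4) * (k + 4)`!%:R ^+ 2) =
    16 ^+ 5 * (k + 4)%:R * ((k%:R + 4) * (k%:R + 3) * (k%:R + 2) * (k%:R + 1)) ^+ 2 :> R.
  by rewrite fE; field; rewrite P0 F0.
have K0 : 0 <= k%:R :> R by [].
rewrite natrD [(k%:R + 4) ^+ 9]exprS mulrA; apply: ler_wpM2l; first by rewrite mulr_ge0 ?exprn_ge0// addr_ge0.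
have -> : (k%:R + 4) ^+ 8 = ((k%:R + 4) ^+ 4) ^+ 2 :> R by rewrite -exprM.
have h4 : (k%:R + 4) * (k%:R + 3) * (k%:R + 2) * (k%:R + 1) <= (k%:R + 4) ^+ 4 :> R.
  rewrite (_ : (k%:R + 4) ^+ 4 = (k%:R + 4) * (k%:R + 4) * (k%:R + 4) * (k%:R + 4)); last ring.
  have h i : 0 <= k%:R + i%:R :> R by rewrite addr_ge0.
  by rewrite !ler_pM// ?mulr_ge0//; lra.
have h0 : 0 <= (k%:R + 4) * (k%:R + 3) * (k%:R + 2) * (k%:R + 1) :> R by rewrite !mulr_ge0//; lra.
by apply: lerXn2r h4; rewrite nnegrE// exprn_ge0//; lra.
Qed.

Section recovery.
Variables (mu C : R) (g : R -> R) (s : seq R) (z : R -> R) (k : nat) (e : R).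
Hypotheses (mu0 : 0 < mu) (e0 : 0 < e) (k4 : (4 <= k)%N) (g2 : L2 g).
Let mI : measurable I. Proof. exact: measurable_I01. Qed.
Let c := (e * mu)^-1.
Let em0 : 0 < e * mu. Proof. exact: mulr_gt0. Qed.
Let c0 : 0 < c. Proof. by rewrite invr_gt0. Qed.
Let k0 : (0 < k)%N. Proof. exact: leq_trans k4. Qed.
Let b := bern_approx C g (k - 2).

(** The derivative of order j of the recovery function. The factor c dilates the profile to width
    [e * mu], on which a density capped at [1 / e] costs mu. *)
Definition recov j t : R := b^`(j).[t] + \sum_(a <- s) z a * (c ^+ j * profile k j (- (a * c) + c * t)).

Lemma recov_chain : chain recov k.
Proof.
apply: chainD; first exact: chain_poly.
by apply: chain_seq_sum => a; apply: chainZ; apply: chain_affine; exact: profile_chain.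
Qed.

Lemma b_top : b^`(k) = 0.
Proof. by apply: derivn_poly0; apply: (leq_trans (size_bernstein _ _)); lia. Qed.

Lemma recov_top_continuous : continuous (recov k).
Proof.
have -> : recov k = fun t => \sum_(a <- s) z a * (c ^+ k * profile k k (- (a * c) + c * t)).
  by apply/funext => t; rewrite /recov b_top horner0 add0r.
elim: s => [|a s' IH].
  rewrite (_ : (fun t => _) = fun=> 0); first exact: cst_continuous.
  by apply/funext => t; rewrite big_nil.
rewrite (_ : (fun t => _) = fun t => z a * (c ^+ k * profile k k (- (a * c) + c * t)) +
    \sum_(x <- s') z x * (c ^+ k * profile k k (- (x * c) + c * t))); last first.
  by apply/funext => t; rewrite big_cons.
move=> t; apply: cvgD; last exact: IH.
apply: cvgM; first exact: cvg_cst.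
apply: cvgM; first exact: cvg_cst.
apply: (@continuous_comp _ _ _ (fun x => - (a * c) + c * x) (profile k k)); last exact: profile_top_continuous.
by apply: cvgD; [exact: cvg_cst|apply: cvgM; [exact: cvg_cst|exact: cvg_id]].
Qed.

Let J a : set R := `]a, a + e * mu[%classic.
(** Number of transition intervals that contain t. Overlaps are allowed: wherever this is at least
    1, the density is bounded by a constant multiple of it. *)
Let n t : R := \sum_(a <- s) \1_(J a) t.

Let inJ a t : (0 < - (a * c) + c * t < 1) = (t \in J a).
Proof.
rewrite [in LHS]addrC [c * t]mulrC -mulrBl -(ltr_pM2r em0) -[X in _ && X](ltr_pM2r em0) mul0r mul1r.
rewrite /c mulfVK ?gt_eqF// subr_gt0 ltrBlDl.
by apply/idP/idP; rewrite inE /J /= in_itv.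
Qed.

Let Z := \sum_(a <- s) `|z a|.
Let S : R := 4 * k%:R * 16 ^+ k * k`!%:R ^+ 2.

Let n_ge0 t : 0 <= n t. Proof. by apply: sumr_ge0 => a _; rewrite indicE. Qed.

Let nP t : (forall a, a \in s -> t \notin J a) \/ 1 <= n t.
Proof.
have [/hasP[a as_ ta]|/hasPn h] := boolP (has (fun a => t \in J a) s); last by left.
right; rewrite /n (big_rem a)//= indicE ta lerDl; apply: sumr_ge0 => x _; by rewrite indicE.
Qed.

Let recov_off j t : (forall a, a \in s -> t \notin J a) -> recov j.+1 t = b^`(j.+1).[t].
Proof.
move=> h; rewrite /recov big1_seq ?addr0// => a /andP[_ as_].
by rewrite profile_out ?mulr0// inJ h.
Qed.

Let top_bound t : recov k t ^+ 2 <= Z ^+ 2 * c ^+ (2 * k) * S.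
Proof.
have S0 : 0 <= S by rewrite /S !mulr_ge0// exprn_ge0.
rewrite /recov b_top horner0 add0r.
have Y0 : 0 <= c ^+ k * Num.sqrt S by rewrite mulr_ge0 ?sqrtr_ge0// exprn_ge0// ltW.
have h : `|\sum_(a <- s) z a * (c ^+ k * profile k k (- (a * c) + c * t))| <= Z * (c ^+ k * Num.sqrt S).
  rewrite /Z mulr_suml; apply: (le_trans (ler_norm_sum _ _ _)); apply: ler_sum => a _.
  rewrite normrM ler_wpM2l// normrM ger0_norm ?exprn_ge0 ?(ltW c0)// ler_wpM2l ?exprn_ge0 ?(ltW c0)//.
  by rewrite -sqrtr_sqr ler_wsqrtr// profile_top_sq.
rewrite -real_normK ?num_real//; apply: (@le_trans _ _ ((Z * (c ^+ k * Num.sqrt S)) ^+ 2)).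
  by rewrite lerXn2r ?nnegrE// mulr_ge0//; apply: sumr_ge0 => a _.
by rewrite !exprMn sqr_sqrtr// mulnC exprM mulrA.
Qed.

Let nL1 : L1 n.
Proof.
apply: (@L1_le R _ (fun=> (size s)%:R)); [|exact: L1_cst|].
  apply: measurable_funTS; rewrite /n; elim: s => [|a s' IH].
    by under eq_fun do rewrite big_nil; exact: measurable_cst.
  under eq_fun do rewrite big_cons; apply: measurable_funD => //; apply: measurable_indic; exact: measurable_itv.
move=> t _; rewrite ger0_norm// /n -sum1_size natr_sum; apply: ler_sum => a _.
by rewrite indicE; case: (_ \in _); rewrite ?ler01.
Qed.

Let J_int a : \int[leb]_(t in I) (\1_(J a) t) <= e * mu.
Proof.
have := Rint_indic (fun=> 1) I (J a); under eq_Rintegral do rewrite mul1r; move=> ->.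
have mJ : measurable (J a) by exact: measurable_itv.
have mIJ : measurable (I `&` J a) by exact: measurableI.
rewrite -lee_fin -RintE//; last exact: L1_cst.
rewrite integral_cst// mul1e; apply: (@le_trans _ _ (leb (J a))).
  by apply: le_measure; rewrite ?inE//; exact: subIsetr.
have ae : a <= a + e * mu by rewrite lerDl ltW.
by rewrite /J [X in (X <= _)%E](leb_oo ae) lee_fin addrAC subrr add0r.
Qed.

Let indL1 a : L1 (\1_(J a) : R -> R).
Proof.
have mJ : measurable (J a) by exact: measurable_itv.
have := L1_indic mJ (L1_cst 1); rewrite (_ : (fun x => _) = \1_(J a))//.
by apply/funext => x; rewrite mul1r.
Qed.

Let sum_int (w : R -> R) : (forall a, 0 <= w a) ->
  L1 (fun t => \sum_(a <- s) w a * \1_(J a) t) /\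
  \int[leb]_(t in I) (\sum_(a <- s) w a * \1_(J a) t) <= (\sum_(a <- s) w a) * (e * mu).
Proof.
move=> w0; elim: s => [|a s' [IL IH]].
  split; first by under eq_fun do rewrite big_nil; exact: L1_cst.
  under eq_Rintegral do rewrite big_nil -(mulr0 0).
  by rewrite (RintZ mI (@subset_refl _ I) _ (L1_cst 0)) big_nil !mul0r.
split.
  by under eq_fun do rewrite big_cons; apply: L1D => //; exact: L1Z.
under eq_Rintegral do rewrite big_cons.
rewrite (RintD mI (@subset_refl _ I) (L1Z _ (indL1 a)) IL) (RintZ mI (@subset_refl _ I) _ (indL1 a)) big_cons mulrDl.
by apply: lerD; [apply: ler_wpM2l; [exact: w0|exact: J_int]|exact: IH].
Qed.

(** Off the transitions only the Bernstein part is seen, without derivative of order k. On them the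
    truncation caps the first term at [1 / e], which costs mu per jump, and the top-order term is a
    remainder that vanishes with k. *)
Lemma recov_energy (eps : nat -> R) : eps k = e ->
  (Phi eps (ck mu) k (recov 0) <= (\int[leb]_(t in I) (g t ^+ 2) + mu * (size s)%:R +
    (16 ^+ 5 * Z ^+ 2 * mu ^- 3 * (size s)%:R) / k%:R)%:E)%E.
Proof.
move=> ek; rewrite (chain_Phi recov_chain recov_top_continuous)// ek.
set K := ck mu k * e ^+ (2 * k - 1).
have K0 : 0 <= K by rewrite mulr_ge0 ?exprn_ge0 ?(ltW e0)// ltW// ck_gt0.
set M := Z ^+ 2 * c ^+ (2 * k) * S.
have M0 : 0 <= M by apply: le_trans (top_bound 0); exact: sqr_ge0.
have W0 : 0 <= 1 / e + K * M by apply: addr_ge0; [rewrite divr_ge0// ltW|exact: mulr_ge0].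
have db2 : L1 (fun t => b^`().[t] ^+ 2).
  by rewrite (_ : (fun x => _) = fun x => (b^`() ^+ 2).[x]); [apply: L1_continuous; exact: poly_continuous|apply/funext => x; rewrite horner_exp].
have bd t : Num.min (recov 1 t ^+ 2) (1 / e) + K * recov k t ^+ 2 <= b^`().[t] ^+ 2 + (1 / e + K * M) * n t.
  have [h|h] := nP t.
    have -> : recov k t = 0 by case: (k) k0 recov_off b_top => // k' _ ro bt; rewrite ro// bt horner0.
    rewrite recov_off// derivn1 expr0n mulr0 addr0 ge_min; apply/orP; left.
    by rewrite lerDl mulr_ge0.
  have h1 : Num.min (recov 1 t ^+ 2) (1 / e) <= 1 / e by rewrite ge_min lexx orbT.
  have h2 : K * recov k t ^+ 2 <= K * M by rewrite ler_wpM2l// top_bound.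
  have h3 : 1 / e + K * M <= (1 / e + K * M) * n t by rewrite ler_peMr.
  have h4 := sqr_ge0 (b^`().[t]); lra.
have [sL sI] := sum_int (fun=> ler01).
have nE t : \sum_(a <- s) 1 * \1_(J a) t = n t by apply: eq_bigr => a _; rewrite mul1r.
have nI : \int[leb]_(t in I) (n t) <= (size s)%:R * (e * mu).
  move: sI; under eq_Rintegral do rewrite nE.
  by have -> : \sum_(a <- s) 1 = (size s)%:R :> R by rewrite -sum1_size natr_sum.
apply: (@le_trans _ _ (\int[leb]_(t in I) (b^`().[t] ^+ 2 + (1 / e + K * M) * n t)%:E)%E).
  apply: ge0_le_integral; [exact: mI| | | |].
  - move=> t _; rewrite lee_fin; apply: addr_ge0; last by rewrite mulr_ge0 ?sqr_ge0.
    by rewrite le_min sqr_ge0 divr_ge0// ltW.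
  - apply/measurable_EFinP; apply: measurable_funD.
      apply: measurable_minr; last exact: measurable_cst.
      by apply: measurable_funX; apply: measurable_funTS; apply: continuous_measurable_fun; apply: chain_continuous recov_chain _; lia.
    apply: measurable_funM; first exact: measurable_cst.
    by apply: measurable_funX; apply: measurable_funTS; apply: continuous_measurable_fun; exact: recov_top_continuous.
  - by apply/measurable_EFinP; apply: L1_measurable; apply: L1D => //; exact: L1Z.
  - by move=> t _; rewrite lee_fin.
rewrite (RintE mI (@subset_refl _ I)); last by apply: L1D => //; exact: L1Z.
rewrite lee_fin (RintD mI (@subset_refl _ I) db2 (L1Z _ nL1)) (RintZ mI (@subset_refl _ I) _ nL1).
rewrite -addrA; apply: lerD; first exact: bern_approx_energy.
apply: (le_trans (ler_wpM2l W0 nI)).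
have -> : (1 / e + K * M) * ((size s)%:R * (e * mu)) = mu * (size s)%:R + K * M * (e * mu) * (size s)%:R.
  by field; rewrite gt_eqF.
rewrite lerD2l [leRHS]mulrAC; apply: ler_wpM2r; first by [].
(* All powers of e cancel and mu remains only as [mu ^- 3], so the dependence on k is that of
   [kap_hat] against the [k ^ 12] of [ck]. *)
have KM : K * M * (e * mu) = kap (k - 2) ^+ 2 * S * (Z ^+ 2 * mu ^- 3 / k%:R ^+ 12).
  rewrite /K /M /ck /c.
  have -> : e ^+ (2 * k - 1) = e ^+ (2 * k) / e.
    by rewrite -{2}(subnK (_ : 1 <= 2 * k)%N) ?addn1 ?exprSr ?mulfK ?gt_eqF//; lia.
  have -> : (mu ^+ (k - 2)) = mu ^+ k / mu ^+ 2.
    by rewrite -{2}(subnK (_ : 2 <= k)%N) ?exprD ?mulfK ?expf_neq0 ?gt_eqF//; lia.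
  have e2 : e ^+ (2 * k) = (e ^+ k) ^+ 2 by rewrite mulnC exprM.
  have m2 : mu ^+ (2 * k) = (mu ^+ k) ^+ 2 by rewrite mulnC exprM.
  rewrite exprVn [(e * mu) ^+ _]exprMn e2 m2; field.
  by rewrite pnatr_eq0 -lt0n k0 !expf_neq0 ?gt_eqF.
rewrite KM; apply: (@le_trans _ _ (16 ^+ 5 * k%:R ^+ 9 * (Z ^+ 2 * mu ^- 3 / k%:R ^+ 12))).
  apply: ler_wpM2r; last exact: kap_hat.
  by rewrite divr_ge0 ?exprn_ge0// mulr_ge0 ?sqr_ge0// invr_ge0 exprn_ge0// ltW.
have kR : 1 <= k%:R :> R by rewrite ler1n.
have -> : 16 ^+ 5 * k%:R ^+ 9 * (Z ^+ 2 * mu ^- 3 / k%:R ^+ 12) = (16 ^+ 5 * Z ^+ 2 * mu ^- 3 / k%:R) / k%:R ^+ 2.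
  by field; rewrite pnatr_eq0 -lt0n k0 gt_eqF.
rewrite ler_pdivrMr ?exprn_gt0 ?(lt_le_trans ltr01 kR)//.
rewrite -[leLHS]mulr1 ler_wpM2l ?exprn_ege1//.
by rewrite divr_ge0// mulr_ge0 ?invr_ge0 ?exprn_ge0 ?(ltW mu0)// mulr_ge0// sqr_ge0.
Qed.

(** A transition differs from its step only on [J a], of length [e * mu], and there by at most
    [|z a|]. *)
Lemma recov_L1 (d : R) : (forall t, 0 <= t <= 1 -> `|b.[t] - (C + prim g t)| <= d) ->
  (\int[leb]_(t in I) (`|recov 0 t - (C + prim g t + stepsum s z t)|)%:E <= (d + Z * (e * mu))%:E)%E.
Proof.
move=> hd; have [sL sI] := sum_int (fun a => normr_ge0 (z a)).
have mrec : measurable_fun I (recov 0).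
  by apply: measurable_funTS; apply: continuous_measurable_fun; apply: chain_continuous recov_chain _.
have mU : measurable_fun I (fun t => C + prim g t + stepsum s z t).
  apply: measurable_funD; last exact: stepsum_measurable.
  apply: measurable_funD; first exact: measurable_cst.
  by apply: measurable_funTS; apply: continuous_measurable_fun; apply: prim_continuous; exact: L2_L1.
apply: (@le_trans _ _ (\int[leb]_(t in I) (d + \sum_(a <- s) `|z a| * \1_(J a) t)%:E)%E).
  apply: ge0_le_integral; [exact: mI|by move=> t _; rewrite lee_fin| | |].
  - by apply/measurable_EFinP; apply: measurableT_comp => //; exact: measurable_funB.
  - by apply/measurable_EFinP; apply: measurable_funD; [exact: measurable_cst|exact: L1_measurable].
  - move=> t /I01E/andP[t0 t1]; rewrite lee_fin /recov derivn0.
    have -> : b.[t] + \sum_(a <- s) z a * (c ^+ 0 * profile k 0 (- (a * c) + c * t)) - (C + prim g t + stepsum s z t) =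
       (b.[t] - (C + prim g t)) + \sum_(a <- s) z a * (profile k 0 (- (a * c) + c * t) - (a < t)%R%:R).
      rewrite opprD addrACA; congr (_ + _); rewrite /stepsum -sumrB; apply: eq_bigr => a _.
      by rewrite expr0 mul1r mulrBr.
    apply: (le_trans (ler_normD _ _)); apply: lerD; first by apply: hd; rewrite !ltW.
    apply: (le_trans (ler_norm_sum _ _ _)); apply: ler_sum => a _; rewrite normrM ler_wpM2l//.
    have := inJ a t; rewrite indicE; case: (t \in J a) => [_|/negbT].
      have /andP[p0 p1] := profile_itv (- (a * c) + c * t) k0.
      move: (profile _ _ _) p0 p1 => P p0 p1; rewrite ler_norml -[true%:R]/(1 : R).
      by case: (a < t)%R; rewrite ?subr0 -?[true%:R]/(1 : R); apply/andP; split; lra.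
    rewrite negb_and -!leNgt => /orP[h|h].
      rewrite profile_le0//; have -> : (a < t)%R = false; last by rewrite subr0 normr0.
      apply/negbTE; rewrite -leNgt; move: h; rewrite addrC [c * t]mulrC subr_le0 ler_pM2r//.
    rewrite profile_ge1//; have -> : (a < t)%R; last by rewrite subrr normr0.
    by rewrite -(ltr_pM2r c0) -subr_gt0 [t * c]mulrC addrC; lra.
rewrite (RintE mI (@subset_refl _ I)); last by apply: L1D => //; exact: L1_cst.
rewrite lee_fin (RintD mI (@subset_refl _ I) (L1_cst d) sL); apply: lerD => //.
have := RintE mI (@subset_refl _ I) (L1_cst d).
by rewrite integral_cst// [X in (_ * X)%E](leb_I01 : _ = 1%E) mule1 => -[<-].
Qed.

End recovery.

Lemma limn_esup_le (x : nat -> \bar R) (l : R) :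
  (forall d : R, 0 < d -> exists N, forall n, (N <= n)%N -> (x n <= (l + d)%:E)%E) -> (limn_esup x <= l%:E)%E.
Proof.
move=> h; apply/lee_addgt0Pr => d d0; have [N hN] := h d d0.
rewrite limn_esup_lim (cvg_lim (@ereal_hausdorff R) (@cvg_esups_inf R x)).
apply: (@le_trans _ _ (esups x N)); first by apply: ereal_inf_lbound; exists N.
by apply: ge_ereal_sup => _ [n Nn <-]; rewrite -EFinD; exact: hN.
Qed.

Lemma ereal_cvg0 (x : nat -> \bar R) : (forall n, (0 <= x n)%E) ->
  (forall d : R, 0 < d -> exists N, forall n, (N <= n)%N -> (x n <= d%:E)%E) -> x @ \oo --> 0%E.
Proof.
move=> x0 h; have fin d n : (x n <= d%:E)%E -> x n \is a fin_num.
  by move=> xd; rewrite ge0_fin_numE// (le_lt_trans xd)// ltry.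
apply/fine_cvgP; split.
  by have [N hN] := h 1 ltr01; exists N => // n /hN; exact: fin.
apply/cvgrPdist_le => d d0; have [N hN] := h d d0; exists N => // n /hN xd.
rewrite sub0r normrN /= ger0_norm ?fine_ge0// -lee_fin fineK//; exact: fin xd.
Qed.

Lemma L1_cvg_measure (v : nat -> R -> R) u : L0 u -> (forall k, L0 (v k)) -> cvg_in_L1 v u -> cvg_in_measure v u.
Proof.
move=> mu_ mv vu d d0; have mI : measurable I by exact: measurable_I01.
apply: ereal_cvg0 => // e e0; have ed : 0 < e * d by exact: mulr_gt0.
have /fine_cvgP[hf] := vu; move=> /cvgrPdist_le/(_ _ ed) hc; have [N _ hN] := filterI hf hc.
exists N => n /hN[/= h1 h2]; set A := _ `&` _.
have mf : measurable_fun I (fun t => `|v n t - u t|).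
  by apply: measurableT_comp => //; apply: measurable_funB; [exact: mv|exact: mu_].
have mA : measurable A.
  have := mf mI `[d, +oo[%classic (measurable_itv _).
  by congr (measurable _); apply/seteqP; split => t [It h]; split=> //; move: h; rewrite /= in_itv /= andbT.
rewrite -(@lee_pmul2l _ d%:E) ?lte_fin// -integral_cst//.
apply: (@le_trans _ _ (\int[leb]_(t in I) (`|v n t - u t|)%:E)%E).
  apply: (@le_trans _ _ (\int[leb]_(t in A) (`|v n t - u t|)%:E)%E).
    apply: ge0_le_integral; [exact: mA|by move=> *; rewrite lee_fin ltW|exact: measurable_cst| |by move=> t []].
    by apply/measurable_EFinP; apply: measurable_funS mf => //; exact: subIsetl.
  apply: ge0_subset_integral; [exact: mA|exact: mI|exact/measurable_EFinP|by move=> *; rewrite lee_fin|exact: subIsetl].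
rewrite -(fineK h1) -EFinM lee_fin mulrC; move: h2; rewrite sub0r normrN; apply: le_trans; exact: ler_norm.
Qed.

Lemma recovery_sequence (mu : R) (eps : nat -> R) u C g (s : seq R) z : 0 < mu ->
  (forall n, 0 < eps n) -> (forall n, (4 <= n)%N -> eps n <= n%:R^-1) -> L0 u -> L2 g ->
  {ae leb, forall t, I t -> u t = C + prim g t + stepsum s z t} ->
  exists v : nat -> R -> R, [/\ forall k, continuous (v k), cvg_in_L1 v u &
    (limn_esup (fun k => Phi eps (ck mu) k (v k)) <= (\int[leb]_(t in I) (g t ^+ 2) + mu * (size s)%:R)%:E)%E].
Proof.
move=> mu0 e0 en Lu g2 uE; have mI : measurable I by exact: measurable_I01.
(* The terms below 4 are set to 0, which does not affect the limits. *)
pose v k := if (4 <= k)%N then recov mu C g s z k (eps k) 0 else (fun=> 0 : R).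
have cv k : continuous (v k).
  rewrite /v; case: ifPn => k4; last exact: cst_continuous.
  apply: (@chain_continuous R (recov mu C g s z k (eps k)) k 0%N); first exact: recov_chain.
  exact: leq_trans k4.
exists v; split=> //.
  apply: ereal_cvg0 => [n|d d0]; first by apply: integral_ge0 => t _; rewrite lee_fin.
  have d2 : 0 < d / 2 by rewrite divr_gt0.
  have [M hM] := bern_approx_cvg C g2 d2.
  have [N hN] := inv_nat_small ((\sum_(a <- s) `|z a|) * mu) d2.
  exists (maxn 4 (maxn (M + 2) N)) => n; rewrite !geq_max => /and3P[n4 nM nN].
  have h := @recov_L1 mu C g s z n (eps n) mu0 (e0 n) n4 g2 (d / 2).
  have {}h := h (hM (n - 2)%N ltac:(clear -nM; lia)).
  apply: (@le_trans _ _ (d / 2 + (\sum_(a <- s) `|z a|) * (eps n * mu))%:E).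
    apply: le_trans h; rewrite /v n4 le_eqVlt; apply/orP; left; apply/eqP.
    have mr : measurable_fun I (recov mu C g s z n (eps n) 0).
      by have := cv n; rewrite /v n4 => cr; apply: measurable_funTS; exact: continuous_measurable_fun.
    apply: ae_eq_integral => //.
    - by apply/measurable_EFinP; apply: measurableT_comp => //; apply: measurable_funB => //; exact: Lu.
    - apply/measurable_EFinP; apply: measurableT_comp => //; apply: measurable_funB => //.
      apply: measurable_funD; last exact: stepsum_measurable.
      apply: measurable_funD; first exact: measurable_cst.
      by apply: measurable_funTS; apply: continuous_measurable_fun; apply: prim_continuous; exact: L2_L1.
    - by apply: aeS uE => t ht /ht /= ->.
  rewrite lee_fin; have h2 := hN n nN; have h3 := en n n4.
  have Z0 : 0 <= (\sum_(a <- s) `|z a|) * mu by rewrite mulr_ge0 ?(ltW mu0)//; apply: sumr_ge0.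
  have : (\sum_(a <- s) `|z a|) * (eps n * mu) <= (\sum_(a <- s) `|z a|) * mu / n%:R.
    by rewrite (_ : _ * (_ * _) = (\sum_(a <- s) `|z a|) * mu * eps n); [exact: ler_wpM2l|ring].
  by clear -h2; lra.
apply: limn_esup_le => d d0.
have [N hN] := inv_nat_small (16 ^+ 5 * (\sum_(a <- s) `|z a|) ^+ 2 * mu ^- 3 * (size s)%:R) d0.
exists (maxn 4 N) => n; rewrite geq_max => /andP[n4 nN]; rewrite /v n4.
apply: (le_trans (@recov_energy mu C g s z n (eps n) mu0 (e0 n) n4 g2 eps erefl)).
by rewrite lee_fin lerD2l; exact: hN.
Qed.

End recovery_sequences.

(** * The two inequalities *)

Section gamma_inequalities.
Context {R : realType}.
Implicit Types (f g u v : R -> R) (p : {poly R}) (x y s t r : R) (m n N : nat).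
Local Notation leb := (@lebesgue_measure R).
Local Notation I := (@I01 R).

(** Every real level E above the lower limit bounds [MumfordShah mu u], through the structure of u
    found at that level. *)
Lemma liminf_inequality (mu : R) (eps : nat -> R) u (v : nat -> R -> R) : 0 < mu ->
  (forall n, 0 < eps n /\ ((4 <= n)%N -> eps n <= n%:R^-1 /\ admissible_eps mu n (eps n))) ->
  L0 u -> (forall k, L0 (v k)) -> cvg_in_measure v u ->
  (MumfordShah mu u <= limn_einf (fun k => Phi eps (ck mu) k (v k)))%E.
Proof.
move=> mu0 epsP Lu Lv vu; set l := limn_einf _.
have key (E : R) : (l < E%:E)%E -> (0 <= E%:E)%E /\ (MumfordShah mu u <= E%:E)%E.
  move=> lE; have [C [g [s [z [g2 us sI uE hE]]]]] := liminf_structure mu0 epsP Lu Lv vu lE.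
  split; last exact: le_trans (MumfordShah_le (ltW mu0) Lu g2 us sI uE) hE.
  apply: le_trans hE; apply: adde_ge0; last by rewrite lee_fin mulr_ge0// ltW.
  by apply: integral_ge0 => t _; rewrite lee_fin sqr_ge0.
case: l key => [r| |] key; last 2 first.
- exact: leey.
(* Such levels are nonnegative, so the lower limit is not minus infinity. *)
- have [h _] := key (-1) (ltNyr _); by move: h; rewrite lee_fin lerNr oppr0 ler10.
apply/lee_addgt0Pr => e e0; rewrite -EFinD; apply: (key _ _).2.
by rewrite lte_fin ltrDl.
Qed.

(** When the value at u is infinite, the constant sequence u serves. The alternative in the
    conclusion lets the same sequence be placed in [L0] or in [L1], whichever space is
    considered. *)
Lemma limsup_inequality (mu : R) (eps : nat -> R) u : 0 < mu ->
  (forall n, 0 < eps n) -> (forall n, (4 <= n)%N -> eps n <= n%:R^-1) -> L0 u ->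
  exists v : nat -> R -> R, [/\ (forall k, continuous (v k)) \/ (forall k, v k = u), cvg_in_L1 v u &
    (limn_esup (fun k => Phi eps (ck mu) k (v k)) <= MumfordShah mu u)%E].
Proof.
move=> mu0 e0 en Lu.
have [sbv|nsbv] := pselect (SBV2 u /\ finite_set (jump_set u)).
  have [su fj] := sbv; have [C [s [us js sI uE]]] := SBV2_finite_structure Lu su fj.
  have g2 : L2 (approx_gradient u) by case: su.
  have [v [cv v1 vE]] := recovery_sequence mu0 e0 en Lu g2 uE.
  exists v; split=> //; first by left.
  apply: (le_trans vE); rewrite /MumfordShah asboolT// js counting_seq// EFinD -EFinM leeD2r//.
  have ag2 : L1 (fun t => approx_gradient u t ^+ 2).
    apply/integrableP; split; first by apply/measurable_EFinP; apply: measurable_funX; case: g2.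
    apply: le_lt_trans g2.2; rewrite le_eqVlt; apply/orP; left; apply/eqP.
    by apply: eq_integral => x _; rewrite /= ger0_norm// sqr_ge0.
  by rewrite (RintE measurable_I01 (@subset_refl _ I) ag2).
exists (fun=> u); split; first by right.
  rewrite /cvg_in_L1; under eq_fun do under eq_integral do rewrite subrr normr0.
  by under eq_fun do rewrite integral0; exact: cvg_cst.
rewrite (_ : MumfordShah mu u = +oo%E) ?leey// /MumfordShah; case: asboolP => // su.
have nf : ~ finite_set (jump_set u) by move=> fj; apply: nsbv.
rewrite /counting asboolF// gt0_muley ?lte_fin// addey//.
rewrite gt_eqF// (lt_le_trans (ltNyr 0))//.
by apply: integral_ge0 => t _; rewrite lee_fin sqr_ge0.
Qed.

End gamma_inequalities.

Theorem proposition24 (R : realType) (mu : R) (mu_gt0 : 0 < mu) :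
  exists eps c : nat -> R,
    (forall k : nat, (2 <= k)%N -> 0 < eps k /\ 0 < c k) /\
    is_Gamma_limit L0 cvg_in_measure (Phi eps c) (MumfordShah mu) /\
    is_Gamma_limit L1 cvg_in_L1 (Phi eps c) (MumfordShah mu).
Proof.
have [eps epsP] := exists_eps mu_gt0; exists eps, (ck mu).
have e0 n : 0 < eps n by have [] := epsP n.
have en n : (4 <= n)%N -> eps n <= n%:R^-1 by move=> n4; have [_ /(_ n4)[]] := epsP n.
split=> [k k2|]; first by split=> //; apply: ck_gt0 => //; exact: leq_trans k2.
(* Convergence in [L1] implies convergence in measure: the lower bound is proved for the weaker
   convergence and the recovery sequence is built for the stronger one, which covers both
   statements. *)
split=> u Lu; split.
- by move=> v Lv vu; exact: liminf_inequality.
- have [v [hv v1 vE]] := limsup_inequality mu_gt0 e0 en Lu.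
  have Lv k : L0 (v k).
    by case: hv => [cv|->//]; apply: measurable_funTS; exact: continuous_measurable_fun.
  by exists v; split=> //; exact: L1_cvg_measure.
- move=> v Lv vu; have mv k : L0 (v k) := L1_measurable (Lv k).
  have mu_ : L0 u := L1_measurable Lu.
  by apply: liminf_inequality => //; exact: L1_cvg_measure.
- have [v [hv v1 vE]] := limsup_inequality mu_gt0 e0 en (L1_measurable Lu).
  exists v; split=> // k; by case: hv => [cv|->//]; exact: L1_continuous.
Qed.
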